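(* Let ${\bf Y}_1={\bf X}_1+{\bf Z}_1$ and ${\bf Y}_2={\bf X}_2+{\bf Z}_2$, where ${\bf X}_1,{\bf X}_2,{\bf Z}_1,{\bf Z}_2$ are mutually independent $d$-dimensional real random vectors, ${\bf Y}_1,{\bf Y}_2$ have finite second moments, and ${\bf Z}_i\sim\mathcal N({\bf 0},{\bf Q}_{{\bf Z}_i})$ with ${\bf Q}_{{\bf Z}_i}$ positive definite, $i=1,2$. Suppose ${\bf Y}_1+{\bf Y}_2$ and ${\bf Y}_1-{\bf Y}_2$ are $\epsilon$-dependent. Then for all $\epsilon$ below some positive threshold and for $i=1,2$, $$|h({\bf Y}_i)-h({\bf Y}_{g,i})|\le B(\epsilon)\quad\text{and}\quad \mathbb E[{\bf Y}_{g,i}{\bf Y}_{g,i}^T]\preceq\mathbb E[{\bf Y}_i{\bf Y}_i^T]+B(\epsilon){\bf I}_d,$$ where ${\bf Y}_{g,1},{\bf Y}_{g,2}$ are Gaussian random vectors with the same covariance matrix (so $h({\bf Y}_{g,1})=h({\bf Y}_{g,2})$), and $B(\epsilon)\to0$ as $\epsilon\to0$ with $B(0)=0$.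
   Context: $h(\cdot)$ denotes differential entropy. ${\bf A}\preceq{\bf B}$ means ${\bf B}-{\bf A}$ is positive semi-definite; ${\bf I}_d$ is the $d\times d$ identity. Random vectors ${\bf U}_1,{\bf U}_2$ are $\epsilon$-dependent if $|\mathbb E[e^{j{\bf t}_1^T{\bf U}_1+j{\bf t}_2^T{\bf U}_2}]-\mathbb E[e^{j{\bf t}_1^T{\bf U}_1}]\mathbb E[e^{j{\bf t}_2^T{\bf U}_2}]|\le\epsilon$ for all ${\bf t}_1,{\bf t}_2\in\mathbb R^d$ ($j=\sqrt{-1}$). *)

(* Defs.v *)
From HB Require Import structures.
From mathcomp Require Import all_boot all_order all_algebra.
From mathcomp Require Import all_classical all_reals all_analysis.
Set Implicit Arguments. Unset Strict Implicit. Unset Printing Implicit Defensive.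
Import Order.TTheory GRing.Theory Num.Theory.
Local Open Scope ring_scope.
Local Open Scope classical_set_scope.

Section Defs.
Variable R : realType.

(* d-dimensional real vectors: d.-tuple R, carrying the product (Borel)
   sigma-algebra generated by the coordinate projections. *)
Definition vec (d : nat) := d.-tuple R.
Definition vcoord d (x : d.-tuple R) (i : 'I_d) : R := tnth x i.
Definition vadd d (x y : d.-tuple R) : d.-tuple R :=
  [tuple tnth x i + tnth y i | i < d].
Definition vsub d (x y : d.-tuple R) : d.-tuple R :=
  [tuple tnth x i - tnth y i | i < d].
Definition vzero d : d.-tuple R := [tuple (0 : R) | i < d].
Definition dotv d (t x : d.-tuple R) : R := \sum_(i < d) tnth t i * tnth x i.

Definition quadf d (A : 'M[R]_d) (x : d.-tuple R) : R :=
  \sum_(i < d) \sum_(j < d) tnth x i * A i j * tnth x j.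
Definition symmetric_mx d (A : 'M[R]_d) : Prop := A^T = A.
Definition posdef d (A : 'M[R]_d) : Prop :=
  symmetric_mx A /\ forall x : d.-tuple R, x <> vzero d -> 0 < quadf A x.
Definition psd d (A : 'M[R]_d) : Prop :=
  symmetric_mx A /\ forall x : d.-tuple R, 0 <= quadf A x.
Definition loewner_le d (A B : 'M[R]_d) : Prop := psd (B - A).

Section Prob.
Context {dT : measure_display} {T : measurableType dT} (P : probability T R).

Definition random_vec d (X : T -> d.-tuple R) : Prop :=
  measurable_fun [set: T] X.

Definition mutually_independent n d (X : 'I_n -> T -> d.-tuple R) : Prop :=
  (forall i, random_vec (X i)) /\
  forall B : 'I_n -> set (d.-tuple R), (forall i, measurable (B i)) ->
    P (\big[setI/setT]_(i < n) (X i @^-1` B i)) =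
    (\prod_(i < n) P (X i @^-1` B i))%E.

(* real number E[f] (used only for bounded/integrable f) *)
Definition Ere (f : T -> R) : R := fine (expectation P f).

Definition finite_second_moment d (Y : T -> d.-tuple R) : Prop :=
  forall i : 'I_d, (expectation P (fun w => (tnth (Y w) i ^+ 2)%R) < +oo)%E.

Definition second_moment_mx d (Y : T -> d.-tuple R) : 'M[R]_d :=
  \matrix_(i, j) Ere (fun w => tnth (Y w) i * tnth (Y w) j).

(* U ~ N(m, K): characteristic function E[e^{j t^T U}] = e^{j t^T m - t^T K t/2},
   written through real and imaginary parts. *)
Definition gaussian_vec d (U : T -> d.-tuple R) (m : d.-tuple R) (K : 'M[R]_d)
  : Prop :=
  random_vec U /\ psd K /\
  forall t : d.-tuple R,
    Ere (fun w => cos (dotv t (U w))) = cos (dotv t m) * expR (- (quadf K t / 2)) /\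
    Ere (fun w => sin (dotv t (U w))) = sin (dotv t m) * expR (- (quadf K t / 2)).

(* epsilon-dependence via characteristic functions:
   |E[e^{j(t1.U1 + t2.U2)}] - E[e^{j t1.U1}] E[e^{j t2.U2}]| <= eps,
   the complex modulus being written out with real and imaginary parts. *)
Definition eps_dependent d (U1 U2 : T -> d.-tuple R) (eps : R) : Prop :=
  forall t1 t2 : d.-tuple R,
    let a := Ere (fun w => cos (dotv t1 (U1 w) + dotv t2 (U2 w))) in
    let b := Ere (fun w => sin (dotv t1 (U1 w) + dotv t2 (U2 w))) in
    let c1 := Ere (fun w => cos (dotv t1 (U1 w))) in
    let s1 := Ere (fun w => sin (dotv t1 (U1 w))) in
    let c2 := Ere (fun w => cos (dotv t2 (U2 w))) in
    let s2 := Ere (fun w => sin (dotv t2 (U2 w))) in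
    Num.sqrt ((a - (c1 * c2 - s1 * s2)) ^+ 2 + (b - (c1 * s2 + s1 * c2)) ^+ 2)
      <= eps.

End Prob.

(* mu is Lebesgue measure on R^d: it gives every closed box its volume
   (this determines mu on the product Borel sigma-algebra). *)
Definition lebesgue_vec d (mu : {measure set (d.-tuple R) -> \bar R}) : Prop :=
  forall a b : d.-tuple R,
    mu [set x | forall i, tnth a i <= tnth x i <= tnth b i] =
    (\prod_(i < d) (Num.max (tnth b i - tnth a i) 0)%:E)%E.

Definition density_of d (mu : {measure set (d.-tuple R) -> \bar R})
  {dT : measure_display} {T : measurableType dT} (P : probability T R)
  (Y : T -> d.-tuple R) (f : d.-tuple R -> R) : Prop :=
  measurable_fun [set: d.-tuple R] f /\ (forall x, 0 <= f x) /\
  forall A, measurable A -> P (Y @^-1` A) = (\int[mu]_(x in A) (f x)%:E)%E.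

Definition diff_entropy d (mu : {measure set (d.-tuple R) -> \bar R})
  (f : d.-tuple R -> R) : \bar R :=
  (- \int[mu]_x (f x * ln (f x))%:E)%E.

End Defs.

(* Main.v *)
(* The characteristic functions of Y1 and Y2, centred at the means, satisfy up to
   eps the equation phi1 (u + v) phi2 (u - v) = phi1 u phi2 u phi1 v (phi2 v)^*.
   For eps = 0 the squared modulus [a] is the same for both, nowhere zero, and
   - ln a obeys the parallelogram law, hence is a quadratic form K; the phase
   doubles at each doubling of the argument but is quadratically small at the
   origin, so it vanishes and both laws are N(m_i, K). For small eps an
   ultrafilter limit of hypothetical counterexamples, which are equicontinuous by
   the moment bound, solves the exact equation; so on any given ball both
   characteristic functions are close to exp (- K / 2) for some K, with K between
   l I and 4 M I.
     The noise Z_i splits off an independent N(0, l I), so Y_i has a bounded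
   density that is an inverse Fourier integral against a Gaussian weight: closeness
   of characteristic functions on a large ball gives uniform closeness of the
   densities, and with the second-moment bound closeness of the entropies. The
   Loewner bound comes from the expansion of the characteristic functions at the
   origin. Finally B is the infimum of the admissible bounds, plus eps. *)
Require Import Defs.
From HB Require Import structures.
From mathcomp Require Import all_boot all_order all_algebra.
From mathcomp Require Import all_classical all_reals all_analysis.
From mathcomp Require Import measurable_realfun.
From mathcomp Require Import ring lra.
Set Implicit Arguments. Unset Strict Implicit. Unset Printing Implicit Defensive.
Import Order.TTheory GRing.Theory Num.Theory.
Import numFieldNormedType.Exports.
Local Open Scope ring_scope.
Local Open Scope classical_set_scope.

(** Complex quantities are carried as cosine and sine integrals. Most formulas keep a free phase [c]
    in [cos (dotv t x + c)]: the values [c = 0] and [c = pi / 2] then give the real and the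
    imaginary part from one identity. The obstacle is uniformity: [B] is fixed before the
    probability space and may depend on the laws only through the moment bound [M] and the noise
    level [l]. Hence [chreg] lists closed conditions with constants in [M] and [l], and compactness
    is applied to functions rather than to laws. It yields no rate, which is why [B] is an infimum.
    Centring makes the phase quadratically small at the origin, and it multiplies the error of the
    functional equation by a number of modulus one only. The inverse Fourier integral is elementary
    here: a Gaussian density is, up to scale, the characteristic function of another Gaussian law,
    so a smoothed density is an average of characteristic functions ([sdensE]). The same formula
    gives the uniqueness theorem, which identifies the law of [Y_i] as a smoothed one. The case
    [eps = 0] is treated apart: small-[eps] statements give a matrix [K] for each tolerance, whereas
    [B 0 = 0] needs a single one. *)

Section Pushforward.
Context {R : realType} {d1 d2 : measure_display}.
Context {T1 : measurableType d1} {T2 : measurableType d2}.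

Definition pushprob (P : probability T1 R) (f : T1 -> T2)
    (mf : measurable_fun [set: T1] f) : probability T2 R :=
  distribution P (HB.pack f (isMeasurableFun.Build _ _ _ _ f mf) : {mfun T1 >-> T2}).

Lemma integral_pushprob (P : probability T1 R) (f : T1 -> T2) (mf : measurable_fun [set: T1] f) (g : T2 -> \bar R) :
  measurable_fun [set: T2] g -> (forall y, 0 <= g y)%E ->
  (\int[@pushprob P f mf]_y g y = \int[P]_x g (f x))%E.
Proof. by move=> mg g0; rewrite ge0_integral_distribution. Qed.

End Pushforward.

(** * Finite powers of a measure, on tuples *)

Section TuplePower.
Context {R : realType}.

Definition tcons d (x : R * d.-tuple R) : d.+1.-tuple R := [tuple of x.1 :: x.2].
Definition tuncons d (x : d.+1.-tuple R) : R * d.-tuple R :=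
  (thead x, [tuple of behead x]).

Lemma tconsK d : cancel (@tcons d) (@tuncons d).
Proof.
move=> [a x]; rewrite /tcons /tuncons /= theadE; congr pair.
by apply: val_inj.
Qed.

Lemma measurable_tcons d : measurable_fun setT (@tcons d).
Proof. exact: (measurable_cons measurable_fst measurable_snd). Qed.

Lemma measurable_tuncons d : measurable_fun setT (@tuncons d).
Proof.
apply: measurable_fun_pair => /=; last exact: measurable_behead.
exact: (measurable_tnth ord0).
Qed.

Section succ.
Variables (m : {sigma_finite_measure set R -> \bar R}) (d : nat)
  (n : {sigma_finite_measure set (d.-tuple R) -> \bar R}).

Definition mcons : set (d.+1.-tuple R) -> \bar R := pushforward (m \x n)%E (@tcons d).

Let mcons0 : mcons set0 = 0%E.
Proof. by rewrite /mcons /pushforward preimage_set0 measure0. Qed.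

Let mcons_ge0 A : (0 <= mcons A)%E.
Proof. exact: (measure_ge0 (m \x n)%E). Qed.

Let mcons_semi_sigma_additive : semi_sigma_additive mcons.
Proof.
have mf := @measurable_tcons d.
move=> F mF tF mUF; rewrite /mcons /pushforward preimage_bigcup.
apply: measure_semi_sigma_additive.
- by move=> k; rewrite -[X in measurable X]setTI; apply: mf.
- apply/trivIsetP => /= i j _ _ ij; rewrite -preimage_setI.
  by move/trivIsetP : tF => /(_ _ _ _ _ ij) ->//; rewrite preimage_set0.
- by rewrite -preimage_bigcup -[X in measurable X]setTI; exact: mf.
Qed.

HB.instance Definition _ := isMeasure.Build _ _ _ mcons
  mcons0 mcons_ge0 mcons_semi_sigma_additive.

Let mcons_sigma_finite : sigma_finite setT mcons.
Proof.
have /sigma_finiteP[F [TF ndF Foo]] := sigma_finiteT m.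
have /sigma_finiteP[G [TG ndG Goo]] := sigma_finiteT n.
exists (fun k => @tuncons d @^-1` (F k `*` G k)).
  rewrite -preimage_bigcup -(preimage_setT (@tuncons d)); congr (_ @^-1` _).
  apply/seteqP; split=> [[x y] _|//].
  have : setT x by []. have : setT y by []. rewrite TF TG => -[j _ Gy] [i _ Fx].
  exists (maxn i j) => //; split => /=.
    by move: x Fx; exact/subsetPset/ndF/leq_maxl.
  by move: y Gy; exact/subsetPset/ndG/leq_maxr.
move=> k; have [mF Fk] := Foo k; have [mG Gk] := Goo k; split.
  rewrite -[X in measurable X]setTI; apply: measurable_tuncons => //.
  exact: measurableX.
rewrite /mcons /pushforward -comp_preimage (_ : tuncons (d := d) \o _ = id).
  rewrite preimage_id product_measure1E// lte_mul_pinfty// ge0_fin_numE//.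
by apply/funext => x /=; rewrite tconsK.
Qed.

HB.instance Definition _ := Measure_isSigmaFinite.Build _ _ _ mcons
  mcons_sigma_finite.

Lemma integral_mcons (f : d.+1.-tuple R -> \bar R) :
  measurable_fun [set: d.+1.-tuple R] f -> (forall x, 0 <= f x)%E ->
  (\int[mcons]_z f z = \int[m]_x \int[n]_y f (tcons (x, y)))%E.
Proof.
move=> mf f0.
rewrite (_ : (\int[mcons]_z f z = \int[pushforward (m \x n)%E (@tcons d)]_z f z)%E)//.
rewrite ge0_integral_pushforward//; last exact: measurable_tcons.
rewrite preimage_setT fubini_tonelli1//=.
apply: measurableT_comp => //; exact: measurable_tcons.
Qed.

End succ.

Variable m : {sigma_finite_measure set R -> \bar R}.

(** One recursion serves both Lebesgue measure ([lebV]) and the Gaussian law ([gaussV]), so the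
    density of the second against the first is an induction on [d]. *)
Fixpoint mpow d : {sigma_finite_measure set (d.-tuple R) -> \bar R} :=
  match d with
  | 0 => \d_ [tuple]
  | k.+1 => mcons m (mpow k)
  end.

Lemma integral_mpow0 (f : 0.-tuple R -> \bar R) :
  measurable_fun [set: 0.-tuple R] f ->
  (\int[mpow 0]_z f z = f [tuple])%E.
Proof. by move=> mf; rewrite integral_dirac// diracT mul1e. Qed.

Lemma integral_mpowS d (f : d.+1.-tuple R -> \bar R) :
  measurable_fun [set: d.+1.-tuple R] f -> (forall x, 0 <= f x)%E ->
  (\int[mpow d.+1]_z f z = \int[m]_x \int[mpow d]_y f (tcons (x, y)))%E.
Proof. exact: integral_mcons. Qed.

End TuplePower.

(** * Lebesgue measure on tuples *)

Section Boxes.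
Context {R : realType} {d : nat}.
Implicit Types a b x : d.-tuple R.

Definition box a b : set (d.-tuple R) :=
  [set x | forall i, tnth a i <= tnth x i <= tnth b i].

Definition cube (k : nat) : set (d.-tuple R) :=
  box [tuple - k%:R | i < d] [tuple k%:R | i < d].

Definition boxes : set (set (d.-tuple R)) := [set A | exists a b, A = box a b].

Lemma measurable_box a b : measurable (box a b).
Proof.
rewrite (_ : box a b = \bigcap_(i in [set: 'I_d]) ((@tnth d R ^~ i) @^-1` `[tnth a i, tnth b i])).
  apply: fin_bigcap_measurable => // i _.
  by rewrite -[X in measurable X]setTI; apply: measurable_tnth => //; exact: measurable_itv.
by apply/seteqP; split=> [x xab i _ /=|x xab i]; [rewrite in_itv/=|have := xab i I; rewrite /= in_itv/=].
Qed.

Lemma boxesI : setI_closed boxes.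
Proof.
move=> _ _ [a [b ->]] [a' [b' ->]].
exists [tuple Num.max (tnth a i) (tnth a' i) | i < d].
exists [tuple Num.min (tnth b i) (tnth b' i) | i < d].
apply/seteqP; split=> [x [h h'] i|x h].
  by rewrite !tnth_mktuple ge_max le_min; have /andP[-> ->] := h i; have /andP[-> ->] := h' i.
by split=> i; have := h i; rewrite !tnth_mktuple ge_max le_min;
  move=> /andP[/andP[? ?] /andP[? ?]]; apply/andP.
Qed.

Lemma bigcup_cube : \bigcup_k cube k = setT.
Proof.
apply/seteqP; split=> // x _.
exists (Num.truncn (\sum_(i < d) `|tnth x i|)).+1 => // i.
rewrite !tnth_mktuple -ler_norml ltW//.
apply: (le_lt_trans _ (truncnS_gt _)).
by rewrite (bigD1 i)//= lerDl sumr_ge0.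
Qed.

(** A half-space given by one coordinate is a countable union of boxes that grow in the other
    directions, so the coordinate projections are measurable for the sigma-algebra of boxes. *)
Lemma measurable_boxesE : measurable = <<s boxes >> :> set (set (d.-tuple R)).
Proof.
apply/seteqP; split; last first.
  apply: smallest_sub; first exact: sigma_algebra_measurable.
  by move=> _ [a [b ->]]; exact: measurable_box.
have mi (i : 'I_d) : @measurable_fun _ _ (g_sigma_algebraType boxes) R setT (@tnth d R ^~ i).
  apply: (measurability _ (RGenCInfty.measurableE R)) => _ [_ [r ->] <-].
  rewrite setTI (_ : _ @^-1` _ = \bigcup_k
    box [tuple (if j == i then r else - k%:R) | j < d] [tuple k%:R | j < d]).
    apply: bigcupT_measurable => k; apply: sub_sigma_algebra.
    by eexists; eexists.
  apply/seteqP; split=> [x /=|x [k _ /(_ i)]]; last first.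
    by rewrite !tnth_mktuple eqxx /= in_itv/= andbT => /andP[].
  rewrite in_itv/= andbT => rx.
  have : setT x by [].
  rewrite -bigcup_cube => -[k _ xk]; exists k => // j.
  have := xk j; rewrite !tnth_mktuple => /andP[kx ->].
  by case: eqVneq => [->|_]; rewrite ?rx ?kx.
apply: smallest_sub; first exact: smallest_sigma_algebra.
rewrite -bigcup_seq => A [i _ [B mB <-]].
exact: (mi i).
Qed.

(** Boxes are stable under intersection and generate the sigma-algebra, and the cubes exhaust the
    space with finite mass: the uniqueness theorem for measures applies. *)
Lemma measure_eq_boxes (m1 m2 : {measure set (d.-tuple R) -> \bar R}) :
  (forall a b, m1 (box a b) = m2 (box a b)) ->
  (forall k, m1 (cube k) < +oo)%E ->
  forall A, measurable A -> m1 A = m2 A.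
Proof.
move=> m12 moo A mA; apply: (measure_unique boxes cube) => //.
- exact: measurable_boxesE.
- exact: boxesI.
- by move=> k; eexists; eexists.
- exact: bigcup_cube.
- by move=> _ [a [b ->]].
Qed.

End Boxes.

Section LebesgueTuple.
Context {R : realType}.

Lemma measurable_idR : measurable_fun [set: measurableTypeR R] (idfun : measurableTypeR R -> R).
Proof. by move=> _ A mA; rewrite setTI. Qed.

(** The identity carries [lebesgue_measure] from [measurableTypeR R] to the measurable structure of
    [R] itself, on which tuples are built. *)
Definition lebR : set R -> \bar R :=
  pushforward (@lebesgue_measure R) (idfun : measurableTypeR R -> R).

Let lebR0 : lebR set0 = 0%E. Proof. exact: (measure0 (@lebesgue_measure R)). Qed.
Let lebR_ge0 A : (0 <= lebR A)%E. Proof. exact: (measure_ge0 (@lebesgue_measure R)). Qed.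
Let lebR_sigma_additive : semi_sigma_additive lebR.
Proof. exact: (@measure_semi_sigma_additive _ _ _ (@lebesgue_measure R)). Qed.
HB.instance Definition _ := isMeasure.Build _ _ _ lebR
  lebR0 lebR_ge0 lebR_sigma_additive.
Let lebR_sigma_finite : sigma_finite setT lebR.
Proof. exact: (sigma_finiteT (@lebesgue_measure R)). Qed.
HB.instance Definition _ := Measure_isSigmaFinite.Build _ _ _ lebR lebR_sigma_finite.

Lemma lebR_itv (a b : R) : lebR `[a, b] = (Num.max (b - a) 0)%:E.
Proof.
rewrite /lebR /pushforward preimage_id lebesgue_measure_itv/= lte_fin.
case: ifPn => ab; first by rewrite max_l// subr_ge0 ltW.
by rewrite max_r// subr_le0 leNgt.
Qed.

Lemma integral_lebR (f : R -> \bar R) : measurable_fun [set: R] f ->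
  (forall x, 0 <= f x)%E ->
  (\int[lebR]_x f x = \int[lebesgue_measure]_x f x)%E.
Proof.
move=> mf f0.
transitivity (\int[pushforward (@lebesgue_measure R) (idfun : measurableTypeR R -> R)]_x f x)%E => //.
rewrite ge0_integral_pushforward//.
exact: measurable_idR.
Qed.

Definition lebV d := mpow (lebR : {sigma_finite_measure set R -> \bar R}) d.

Lemma tnth_beheadE (T : Type) d (a : d.+1.-tuple T) i :
  tnth [tuple of behead a] i = tnth a (lift ord0 i).
Proof.
rewrite tnth_behead; congr tnth; apply: val_inj.
by rewrite /= inordK// ltnS.
Qed.

Lemma mpow_box (m : {sigma_finite_measure set R -> \bar R}) d (a b : d.-tuple R) :
  (mpow m d (box a b) = \prod_(i < d) m `[tnth a i, tnth b i]%classic)%E.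
Proof.
elim: d a b => [|d IHd] a b.
  rewrite big_ord0 /= diracE (_ : _ \in _)//; apply/mem_set => i; by case: i.
rewrite big_ord_recl /=.
rewrite (_ : mcons _ _ _ = (m \x mpow m d)%E (`[tnth a ord0, tnth b ord0]%classic `*`
   box [tuple of behead a] [tuple of behead b])).
  rewrite product_measure1E//=; [|exact: measurable_box].
  rewrite IHd; congr (_ * _)%E; apply: eq_bigr => i _.
  by rewrite !tnth_beheadE.
rewrite /mcons /pushforward; congr (_ _).
apply/seteqP; split=> [[x y] /= h|[x y] /= [h1 h2] i].
  split; first by have := h ord0; rewrite /tcons tnth0 in_itv.
  by move=> i; rewrite !tnth_beheadE; have := h (lift ord0 i); rewrite /tcons tnthS.
move: h1; rewrite in_itv /= => h1.
case: (unliftP ord0 i) => [j ->|->]; last by rewrite /tcons tnth0.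
rewrite /tcons tnthS; by have := h2 j; rewrite !tnth_beheadE.
Qed.

Lemma lebesgue_vec_lebV d : lebesgue_vec (lebV d).
Proof.
move=> a b; apply: etrans (mpow_box _ a b) _; apply: eq_bigr => i _.
by rewrite -lebR_itv.
Qed.

Lemma lebesgue_vec_box_fin d (mu : {measure set (d.-tuple R) -> \bar R}) a b :
  lebesgue_vec mu -> (mu (box a b) < +oo)%E.
Proof.
move=> hmu; rewrite /box hmu; 
by rewrite prodEFin ltry.
Qed.

Lemma lebesgue_vec_unique d (mu nu : {measure set (d.-tuple R) -> \bar R}) :
  lebesgue_vec mu -> lebesgue_vec nu -> forall A, measurable A -> mu A = nu A.
Proof.
move=> hmu hnu; apply: measure_eq_boxes => [a b|k]; last exact: lebesgue_vec_box_fin.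
by rewrite /box hmu hnu.
Qed.

Lemma measurable_vadd_cst d (c : d.-tuple R) : measurable_fun setT (fun x => vadd x c).
Proof.
apply/measurable_fun_tnthP => i.
rewrite (_ : _ \o _ = fun x => tnth x i + tnth c i); last first.
  by apply/funext => x /=; rewrite tnth_mktuple.
by apply: measurable_funD => //; exact: measurable_tnth.
Qed.

(** Translation invariance comes from uniqueness: the image of [lebV d] under a shift still gives
    every box its volume. *)
Lemma integral_lebV_shift d (c : d.-tuple R) (f : d.-tuple R -> \bar R) :
  measurable_fun [set: d.-tuple R] f -> (forall x, 0 <= f x)%E ->
  (\int[lebV d]_x f (vadd x c) = \int[lebV d]_x f x)%E.
Proof.
move=> mf f0.
have mc := measurable_vadd_cst c.
have <- : (\int[pushforward (lebV d) (fun x => vadd x c)]_x f x = 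
   \int[lebV d]_x f (vadd x c))%E.
  by rewrite ge0_integral_pushforward.
apply: eq_measure_integral => A mA _; apply: lebesgue_vec_unique => //; last exact: lebesgue_vec_lebV.
move=> a b.
have -> : [set x | forall i, tnth a i <= tnth x i <= tnth b i] =
    (fun x => vsub x c) @^-1` box (vsub a c) (vsub b c).
  apply/seteqP; split=> x h i; have := h i.
    by rewrite !tnth_mktuple !lerD2r.
  by rewrite !tnth_mktuple !lerD2r.
rewrite /= /pushforward -comp_preimage.
rewrite (_ : (vsub (d:=d))^~ c \o (vadd (d:=d))^~ c = id); last first.
  by apply/funext => x; apply/eq_from_tnth => i; rewrite !tnth_mktuple addrK.
rewrite preimage_id; apply: etrans (lebesgue_vec_lebV _ _) _.
by apply: eq_bigr => i _; rewrite !tnth_mktuple; congr (Num.max _ _)%:E; ring.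
Qed.

End LebesgueTuple.

(** * Gaussian product measures *)

Section NormalChf1.
Context {R : realType}.
Notation mu := (@lebesgue_measure R).
Implicit Types (f g G : R -> R).

(* The fundamental theorem of calculus on [-n, n], as n goes to infinity. *)
Lemma integral_derive_eq0 G g : (forall x : R, is_derive x 1 G (g x)) ->
  continuous g -> mu.-integrable setT (EFin \o g) ->
  G n%:R @[n --> \oo] --> 0 -> G (- n%:R) @[n --> \oo] --> 0 ->
  (\int[mu]_x (g x)%:E = 0)%E.
Proof.
move=> dG cg ig G0 GN0.
have /measurable_EFinP mg := measurable_int mu ig.
pose gn n x := ((g \_ `[- n%:R, n%:R]) x)%:E.
have cvgn : (\int[mu]_x gn n x @[n --> \oo] --> \int[mu]_x (g x)%:E)%E.
  apply: (@dominated_cvg _ _ _ mu setT measurableT gn (EFin \o g) (fun x => `|g x|%:E)).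
  - move=> n; apply/measurable_EFinP.
    by apply/(measurable_restrictT _ _).1 => //; exact: measurable_funTS.
  - move=> x _; apply: cvg_near_cst; near=> n.
    rewrite /gn patchE ifT// inE/= in_itv/= -ler_norml.
    near: n; exact: nbhs_infty_ger.
  - by [].
  - exact: integrable_abse ig.
  - move=> n x _; rewrite /gn patchE; case: ifPn => _; first by rewrite lexx.
    by rewrite /= normr0 lee_fin.
(* [n.+1] rather than [n], since the fundamental theorem asks for a nondegenerate interval. *)
have En n : (\int[mu]_x gn n.+1 x = (G n.+1%:R - G (- n.+1%:R))%:E)%E.
  rewrite /gn.
  rewrite [LHS](_ : _ = \int[mu]_(x in `[(- n.+1%:R)%R, n.+1%:R%R]) (g x)%:E)%E; last first.
    by rewrite [RHS]integral_mkcond restrict_EFin.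
  rewrite (@continuous_FTC2 _ g G)//.
  - by apply: (@lt_trans _ _ 0); rewrite ?oppr_lt0 ltr0n.
  - exact: continuous_subspaceT.
  - split => [x _||].
    + by have [] := dG x.
    + apply: cvg_at_right_filter; apply: differentiable_continuous.
      by apply/derivable1_diffP; have [] := dG (- n.+1%:R).
    + apply: cvg_at_left_filter; apply: differentiable_continuous.
      by apply/derivable1_diffP; have [] := dG n.+1%:R.
  - by move=> x _; rewrite derive1E; exact: derive_val.
have : ((G n.+1%:R - G (- n.+1%:R))%:E @[n --> \oo] --> 0%:E)%E.
  apply: cvg_EFin; first exact: nearW.
  rewrite -[0 in X in _ --> X]subr0; apply: cvgB.
    by rewrite (cvg_shiftS (fun n => G n%:R)).
  by rewrite (cvg_shiftS (fun n => G (- n%:R))).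
move=> h0.
have h1 : (\int[mu]_x gn n.+1 x @[n --> \oo] --> \int[mu]_x (g x)%:E)%E.
  by rewrite (cvg_shiftS (fun n => \int[mu]_x gn n x)%E).
move: h1; rewrite (eq_cvg _ _ En) => h1.
exact: (cvg_unique _ h1 h0).
Unshelve. all: end_near. Qed.

Variable s : R.
Hypothesis s0 : 0 < s.
Let p := normal_pdf 0 s.

Let pE x : p x = normal_peak s * expR (- (x ^+ 2 / (s ^+ 2 *+ 2))).
Proof. by rewrite /p normal_pdfE ?gt_eqF// /normal_fun subr0 mulNr. Qed.

Let dp (x : R) : is_derive x 1 p (- (x / s ^+ 2) * p x).
Proof.
rewrite (_ : p = fun x => normal_peak s * expR (- (x ^+ 2 / (s ^+ 2 *+ 2)))); last first.
  by apply/funext => y; exact: pE.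
apply: is_derive_eq.
rewrite /GRing.scale/= !mulr1.
have sn0 : s != 0 by rewrite gt_eqF.
by field.
Qed.

(** With [u = x^2 / (4 s^2)], half of the exponent absorbs the factor [|x|], since
    [|x| <= s (1 + u) <= s e^u]. What remains is a multiple of the normal density of variance
    [2 s^2], which yields both integrability and decay. *)
Let p_bound x : `|x| * p x <= s * (normal_peak s * expR (- (x ^+ 2 / (4 * s ^+ 2)))).
Proof.
have sn0 : s != 0 by rewrite gt_eqF.
rewrite pE [leLHS]mulrCA [leRHS]mulrCA ler_wpM2l ?normal_peak_ge0//.
set u := x ^+ 2 / (4 * s ^+ 2).
have -> : - (x ^+ 2 / (s ^+ 2 *+ 2)) = - u - u by rewrite /u; field.
rewrite expRD mulrA ler_wpM2r ?expR_ge0//.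
rewrite expRN ler_pdivrMr ?expR_gt0//.
apply: (@le_trans _ _ (s * (1 + u))); last first.
  by rewrite ler_wpM2l ?(ltW s0)// expR_ge1Dx.
have -> : s * (1 + u) = (`|x| - 2 * s) ^+ 2 / (4 * s) + `|x|.
  by rewrite /u -[x ^+ 2]real_normK ?num_real//; field.
by rewrite lerDr divr_ge0 ?sqr_ge0// mulr_ge0// ltW.
Qed.

Let integrable_xp : mu.-integrable setT (EFin \o (fun x => `|x| * p x)).
Proof.
pose q := normal_pdf 0 (s * Num.sqrt 2).
have s20 : s * Num.sqrt 2 != 0 by rewrite gt_eqF// mulr_gt0// sqrtr_gt0.
have iq : mu.-integrable setT (fun x => ((s * (normal_peak s / normal_peak (s * Num.sqrt 2))) * q x)%:E).
  under eq_fun do rewrite EFinM.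
  by apply: integrableZl => //; exact: integrable_normal_pdf.
apply: (le_integrable measurableT _ _ iq).
  apply/measurable_EFinP; apply: measurable_funM; first exact: normr_measurable.
  exact: measurable_normal_pdf.
move=> x _ /=; rewrite lee_fin.
rewrite [leRHS]ger0_norm; last first.
  by rewrite mulr_ge0 ?normal_pdf_ge0// mulr_ge0 ?(ltW s0)// divr_ge0 ?normal_peak_ge0.
rewrite ger0_norm ?mulr_ge0 ?normal_pdf_ge0//.
apply: le_trans (p_bound x) _; rewrite le_eqVlt; apply/orP; left; apply/eqP.
rewrite /q normal_pdfE// /normal_fun subr0.
have sn0 : s != 0 by rewrite gt_eqF.
have -> : - x ^+ 2 / ((s * Num.sqrt 2) ^+ 2 *+ 2) = - (x ^+ 2 / (4 * s ^+ 2)).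
  by rewrite exprMn sqr_sqrtr//; field.
have k0 : normal_peak (s * Num.sqrt 2) != 0 by rewrite gt_eqF// normal_peak_gt0.
by field.
Qed.

(** The map [e] stands for the identity or the opposite, so both boundary terms of the integration
    by parts vanish by one statement. *)
Let p_cvg0 (h : R -> R) (e : R -> R) : (forall x, `|h x| <= 1) -> (forall x, `|e x| = `|x|) ->
  s ^+ 2 * (h (e n%:R) * p (e n%:R)) @[n --> \oo] --> 0.
Proof.
move=> h1 he; apply/cvgr0Pnorm_le => r r0.
near=> n.
have n0 : (0 : R) < n%:R by near: n; exact: nbhs_infty_gtr.
rewrite normrM (ger0_norm (sqr_ge0 _)) normrM (ger0_norm (normal_pdf_ge0 _ _ _)).
have pn : p (e n%:R) <= s * normal_peak s / n%:R.
  rewrite ler_pdivlMr// mulrC -{1}(ger0_norm (ltW n0)) -he.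
  apply: le_trans (p_bound _) _; rewrite mulrA ler_piMr ?mulr_ge0 ?(ltW s0) ?normal_peak_ge0//.
  by rewrite -[leRHS]expR0 ler_expR oppr_le0 mulr_ge0 ?sqr_ge0// invr_ge0 mulr_ge0 ?sqr_ge0.
apply: (@le_trans _ _ (s ^+ 2 * (1 * (s * normal_peak s / n%:R)))).
  by rewrite ler_wpM2l ?sqr_ge0// ler_pM ?normal_pdf_ge0.
rewrite mul1r mulrA ler_pdivrMr// -ler_pdivrMl//.
by near: n; exact: nbhs_infty_ger.
Unshelve. all: end_near. Qed.

Let measurable_p : measurable_fun [set: measurableTypeR R] p.
Proof. exact: measurable_normal_pdf. Qed.

Let measurable_trig (h : R -> R) t c : continuous h ->
  measurable_fun [set: measurableTypeR R] (fun x : measurableTypeR R => h (t * x + c)).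
Proof.
move=> ch; apply: continuous_measurable_fun => x.
apply: (@continuous_comp _ _ _ (fun x => t * x + c) h) => //.
apply: cvgD; last exact: cvg_cst.
  by apply: cvgM; [exact: cvg_cst|exact: cvg_id].
exact: ch.
Qed.

Let integrable_Mp (h : R -> R) :
  measurable_fun [set: measurableTypeR R] h -> (forall x, `|h x| <= 1) ->
  mu.-integrable setT (EFin \o (fun x => h x * p x)).
Proof.
move=> mh h1; apply: (le_integrable measurableT _ _ (integrable_normal_pdf 0 s)).
  by apply/measurable_EFinP; apply: measurable_funM.
move=> x _ /=; rewrite lee_fin normrM.
by apply: ler_piMl.
Qed.

Let integrable_Mxp (h : R -> R) :
  measurable_fun [set: measurableTypeR R] h -> (forall x, `|h x| <= 1) ->
  mu.-integrable setT (EFin \o (fun x => - x * h x * p x)).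
Proof.
move=> mh h1; apply: (le_integrable measurableT _ _ integrable_xp).
  apply/measurable_EFinP; apply: measurable_funM => //; apply: measurable_funM => //.
move=> x _ /=; rewrite lee_fin !normrM normr_id normrN.
rewrite ler_wpM2r// ler_piMr//.
Qed.

(* Stein's identity for [y |-> sin (t * y + c)]. *)
Let stein t c :
  \int[mu]_x (- x * sin (t * x + c) * p x) = - (s ^+ 2 * t) * \int[mu]_x (cos (t * x + c) * p x).
Proof.
have sn0 : s != 0 by rewrite gt_eqF.
have mc := @measurable_trig cos t c (@continuous_cos R).
have ms := @measurable_trig sin t c (@continuous_sin R).
have ic := integrable_Mp mc (fun x => cos_max _).
have is_ := integrable_Mxp ms (fun x => sin_max _).
pose g x := (s ^+ 2 * t) * (cos (t * x + c) * p x) + (- x * sin (t * x + c) * p x).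
have igc : mu.-integrable setT (EFin \o (fun x => (s ^+ 2 * t) * (cos (t * x + c) * p x))).
  rewrite /comp; under eq_fun do rewrite EFinM.
  by apply: integrableZl.
have : (\int[mu]_x (g x)%:E = 0)%E.
  apply: (@integral_derive_eq0 (fun x => s ^+ 2 * (sin (t * x + c) * p x)) g).
  - move=> x; have := dp x => dpx.
    apply: is_derive_eq; rewrite /GRing.scale/= /g.
    by field.
  - move=> x; apply: differentiable_continuous; apply/derivable1_diffP.
    have := dp x => dpx; rewrite /g; exact: ex_derive.
  - rewrite /g /comp; under eq_fun do rewrite EFinD.
    exact: integrableD.
  - exact: (@p_cvg0 (fun x => sin (t * x + c)) id (fun x => sin_max _)).
  - exact: (@p_cvg0 (fun x => sin (t * x + c)) -%R (fun x => sin_max _) (@normrN _ _)).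
move=> /(congr1 fine); rewrite -/(Rintegral mu setT g) /g RintegralD// RintegralZl//=.
by move=> /eqP; rewrite addrC addr_eq0 mulNr => /eqP.
Qed.

Let F c t := \int[mu]_x (cos (t * x + c) * p x).

Let F0 c : F c 0 = cos c.
Proof.
rewrite /F; under eq_Rintegral do rewrite mul0r add0r.
rewrite RintegralZl//; last exact: integrable_normal_pdf.
by rewrite /Rintegral integral_normal_pdf mulr1.
Qed.

(** Differentiation under the integral sign, dominated by [|x| * p x], turns Stein's identity into
    the linear equation [F' = - s^2 t F]. *)
Let dF c (t : R) : is_derive t 1 (F c) (- (s ^+ 2 * t) * F c t).
Proof.
have mc u := @measurable_trig cos u c (@continuous_cos R).
have ms u := @measurable_trig sin u c (@continuous_sin R).
have ic u := integrable_Mp (mc u) (fun x => cos_max _).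
pose f (u x : R) := cos (u * x + c) * p x.
have df (u x : R) : is_derive u 1 (f ^~ x) (- x * sin (u * x + c) * p x).
  rewrite /f; apply: is_derive_eq; rewrite /GRing.scale/=.
  by ring.
have d1 u x : partial1of2 f u x = - x * sin (u * x + c) * p x.
  by rewrite partial1of2E; have := df u x => ?; rewrite derive_val.
have It : `]t - 1, t + 1[%classic t by rewrite /= in_itv/= ltrBlDr ltrDl ltr01.
have h1 x y : `]t - 1, t + 1[%classic x -> [set: R] y -> derivable (f ^~ y) x 1.
  by move=> _ _; have [] := df x y.
have h2 (x : R) (y : measurableTypeR R) : `]t - 1, t + 1[%classic x -> [set: R] y -> `|partial1of2 f x y| <= `|y| * p y.
  move=> _ _; rewrite d1 !normrM normrN [X in _ * X]ger0_norm ?normal_pdf_ge0//.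
  by rewrite ler_wpM2r ?normal_pdf_ge0// ler_piMr// sin_max.
have h3 y : 0 <= `|y| * p y by rewrite mulr_ge0 ?normal_pdf_ge0.
have D := @derivable_under_integral R _ _ mu f setT measurableT t _ _ It (fun u _ => ic u) h1 _ h3 integrable_xp h2.
have E := @differentiation_under_integral R _ _ mu f setT measurableT t _ _ It (fun u _ => ic u) h1 _ h3 integrable_xp h2.
apply: DeriveDef => //.
rewrite -derive1E E -stein.
by apply: eq_Rintegral => x _; rewrite -d1.
Qed.

(** The product of [F] and [exp (s^2 t^2 / 2)] has zero derivative. The phase [c] makes this a
    statement on the whole characteristic function. *)
Lemma Rintegral_cos_normal_pdf t c :
  \int[mu]_x (cos (t * x + c) * normal_pdf 0 s x) = cos c * expR (- (s ^+ 2 * t ^+ 2 / 2)).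
Proof.
pose H u := F c u * expR ((s ^+ 2 / 2) * u ^+ 2).
have dH (u : R) : is_derive u 1 H 0.
  have := dF c u => dFu; rewrite /H; apply: is_derive_eq; rewrite /GRing.scale/= !mulr1.
  by field.
have := is_derive_0_is_cst t 0 dH.
rewrite /H F0 expr0n/= mulr0 expR0 mulr1 => <-.
by rewrite -[RHS]mulrA -expRD mulrAC addrN expR0 mulr1.
Qed.

End NormalChf1.

(** * Densities, bounded integrands and product laws *)

Section Density.
Context d (T : measurableType d) (R : realType).
Variables (mu nu : {measure set T -> \bar R}) (f : T -> R).
Hypothesis mf : measurable_fun setT f.
Hypothesis f0 : forall x, 0 <= f x.
Hypothesis nuE : forall A, measurable A -> nu A = (\int[mu]_(x in A) (f x)%:E)%E.

Import HBNNSimple.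

(** Both sides agree on simple functions, and monotone convergence passes to the limit on either
    side. *)
Lemma ge0_integral_density (g : T -> \bar R) :
  measurable_fun [set: T] g -> (forall x, 0 <= g x)%E ->
  (\int[nu]_x g x = \int[mu]_x (g x * (f x)%:E))%E.
Proof.
move=> mg g0.
have mfE : measurable_fun setT (EFin \o f) by exact/measurable_EFinP.
pose g_ := nnsfun_approx measurableT mg.
have ms n : (\int[nu]_x (g_ n x)%:E = \int[mu]_x ((g_ n x)%:E * (f x)%:E))%E.
  under eq_integral do rewrite fimfunE -fsumEFin//.
  rewrite ge0_integral_fsum//; last 2 first.
  - by move=> y; exact/measurable_EFinP/measurable_funM.
  - by move=> y x _; rewrite nnfun_muleindic_ge0.
  rewrite [RHS](_ : _ = \int[mu]_x (\sum_(k \in range (g_ n))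
      ((k * \1_(g_ n @^-1` [set k]) x)%:E * (f x)%:E)))%E; last first.
    apply: eq_integral => x _; rewrite {1}fimfunE -fsumEFin// ge0_mule_fsuml// => k.
    exact: nnfun_muleindic_ge0.
  rewrite ge0_integral_fsum//; last 2 first.
  - move=> y; apply: emeasurable_funM => //.
    exact/measurable_EFinP/measurable_funM.
  - by move=> y x _; rewrite mule_ge0 ?nnfun_muleindic_ge0 ?lee_fin.
  apply: eq_fsbigr => r _.
  rewrite integralZl_indic_nnsfun// integral_indic// setIT.
  rewrite nuE//.
  have [r0|r0] := ltP r 0.
    rewrite preimage_nnfun0// integral_set0 mule0.
    under eq_integral do rewrite indic0 mulr0 mul0e.
    by rewrite integral0.
  rewrite integral_mkcond -ge0_integralZl//; last 2 first.
  - by apply/(measurable_restrictT _ _).1 => //; exact: measurable_funTS.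
  - by move=> x _; rewrite erestrict_ge0// => y _; rewrite lee_fin.
  apply: eq_integral => x _.
  rewrite patchE indicE; case: ifPn => _; first by rewrite mulr1.
  by rewrite mulr0 mul0e mule0.
transitivity (limn (fun n => \int[nu]_x (g_ n x)%:E)%E).
  rewrite -monotone_convergence//.
  - apply: eq_integral => y _; apply/esym/cvg_lim => //.
    by apply: cvg_nnsfun_approx.
  - by move=> n; exact/measurable_EFinP/measurable_funP.
  - by move=> n y _; rewrite lee_fin.
  - by move=> y _ m n mn; rewrite lee_fin; exact/lefP/nd_nnsfun_approx.
rewrite (_ : (fun n => _) = fun n => \int[mu]_x ((g_ n x)%:E * (f x)%:E))%E; last exact/funext.
rewrite -monotone_convergence//.
- apply: eq_integral => y _; apply/cvg_lim => //.
  by apply: cvgeZr => //; apply: cvg_nnsfun_approx.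
- move=> n; apply: emeasurable_funM => //.
  exact/measurable_EFinP/measurable_funP.
- by move=> n y _; rewrite mule_ge0 ?lee_fin.
- move=> y _ m n mn; rewrite lee_wpmul2r ?lee_fin//.
  exact/lefP/nd_nnsfun_approx.
Qed.

End Density.

(* [probability_setT] does not match when [P] is seen as a plain measure. *)
Lemma measure_prob_setT d (T : measurableType d) (R : realType) (P : probability T R) :
  (P : {measure set T -> \bar R}) [set: T] = 1%E.
Proof. exact: probability_setT. Qed.

Section BoundedIntegrals.
Context d (T : measurableType d) (R : realType) (P : probability T R).

Lemma bounded_integrable (f : T -> R) (M : R) : measurable_fun setT f ->
  (forall x, `|f x| <= M) -> P.-integrable setT (EFin \o f).
Proof.
move=> mf fM; apply: (le_integrable measurableT _ _ (finite_measure_integrable_cst P M measurableT)).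
  exact/measurable_EFinP.
by move=> x _; rewrite /= lee_fin (le_trans (fM x))// ler_norm.
Qed.

Lemma EFin_Rintegral (f : T -> R) : P.-integrable setT (EFin \o f) ->
  (\int[P]_x (f x)%:E = (\int[P]_x f x)%:E)%E.
Proof. by move=> pf; rewrite /Rintegral fineK//; exact: integrable_fin_num. Qed.

Lemma Rintegral_prob_cst (r : R) : \int[P]_x r = r.
Proof. by rewrite Rintegral_cst// measure_prob_setT mulr1. Qed.

Lemma Rintegral_abs_le (f : T -> R) (M : R) : measurable_fun setT f ->
  (forall x, `|f x| <= M) -> `|\int[P]_x f x| <= M.
Proof.
move=> mf fM; have pf := bounded_integrable mf fM.
apply: (le_trans (le_normr_Rintegral _ pf)) => //.
rewrite -[leRHS]Rintegral_prob_cst; apply: le_Rintegral => //.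
- exact: integrable_norm.
- exact: finite_measure_integrable_cst.
Qed.

End BoundedIntegrals.

Lemma Rintegral_pushprob (R : realType) d1 d2 (T1 : measurableType d1) (T2 : measurableType d2)
    (P : probability T1 R) (f : T1 -> T2) (mf : measurable_fun [set: T1] f) (g : T2 -> R) (M : R) :
  measurable_fun [set: T2] g -> (forall y, `|g y| <= M) ->
  \int[pushprob P mf]_y g y = \int[P]_x g (f x).
Proof.
move=> mg gM; rewrite /Rintegral /pushprob integral_distribution//.
  exact/measurable_EFinP.
apply: bounded_integrable => //=.
by apply: measurableT_comp => //; exact/measurable_EFinP.
Qed.

Section ProductProbability.
Context {R : realType} d1 d2 (T1 : measurableType d1) (T2 : measurableType d2).
Variables (P : probability T1 R) (Q : probability T2 R).

Definition pprod : set (T1 * T2) -> \bar R := (P \x Q)%E.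
HB.instance Definition _ := Measure.on pprod.

Let pprod_setT : pprod setT = 1%E.
Proof. by rewrite /pprod -setXTT product_measure1E// !measure_prob_setT mule1. Qed.

HB.instance Definition _ := Measure_isProbability.Build _ _ _ pprod pprod_setT.

Lemma integral_pprod (f : T1 * T2 -> \bar R) : measurable_fun setT f ->
  (forall x, 0 <= f x)%E -> (\int[pprod]_z f z = \int[P]_x \int[Q]_y f (x, y))%E.
Proof. by move=> mf f0; rewrite -fubini_tonelli1. Qed.

Lemma bounded_Fubini (f : T1 * T2 -> R) (M : R) : measurable_fun setT f ->
  (forall z, `|f z| <= M) ->
  \int[pprod]_z f z = \int[P]_x \int[Q]_y f (x, y) /\
  \int[pprod]_z f z = \int[Q]_y \int[P]_x f (x, y).
Proof.
move=> mf fM.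
have pf : (P \x Q)%E.-integrable setT (EFin \o f).
  exact: (@bounded_integrable _ _ _ (pprod : probability _ R) f M).
split; congr fine.
  rewrite -[LHS](integral12_prod_meas1 pf).
  apply: eq_integral => x _; rewrite /fubini_F -EFin_Rintegral//.
  apply: (@bounded_integrable _ _ _ _ _ M) => //.
  exact: measurableT_comp.
rewrite -[LHS](integral21_prod_meas1 pf).
apply: eq_integral => x _; rewrite /fubini_G -EFin_Rintegral//.
apply: (@bounded_integrable _ _ _ _ _ M) => //.
exact: (measurableT_comp mf (pair2_measurable x)).
Qed.

End ProductProbability.

Section GaussR.
Context {R : realType}.

Definition normR (s : R) : probability R R :=
  pushprob (normal_prob 0 s) (measurable_idR (R := R)).

Lemma integral_normR (s : R) (f : R -> \bar R) : measurable_fun [set: R] f ->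
  (forall x, 0 <= f x)%E ->
  (\int[normR s]_x f x = \int[lebR]_x (f x * (normal_pdf 0 s x)%:E))%E.
Proof.
move=> mf f0; apply: ge0_integral_density => //.
- exact: (@measurable_normal_pdf R 0 s).
- by move=> x; exact: normal_pdf_ge0.
- move=> A mA; rewrite -[LHS]/(normal_prob 0 s A) /normal_prob.
  rewrite [LHS]integral_mkcond [RHS]integral_mkcond integral_lebR//.
    apply/(measurable_restrictT _ _).1 => //; apply: measurable_funTS.
    by apply/measurable_EFinP; exact: (@measurable_normal_pdf R 0 s).
  by move=> x; rewrite erestrict_ge0// => y _; rewrite lee_fin normal_pdf_ge0.
Qed.

Lemma measurable_cosR : measurable_fun [set: R] (@cos R).
Proof. by apply: continuous_measurable_fun; exact: continuous_cos. Qed.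

Lemma measurable_sinR : measurable_fun [set: R] (@sin R).
Proof. by apply: continuous_measurable_fun; exact: continuous_sin. Qed.

Lemma oneDcos_ge0 (x : R) : 0 <= 1 + cos x.
Proof. by rewrite -lerBlDl sub0r cos_geN1. Qed.

Lemma measurable_affine_cos (t c : R) : measurable_fun [set: R] (fun x : R => cos (t * x + c)).
Proof.
apply: (measurableT_comp (measurable_cosR)) => /=.
by apply: measurable_funD => //; exact: measurable_funM.
Qed.

Lemma Rintegral_cos_normR (s t c : R) : 0 < s ->
  \int[normR s]_x cos (t * x + c) = cos c * expR (- (s ^+ 2 * t ^+ 2 / 2)).
Proof.
move=> s0; rewrite -Rintegral_cos_normal_pdf//.
have mc := measurable_affine_cos t c.
have i1 : (normR s).-integrable setT (EFin \o (fun x : R => cos (t * x + c))).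
  by apply: (@bounded_integrable _ _ _ _ _ 1) => // x; exact: cos_max.
(* Adding 1 makes the integrand nonnegative, as [integral_normR] requires; the two constants cancel
   at the end. *)
have Hp : (\int[normR s]_x (1 + cos (t * x + c))%:E =
   \int[lebesgue_measure]_x ((1 + cos (t * x + c)) * normal_pdf 0 s x)%:E)%E.
  rewrite integral_normR; last 2 first.
  - by apply/measurable_EFinP; exact: measurable_funD.
  - by move=> x; rewrite lee_fin -lerBlDl sub0r cos_geN1.
  rewrite integral_lebR//.
  - apply: emeasurable_funM; apply/measurable_EFinP; first exact: measurable_funD.
    exact: (@measurable_normal_pdf R 0 s).
  - move=> x; by rewrite mule_ge0// lee_fin ?normal_pdf_ge0// oneDcos_ge0.
have ip := integrable_normal_pdf 0 s.
have icp : lebesgue_measure.-integrable setT (EFin \o (fun x => cos (t * x + c) * normal_pdf 0 s x)).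
  apply: (le_integrable measurableT _ _ ip).
    apply/measurable_EFinP; apply: measurable_funM; first exact: mc.
    exact: measurable_normal_pdf.
  move=> x _ /=; rewrite lee_fin normrM.
  by apply: ler_piMl => //; exact: cos_max.
move: Hp => /(congr1 fine).
rewrite -[LHS]/(Rintegral _ _ _) RintegralD//; last exact: finite_measure_integrable_cst.
rewrite Rintegral_prob_cst.
rewrite -[RHS]/(Rintegral _ _ _).
under [in RHS]eq_Rintegral do rewrite mulrDl mul1r.
rewrite [RHS]RintegralD//.
rewrite [X in _ = X + _](_ : _ = 1); first exact: addrI.
by rewrite /Rintegral integral_normal_pdf.
Qed.

End GaussR.

Section GaussV.
Context {R : realType}.
Implicit Types (s : R) (d : nat).

Definition nsq d (x : d.-tuple R) : R := \sum_(i < d) tnth x i ^+ 2.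

Definition gaussV s d : set (d.-tuple R) -> \bar R := mpow (normR s) d.
Arguments gaussV : clear implicits.
HB.instance Definition _ s d := Measure.on (gaussV s d).

Let gaussV_setT s d : gaussV s d setT = 1%E.
Proof.
rewrite /gaussV; elim: d => [|d IHd]; first by rewrite /= diracT.
rewrite /= /mcons /pushforward preimage_setT -setXTT product_measure1E//.
by rewrite measure_prob_setT mul1e.
Qed.

HB.instance Definition _ s d := Measure_isProbability.Build _ _ _ (gaussV s d)
  (gaussV_setT s d).

Definition gausspdf s d (x : d.-tuple R) : R := \prod_(i < d) normal_pdf 0 s (tnth x i).

Lemma gausspdf_ge0 s d (x : d.-tuple R) : 0 <= gausspdf s x.
Proof. by apply: prodr_ge0 => i _; exact: normal_pdf_ge0. Qed.

Lemma measurable_gausspdf s d : measurable_fun [set: d.-tuple R] (gausspdf s (d := d)).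
Proof.
apply: measurable_prod => i _.
apply: (measurableT_comp (@measurable_normal_pdf R 0 s)).
exact: measurable_tnth.
Qed.

Lemma gausspdf_tcons s d (x : R) (y : d.-tuple R) :
  gausspdf s (tcons (x, y)) = normal_pdf 0 s x * gausspdf s y.
Proof.
rewrite /gausspdf big_ord_recl /tcons tnth0; congr (_ * _).
by apply: eq_bigr => i _; rewrite tnthS.
Qed.

Lemma integral_gaussV s d (f : d.-tuple R -> \bar R) :
  measurable_fun [set: d.-tuple R] f -> (forall x, 0 <= f x)%E ->
  (\int[gaussV s d]_x f x = \int[lebV d]_x (f x * (gausspdf s x)%:E))%E.
Proof.
rewrite /gaussV; elim: d f => [|d IHd] f mf f0.
  rewrite integral_mpow0// integral_mpow0.
    by rewrite /gausspdf big_ord0 mule1.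
  by apply: emeasurable_funM => //; apply/measurable_EFinP; exact: measurable_gausspdf.
have mft : measurable_fun setT (fun z => f (tcons z)).
  exact: (measurableT_comp mf (@measurable_tcons R d)).
have mg := @measurable_gausspdf s d.
rewrite integral_mpowS// integral_mpowS; last 2 first.
- by apply: emeasurable_funM => //; apply/measurable_EFinP; exact: measurable_gausspdf.
- by move=> x; rewrite mule_ge0 ?lee_fin ?gausspdf_ge0.
have mf1 x : measurable_fun [set: d.-tuple R] (fun y => f (tcons (x, y))).
  exact: (measurableT_comp mft (pair1_measurable x)).
rewrite integral_normR; last 2 first.
- apply: (measurable_fun_fubini_tonelli_F (fun z => f (tcons z))) => //.
- by move=> x; apply: integral_ge0.
apply: eq_integral => x _.
rewrite IHd// -ge0_integralZr//; last 3 first.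
- by apply: emeasurable_funM => //; apply/measurable_EFinP.
- by move=> y _; rewrite mule_ge0 ?lee_fin ?gausspdf_ge0.
- by rewrite lee_fin normal_pdf_ge0.
apply: eq_integral => y _; rewrite gausspdf_tcons EFinM -muleA.
by congr (_ * _)%E; rewrite muleC.
Qed.

Lemma dotv_tcons d (t : d.+1.-tuple R) (x : R) (y : d.-tuple R) :
  dotv t (tcons (x, y)) = tnth t ord0 * x + dotv [tuple of behead t] y.
Proof.
rewrite /dotv big_ord_recl /tcons tnth0; congr (_ + _).
by apply: eq_bigr => i _; rewrite tnthS tnth_beheadE.
Qed.

Lemma nsq_behead d (t : d.+1.-tuple R) :
  nsq t = tnth t ord0 ^+ 2 + nsq [tuple of behead t].
Proof.
by rewrite /nsq big_ord_recl; congr (_ + _); apply: eq_bigr => i _; rewrite tnth_beheadE.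
Qed.

Lemma measurable_dotv d (t : d.-tuple R) : measurable_fun [set: d.-tuple R] (dotv t).
Proof.
apply: measurable_sum => i; apply: measurable_funM => //.
exact: measurable_tnth.
Qed.

Lemma measurable_cos_dotv d (t : d.-tuple R) c :
  measurable_fun [set: d.-tuple R] (fun x => cos (dotv t x + c)).
Proof.
apply: (measurableT_comp (measurable_cosR)) => /=.
by apply: measurable_funD => //; exact: measurable_dotv.
Qed.

(** The induction needs the phase free: once the tail is integrated, the first coordinate enters as
    the new phase [tnth t ord0 * x + c]. The added 1 keeps the integrand nonnegative for Tonelli. *)
Let int_1cos_gaussV s d (t : d.-tuple R) (c : R) : 0 < s ->
  (\int[gaussV s d]_x (1 + cos (dotv t x + c))%:E =
   (1 + cos c * expR (- (s ^+ 2 * nsq t / 2)))%:E)%E.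
Proof.
move=> s0; rewrite /gaussV; elim: d t c => [|d IHd] t c.
  rewrite integral_mpow0.
    by rewrite /dotv /nsq !big_ord0 mulr0 mul0r oppr0 expR0 mulr1 add0r.
  by apply/measurable_EFinP; apply: measurable_funD => //; exact: measurable_cos_dotv.
rewrite integral_mpowS; last 2 first.
- by apply/measurable_EFinP; apply: measurable_funD => //; exact: measurable_cos_dotv.
- by move=> x; rewrite lee_fin -lerBlDl sub0r cos_geN1.
under eq_integral => x _.
  under eq_integral => y _.
    rewrite dotv_tcons addrAC addrC.
    over.
  rewrite IHd mulrC.
  over.
set k := expR _.
have i1 : (normR s).-integrable setT (EFin \o (fun x : R => cos (tnth t ord0 * x + c))).
  apply: (@bounded_integrable _ _ _ _ _ 1) => [|x]; last exact: cos_max.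
  exact: measurable_affine_cos.
have i2 : (normR s).-integrable setT (EFin \o (fun x : R => k * cos (tnth t ord0 * x + c))).
  by rewrite /comp; under eq_fun do rewrite EFinM; exact: integrableZl.
rewrite EFin_Rintegral; last first.
  rewrite /comp; under eq_fun do rewrite EFinD.
  by apply: integrableD => //; exact: finite_measure_integrable_cst.
rewrite RintegralD//; last exact: finite_measure_integrable_cst.
rewrite Rintegral_prob_cst RintegralZl// Rintegral_cos_normR//.
congr (1 + _)%:E; rewrite mulrCA /k -expRD nsq_behead; congr (_ * expR _).
by ring.
Qed.

Lemma Rintegral_cos_gaussV s d (t : d.-tuple R) (c : R) : 0 < s ->
  \int[gaussV s d]_x cos (dotv t x + c) = cos c * expR (- (s ^+ 2 * nsq t / 2)).
Proof.
move=> s0; have := int_1cos_gaussV t c s0 => /(congr1 fine).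
rewrite -[LHS]/(Rintegral _ _ _) RintegralD//=; last 2 first.
- exact: finite_measure_integrable_cst.
- apply: (@bounded_integrable _ _ _ _ _ 1) => [|x]; last exact: cos_max.
  exact: measurable_cos_dotv.
by rewrite Rintegral_prob_cst => /addrI.
Qed.

(** The Gaussian density is a multiple of the characteristic function of the Gaussian law of inverse
    scale. This is the source of the inverse Fourier formula [sdensE]. *)
Lemma gausspdfE s d (x : d.-tuple R) : 0 < s ->
  gausspdf s x = normal_peak s ^+ d * \int[gaussV s^-1 d]_y cos (dotv x y).
Proof.
move=> s0.
transitivity (normal_peak s ^+ d * \int[gaussV s^-1 d]_y cos (dotv x y + 0)); last first.
  by congr (_ * _); apply: eq_Rintegral => y _; rewrite addr0.
rewrite Rintegral_cos_gaussV ?invr_gt0// cos0 mul1r.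
rewrite /gausspdf /nsq.
under eq_bigr do rewrite normal_pdfE ?gt_eqF// /normal_fun subr0.
rewrite big_split/= prodr_const card_ord; congr (_ * _).
rewrite -expR_sum; congr expR.
rewrite mulr_sumr mulr_suml -sumrN; apply: eq_bigr => i _.
have sn0 : s != 0 by rewrite gt_eqF.
by field.
Qed.

End GaussV.
Arguments gaussV {R} s d _.

(** * Gaussian smoothing and characteristic functions *)

Section TrigBounds.
Context {R : realType}.
Implicit Types x y : R.

Lemma sin_lip x y : `|sin x - sin y| <= `|x - y|.
Proof.
wlog xy : x y / y < x => [H|].
  have [xy|xy|->] := ltgtP x y; [|exact: H|by rewrite !subrr].
  by rewrite distrC [leRHS]distrC; exact: H.
have h1 (z : R) : z \in `]y, x[%R -> is_derive z 1 sin (cos z) by move=> _; exact: is_derive_sin.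
have h2 : {within `[y, x], continuous sin}.
  by apply: continuous_subspaceT => z; exact: continuous_sin.
have [c _ ->] := MVT xy h1 h2.
by rewrite normrM ler_piMl// cos_max.
Qed.

Lemma cos_lip x y : `|cos x - cos y| <= `|x - y|.
Proof.
rewrite -!sinDpihalf; apply: le_trans (sin_lip _ _) _.
by rewrite opprD addrACA subrr addr0.
Qed.

Lemma abs_sin_le x : `|sin x| <= `|x|.
Proof. by have := sin_lip x 0; rewrite sin0 !subr0. Qed.

Lemma oneBcos_half x : 1 - cos x = 2 * sin (x / 2) ^+ 2.
Proof.
have := cos_mulr2n (x / 2); rewrite (_ : x / 2 *+ 2 = x); last by rewrite -mulr_natr divfK.
by rewrite cos2sin2 => ->; ring.
Qed.

Lemma oneBcos_le x : 1 - cos x <= x ^+ 2 / 2.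
Proof.
rewrite oneBcos_half; have := abs_sin_le (x / 2) => h.
have : sin (x / 2) ^+ 2 <= (x / 2) ^+ 2.
  by rewrite -[leLHS]real_normK ?num_real// -[leRHS]real_normK ?num_real// lerXn2r ?nnegrE.
by rewrite expr_div_n; lra.
Qed.

Lemma sin_sub_le x : `|sin x - x| <= x ^+ 2.
Proof.
wlog x0 : x / 0 < x => [H|].
  have [x0|x0|->] := ltgtP x 0; [|exact: H|by rewrite sin0 subrr normr0 expr0n].
  by have := H (- x); rewrite sinN oppr_gt0 sqrrN opprK -normrN opprD opprK; apply.
pose f z : R := sin z - z.
have h1 (z : R) : z \in `]0, x[%R -> is_derive z 1 f (cos z - 1).
  by move=> _; apply: is_derive_eq; rewrite ?mul1r ?mulr1.
have h2 : {within `[0, x], continuous f}.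
  by apply: continuous_subspaceT => z; apply: cvgB; [exact: continuous_sin|exact: cvg_id].
have [c] := MVT x0 h1 h2.
rewrite in_itv/= /f => /andP[c0 cx]; rewrite sin0 !subr0 => ->.
rewrite normrM (gtr0_norm x0) expr2 ler_wpM2r ?(ltW x0)//.
have := cos_lip c 0; rewrite cos0 subr0 => /le_trans; apply.
by rewrite gtr0_norm// ltW.
Qed.

Lemma cvg_oneBcos (u : R) :
  2 * (1 - cos (u / n.+1%:R)) * n.+1%:R ^+ 2 @[n --> \oo] --> u ^+ 2.
Proof.
have [->|u0] := eqVneq u 0.
  by under eq_fun do rewrite mul0r cos0 subrr mulr0 mul0r; rewrite expr0n; exact: cvg_cst.
(* The half-angle formula turns the term into [u^2 (sin h / h)^2]; the case [u = 0] is apart because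
   [h] must not vanish. *)
pose h n : R := u / 2 / n.+1%:R.
have h0 : h n @[n --> \oo] --> 0.
  rewrite -(mulr0 (u / 2)); apply: cvgM; first exact: cvg_cst.
  exact: cvg_harmonic.
have hn0 n : h n != 0 by rewrite /h !mulf_neq0 ?invr_eq0.
have sh : sin (h n) / h n @[n --> \oo] --> (1 : R).
  have d0 : is_derive (0 : R) (1 : R) sin (cos 0) by exact: is_derive_sin.
  have /cvgr_dnbhsP/(_ h (conj hn0 h0)) := (@ex_derive _ _ _ _ _ _ _ d0).
  rewrite -[lim _]/('D_1 sin 0) derive_val cos0.
  apply: cvg_trans; apply: near_eq_cvg; near=> n.
  by rewrite /= /GRing.scale/= mulr1 addr0 sin0 subr0 mulrC.
have -> : u ^+ 2 = u ^+ 2 * (1 * 1) by ring.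
rewrite (_ : (fun n => _) = fun n => u ^+ 2 * ((sin (h n) / h n) * (sin (h n) / h n))); last first.
  apply/funext => n; rewrite oneBcos_half /h.
  have : n.+1%:R != 0 :> R by [].
  move: n.+1%:R => m m0; rewrite (_ : u / m / 2 = u / 2 / m); last by field.
  by field; rewrite u0 m0.
by apply: cvgM; [exact: cvg_cst|exact: cvgM].
Unshelve. all: end_near. Qed.

End TrigBounds.

Section SecondMoment.
Context d (T : measurableType d) (R : realType) (P : probability T R).

(* Fatou's lemma along [h = 1/(n+1)]. *)
Lemma second_moment_le (f : T -> R) (v : R) : measurable_fun setT f ->
  (forall h, 1 - \int[P]_x cos (h * f x) <= h ^+ 2 * v / 2) ->
  (\int[P]_x (f x ^+ 2)%:E <= v%:E)%E.
Proof.
move=> mf H.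
pose g n x := (2 * (1 - cos (f x / n.+1%:R)) * n.+1%:R ^+ 2)%:E.
have mc (h : R) : measurable_fun setT (fun x => cos (h * f x)).
  by apply: (measurableT_comp measurable_cosR) => /=; exact: measurable_funM.
have mg n : measurable_fun [set: T] (g n).
  apply/measurable_EFinP; apply: measurable_funM => //; apply: measurable_funM => //.
  apply: measurable_funB => //.
  by under eq_fun do rewrite mulrC; exact: mc.
have g0 n x : [set: T] x -> (0 <= g n x)%E.
  by move=> _; rewrite lee_fin mulr_ge0 ?sqr_ge0// mulr_ge0// subr_ge0 ?cos_le1.
have := fatou P measurableT mg g0.
under eq_integral => x _.
  have -> : limn_einf (g^~ x) = (f x ^+ 2)%:E.
    by apply: (cvg_limn_einf_sup _).1; apply: cvg_EFin; [exact: nearW|exact: cvg_oneBcos].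
  over.
move/le_trans; apply.
have gv n : (\int[P]_x g n x <= v%:E)%E.
  have ic : P.-integrable setT (EFin \o (fun x => cos (n.+1%:R^-1 * f x))).
    by apply: (@bounded_integrable _ _ _ _ _ 1) => // x; exact: cos_max.
  rewrite /g.
  under eq_integral => x _ do rewrite [f x / _]mulrC mulrAC mulrBr mulr1.
  have ic2 : P.-integrable setT (EFin \o (fun x => 2 * n.+1%:R ^+ 2 * cos (n.+1%:R^-1 * f x))).
    by rewrite /comp; under eq_fun do rewrite EFinM; exact: integrableZl.
  have i1 := finite_measure_integrable_cst P (2 * n.+1%:R ^+ 2) measurableT.
  rewrite EFin_Rintegral; last by rewrite /comp; under eq_fun do rewrite EFinB; exact: integrableB.
  rewrite RintegralB//=.
  rewrite Rintegral_prob_cst RintegralZl// lee_fin -[X in X - _]mulr1 -mulrBr.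
  have := H n.+1%:R^-1.
  have : n.+1%:R != 0 :> R by [].
  move: n.+1%:R => m m0 h.
  rewrite (_ : v = 2 * m ^+ 2 * (m^-1 ^+ 2 * v / 2)); last by field.
  by rewrite ler_wpM2l// mulr_ge0 ?sqr_ge0.
apply: (@le_trans _ _ (limn_einf (fun=> v%:E : \bar R))); last first.
  by rewrite (cvg_limn_einf_sup (cvg_cst _)).1.
rewrite !limn_einf_lim; apply: lee_lim.
- exact: is_cvg_einfs.
- exact: is_cvg_einfs.
near=> n.
apply: le_ereal_inf_tmp.
move=> _ [k kn <-]; apply: le_trans (gv k).
by apply: ereal_inf_lbound; exists k.
Unshelve. all: end_near. Qed.

End SecondMoment.

Section Convolution.
Context {R : realType} {d : nat}.
Notation V := (d.-tuple R).
Implicit Types (s : R) (F : V -> \bar R) (om : probability V R).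

Lemma measurable_vadd : measurable_fun [set: V * V] (fun z => vadd z.1 z.2).
Proof.
apply/measurable_fun_tnthP => i.
rewrite (_ : _ \o _ = fun z : V * V => tnth z.1 i + tnth z.2 i); last first.
  by apply/funext => x /=; rewrite tnth_mktuple.
by apply: measurable_funD;
  [exact: (measurableT_comp (measurable_tnth i) measurable_fst)|
   exact: (measurableT_comp (measurable_tnth i) measurable_snd)].
Qed.

Lemma measurable_vsub : measurable_fun [set: V * V] (fun z => vsub z.1 z.2).
Proof.
apply/measurable_fun_tnthP => i.
rewrite (_ : _ \o _ = fun z : V * V => tnth z.1 i - tnth z.2 i); last first.
  by apply/funext => x /=; rewrite tnth_mktuple.
by apply: measurable_funB;
  [exact: (measurableT_comp (measurable_tnth i) measurable_fst)|
   exact: (measurableT_comp (measurable_tnth i) measurable_snd)].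
Qed.

Lemma dotv_vadd (t x y : V) : dotv t (vadd x y) = dotv t x + dotv t y.
Proof.
rewrite /dotv -big_split; apply: eq_bigr => i _ /=.
by rewrite tnth_mktuple mulrDr.
Qed.

Lemma dotv_vsub (t x y : V) : dotv t (vsub x y) = dotv t x - dotv t y.
Proof.
rewrite /dotv -sumrB; apply: eq_bigr => i _ /=.
by rewrite tnth_mktuple mulrBr.
Qed.

Lemma dotvC (x y : V) : dotv x y = dotv y x.
Proof. by apply: eq_bigr => i _; rewrite mulrC. Qed.

Definition gconv om s : probability V R := pushprob (pprod om (gaussV s d)) measurable_vadd.

Definition chC om t := \int[om]_x cos (dotv t x).
Definition chS om t := \int[om]_x sin (dotv t x).

Lemma measurable_cos_dot (t : V) : measurable_fun [set: V] (fun x => cos (dotv t x)).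
Proof. exact: (measurableT_comp measurable_cosR (@measurable_dotv R d t)). Qed.

Lemma measurable_sin_dot (t : V) : measurable_fun [set: V] (fun x => sin (dotv t x)).
Proof. exact: (measurableT_comp measurable_sinR (@measurable_dotv R d t)). Qed.

Lemma Rintegral_cosD om (t : V) c :
  \int[om]_x cos (dotv t x + c) = cos c * chC om t - sin c * chS om t.
Proof.
have ic : om.-integrable setT (EFin \o (fun x => cos (dotv t x))).
  by apply: (@bounded_integrable _ _ _ _ _ 1) => [|x]; [exact: measurable_cos_dot|exact: cos_max].
have is_ : om.-integrable setT (EFin \o (fun x => sin (dotv t x))).
  by apply: (@bounded_integrable _ _ _ _ _ 1) => [|x]; [exact: measurable_sin_dot|exact: sin_max].
under eq_Rintegral do rewrite cosD mulrC [sin _ * _]mulrC.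
rewrite RintegralB//; last 2 first.
- by rewrite /comp; under eq_fun do rewrite EFinM; exact: integrableZl.
- by rewrite /comp; under eq_fun do rewrite EFinM; exact: integrableZl.
by rewrite !RintegralZl.
Qed.

Let cos1 (g : V -> R) x : `|cos (g x)| <= 1. Proof. exact: cos_max. Qed.

Lemma Rintegral_cos_gconv om s (t : V) c : 0 < s ->
  \int[gconv om s]_x cos (dotv t x + c) =
  expR (- (s ^+ 2 * nsq t / 2)) * \int[om]_x cos (dotv t x + c).
Proof.
move=> s0.
have mc := @measurable_cos_dotv R d t c.
rewrite (@Rintegral_pushprob _ _ _ _ _ _ _ _ _ 1)//; last by move=> y; exact: cos_max.
have mcc := measurableT_comp mc measurable_vadd.
have [-> _] := @bounded_Fubini _ _ _ _ _ om (gaussV s d) _ 1 mcc (fun z => cos_max _).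
rewrite -RintegralZl//; last first.
  by apply: (@bounded_integrable _ _ _ _ _ 1) => // x; exact: cos_max.
apply: eq_Rintegral => x _.
under eq_Rintegral => y _ do rewrite /= dotv_vadd addrAC addrC.
by rewrite Rintegral_cos_gaussV// mulrC.
Qed.

Lemma chC_gconv om s (t : V) : 0 < s ->
  chC (gconv om s) t = expR (- (s ^+ 2 * nsq t / 2)) * chC om t.
Proof.
move=> s0; have := Rintegral_cos_gconv om t 0 s0.
by rewrite !Rintegral_cosD cos0 sin0 !mul1r !mul0r !subr0.
Qed.

Lemma chS_gconv om s (t : V) : 0 < s ->
  chS (gconv om s) t = expR (- (s ^+ 2 * nsq t / 2)) * chS om t.
Proof.
move=> s0; have := Rintegral_cos_gconv om t (pi / 2) s0.
by rewrite !Rintegral_cosD cos_pihalf sin_pihalf !mul1r !mul0r !sub0r mulrN => /oppr_inj.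
Qed.

Definition sdens om s (y : V) : R := \int[om]_w gausspdf s (vsub y w).

Lemma gausspdf_le s (x : V) : 0 < s -> gausspdf s x <= normal_peak s ^+ d.
Proof.
move=> s0; rewrite -[X in _ <= _ ^+ X]card_ord -prodr_const.
by apply: ler_prod => i _; rewrite normal_pdf_ge0 normal_pdf_ub ?gt_eqF.
Qed.

Lemma sdens_ge0 om s y : 0 <= sdens om s y.
Proof. by apply: Rintegral_ge0 => x _; exact: gausspdf_ge0. Qed.

Let mgsub s : measurable_fun [set: V * V] (fun z => gausspdf s (vsub z.1 z.2)).
Proof. exact: (measurableT_comp (@measurable_gausspdf R s d) measurable_vsub). Qed.

Let mgsub2 s y : measurable_fun [set: V] (fun w => gausspdf s (vsub y w)).
Proof. exact: (measurableT_comp (mgsub s) (pair1_measurable y)). Qed.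

Let igsub om s y : 0 < s -> om.-integrable setT (EFin \o (fun w => gausspdf s (vsub y w))).
Proof.
move=> s0; apply: (@bounded_integrable _ _ _ _ _ (normal_peak s ^+ d)) => //.
by move=> w; rewrite ger0_norm ?gausspdf_ge0// gausspdf_le.
Qed.

Lemma EFin_sdens om s y : 0 < s ->
  (sdens om s y)%:E = (\int[om]_w (gausspdf s (vsub y w))%:E)%E.
Proof. by move=> s0; rewrite EFin_Rintegral//; exact: igsub. Qed.

Lemma sdens_le om s y : 0 < s -> sdens om s y <= normal_peak s ^+ d.
Proof.
move=> s0; rewrite -[leRHS](@Rintegral_prob_cst _ _ _ om); apply: le_Rintegral => //.
- exact: igsub.
- exact: finite_measure_integrable_cst.
- by move=> x _; exact: gausspdf_le.
Qed.

Lemma measurable_sdens om s : 0 < s -> measurable_fun [set: V] (sdens om s).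
Proof.
move=> s0; apply/measurable_EFinP.
have mF : measurable_fun [set: V * V] (fun z => (gausspdf s (vsub z.1 z.2))%:E).
  exact/measurable_EFinP.
have := @measurable_fun_fubini_tonelli_F _ _ _ _ R om _ mF (fun z => _).
rewrite (_ : fubini_F _ _ = EFin \o sdens om s).
  by apply=> z; rewrite lee_fin gausspdf_ge0.
by apply/funext => y; rewrite /fubini_F /= EFin_sdens.
Qed.

(** For a fixed value of the [om]-variable, translation invariance moves the shift from [F] to the
    Gaussian kernel; Tonelli then averages the kernel over [om]. *)
Lemma integral_gconv om s F : 0 < s -> measurable_fun [set: V] F ->
  (forall x, 0 <= F x)%E ->
  (\int[gconv om s]_x F x = \int[lebV d]_y (F y * (sdens om s y)%:E))%E.
Proof.
move=> s0 mF F0.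
have mFv : measurable_fun [set: V * V] (fun z => F (vadd z.1 z.2)).
  exact: (measurableT_comp mF measurable_vadd).
rewrite integral_pushprob// integral_pprod//.
transitivity (\int[om]_w \int[lebV d]_y (F y * (gausspdf s (vsub y w))%:E))%E.
  apply: eq_integral => w _.
  have mFw : measurable_fun [set: V] (fun y => F (vadd w y)).
    exact: (measurableT_comp mFv (pair1_measurable w)).
  rewrite -[LHS]/(\int[gaussV s d]_y F (vadd w y))%E.
  apply: (etrans (integral_gaussV s mFw (fun y => F0 _))).
  pose H y := (F (vadd w y) * (gausspdf s y)%:E)%E.
  rewrite -[LHS]/(\int[lebV d]_y H y)%E -(integral_lebV_shift (vsub (@vzero R d) w)); last 2 first.
  - apply: emeasurable_funM => //.
    by apply/measurable_EFinP; exact: measurable_gausspdf.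
  - by move=> x; rewrite mule_ge0 ?lee_fin ?gausspdf_ge0.
  apply: eq_integral => y _; rewrite /H.
  have -> : vadd w (vadd y (vsub (vzero R d) w)) = y.
    by apply/eq_from_tnth => i; rewrite !tnth_mktuple; ring.
  have -> // : vadd y (vsub (vzero R d) w) = vsub y w.
  by apply/eq_from_tnth => i; rewrite !tnth_mktuple; ring.
have mG : measurable_fun [set: V * V] (fun z => F z.2 * (gausspdf s (vsub z.2 z.1))%:E)%E.
  apply: emeasurable_funM; first exact: (measurableT_comp mF measurable_snd).
  apply/measurable_EFinP.
  exact: (measurableT_comp (mgsub s) (measurable_swap (T1 := V) (T2 := V))).
rewrite (@fubini_tonelli _ _ _ _ _ om (lebV d) _ mG); last first.
  by move=> z; rewrite mule_ge0 ?lee_fin ?gausspdf_ge0.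
apply: eq_integral => y _ /=.
rewrite ge0_integralZl//.
- by rewrite -EFin_sdens.
- by apply/measurable_EFinP; exact: mgsub2.
- by move=> w _; rewrite lee_fin gausspdf_ge0.
Qed.

(** Fourier inversion for a smoothed law: the kernel is written as a cosine average by [gausspdfE]
    and the two integrals are exchanged. The Gaussian weight is a probability, so everything stays
    bounded. *)
Lemma sdensE om s y : 0 < s -> sdens om s y =
  normal_peak s ^+ d * \int[gaussV s^-1 d]_x (cos (dotv y x) * chC om x + sin (dotv y x) * chS om x).
Proof.
move=> s0; rewrite /sdens.
under eq_Rintegral do rewrite gausspdfE//.
have mf : measurable_fun [set: V * V] (fun z => cos (dotv (vsub y z.1) z.2)).
  rewrite (_ : (fun z => _) = fun z : V * V => cos (dotv y z.2 - dotv z.1 z.2)); last first.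
    by apply/funext => z; rewrite dotvC dotv_vsub ![dotv z.2 _]dotvC.
  apply: (measurableT_comp measurable_cosR) => /=.
  apply: measurable_funB; first exact: (measurableT_comp (@measurable_dotv R d y) measurable_snd).
  apply: measurable_sum => i; apply: measurable_funM;
    [exact: (measurableT_comp (measurable_tnth i) measurable_fst)|
     exact: (measurableT_comp (measurable_tnth i) measurable_snd)].
have [E1 E2] := @bounded_Fubini _ _ _ _ _ om (gaussV s^-1 d) _ 1 mf (fun z => cos_max _).
have mI : measurable_fun setT (fun w => \int[gaussV s^-1 d]_x cos (dotv (vsub y w) x)).
  have mg1 : measurable_fun setT (fun w => (normal_peak s ^+ d)^-1 * gausspdf s (vsub y w)).
    by apply: measurable_funM.
  rewrite (_ : (fun w => _) = (fun w => (normal_peak s ^+ d)^-1 * gausspdf s (vsub y w)))//.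
  apply/funext => w; rewrite gausspdfE// mulKf// expf_neq0// gt_eqF// normal_peak_gt0// gt_eqF//.
rewrite RintegralZl//; last first.
  apply: (@bounded_integrable _ _ _ _ _ 1) => // w.
  apply: Rintegral_abs_le => [|x]; last exact: cos_max.
  exact: measurable_cos_dot.
congr (_ * _); rewrite -[LHS]E1 E2; apply: eq_Rintegral => x _.
transitivity (\int[om]_w cos (dotv x w + - dotv y x)).
  apply: eq_Rintegral => w _; rewrite /= dotvC dotv_vsub -cosN opprB.
  by rewrite [dotv x y]dotvC.
by rewrite Rintegral_cosD cosN sinN mulNr opprK.
Qed.

(** The [norm1] distance to a nonempty box. For an empty box it stays positive, so [boxtest] tends
    to the indicator in this case too. *)
Definition boxdist (a b x : V) : R :=
  \sum_(i < d) Num.max 0 (Num.max (tnth a i - tnth x i) (tnth x i - tnth b i)).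

(* A Lipschitz approximation of the indicator of a box. *)
Definition boxtest (a b : V) (k : R) (x : V) : R := Num.max 0 (1 - k * boxdist a b x).

Definition norm1 (x : V) : R := \sum_(i < d) `|tnth x i|.

Lemma boxdist_ge0 a b x : 0 <= boxdist a b x.
Proof. by apply: sumr_ge0 => i _; rewrite le_max lexx. Qed.

Lemma boxdist_lip a b x n : boxdist a b x <= boxdist a b (vadd x n) + norm1 n.
Proof.
rewrite /boxdist /norm1 -big_split; apply: ler_sum => i _ /=.
rewrite !tnth_mktuple.
have h1 := ler_norm (tnth n i); have h2 := ler_norm (- tnth n i); rewrite normrN in h2.
rewrite !ge_max; apply/and3P; split.
- by rewrite addr_ge0// le_max lexx.
- apply: (@le_trans _ _ (tnth a i - (tnth x i + tnth n i) + `|tnth n i|)); first lra.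
  by rewrite lerD2r !le_max lexx orbT.
- apply: (@le_trans _ _ (tnth x i + tnth n i - tnth b i + `|tnth n i|)); first lra.
  by rewrite lerD2r !le_max lexx !orbT.
Qed.

Lemma norm1N (x : V) : norm1 (vsub (vzero R d) x) = norm1 x.
Proof. by apply: eq_bigr => i _; rewrite !tnth_mktuple sub0r normrN. Qed.

Lemma boxtest_ge0 a b k x : 0 <= boxtest a b k x.
Proof. by rewrite le_max lexx. Qed.

Lemma boxtest_le1 a b k x : 0 <= k -> boxtest a b k x <= 1.
Proof. by move=> k0; rewrite ge_max ler01 lerBlDr lerDl mulr_ge0 ?boxdist_ge0. Qed.

Lemma boxtest_lip a b k x n : 0 <= k ->
  boxtest a b k (vadd x n) <= boxtest a b k x + k * norm1 n /\
  boxtest a b k x <= boxtest a b k (vadd x n) + k * norm1 n.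
Proof.
move=> k0; have n0 : 0 <= norm1 n by apply: sumr_ge0.
have L (u v w : R) : 0 <= w -> u <= v + w -> Num.max 0 (1 - k * v) <= Num.max 0 (1 - k * u) + k * w.
  move=> w0 uvw; rewrite ge_max addr_ge0 ?mulr_ge0 ?le_max ?lexx//=.
  apply: (@le_trans _ _ (1 - k * u + k * w)); last by rewrite lerD2r le_max lexx orbT.
  by have := ler_wpM2l k0 uvw; rewrite mulrDr; lra.
split; apply: L => //; first exact: boxdist_lip.
have := boxdist_lip a b (vadd x n) (vsub (vzero R d) n); rewrite norm1N.
have -> // : vadd (vadd x n) (vsub (vzero R d) n) = x.
by apply/eq_from_tnth => i; rewrite !tnth_mktuple; ring.
Qed.

Lemma measurable_boxtest a b k : measurable_fun [set: V] (boxtest a b k).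
Proof.
apply: measurable_maxr => //; apply: measurable_funB => //; apply: measurable_funM => //.
apply: measurable_sum => i; apply: measurable_maxr => //.
by apply: measurable_maxr; apply: measurable_funB => //; exact: measurable_tnth.
Qed.

Lemma cvg_boxtest a b x : boxtest a b n%:R x @[n --> \oo] --> (\1_(box a b) x : R).
Proof.
rewrite indicE; have [xab|xab] := boolP (x \in box a b).
  rewrite (_ : (fun n => _) = fun=> 1); first exact: cvg_cst.
  apply/funext => n; rewrite /boxtest (_ : boxdist a b x = 0).
    by rewrite mulr0 subr0 max_r.
  rewrite /boxdist big1// => i _; move: xab; rewrite inE => /(_ i)/andP[ax xb].
  by apply/max_idPl; rewrite ge_max !subr_le0 ax xb.
have D0 : 0 < boxdist a b x.
  rewrite lt_neqAle boxdist_ge0 andbT eq_sym; apply: contra xab => /eqP.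
  have h0 i : true -> 0 <= Num.max 0 (Num.max (tnth a i - tnth x i) (tnth x i - tnth b i)).
    by rewrite le_max lexx.
  move/eqP; rewrite /boxdist psumr_eq0// => /allP H; rewrite inE => i.
  have /eqP/max_idPl := H i (mem_index_enum i).
  by rewrite ge_max !subr_le0.
apply: cvg_near_cst; near=> n.
apply/max_idPl; rewrite subr_le0 -ler_pdivrMr//.
by near: n; exact: nbhs_infty_ger.
Unshelve. all: end_near. Qed.

End Convolution.

(** * Uniqueness of the law with given characteristic function *)

Section CharacteristicUniqueness.
Context {R : realType} {d : nat}.
Notation V := (d.-tuple R).

(** The variance bound is read off the characteristic function by [second_moment_le]; then
    [|x| <= s / 2 + x^2 / (2 s)]. *)
Lemma gaussV_abs_coord (s : R) (i : 'I_d) : 0 < s ->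
  (\int[gaussV s d]_x `|tnth x i|%:E <= s%:E)%E.
Proof.
move=> s0.
have h2 : (\int[gaussV s d]_x (tnth x i ^+ 2)%:E <= (s ^+ 2)%:E)%E.
  apply: second_moment_le => [|h]; first exact: measurable_tnth.
  pose t : V := [tuple (if j == i then h else 0) | j < d].
  have dt x : dotv t x = h * tnth x i.
    rewrite /dotv (bigD1 i)//= tnth_mktuple eqxx big1 ?addr0// => j ji.
    by rewrite tnth_mktuple (negbTE ji) mul0r.
  have := @Rintegral_cos_gaussV R s d t 0 s0.
  under eq_Rintegral do rewrite addr0 dt.
  move=> ->; rewrite cos0 mul1r.
  rewrite (_ : nsq t = h ^+ 2); last first.
    rewrite /nsq (bigD1 i)//= tnth_mktuple eqxx big1 ?addr0// => j ji.
    by rewrite tnth_mktuple (negbTE ji) expr0n.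
  have := expR_ge1Dx (- (s ^+ 2 * h ^+ 2 / 2)).
  lra.
apply: (@le_trans _ _ (\int[gaussV s d]_x ((s / 2)%:E + (2 * s)^-1%:E * (tnth x i ^+ 2)%:E))%E).
  apply: ge0_le_integral => //.
  - by apply/measurable_EFinP; apply: measurableT_comp => //; exact: measurable_tnth.
  - apply: emeasurable_funD => //; apply: emeasurable_funM => //; apply/measurable_EFinP.
    by apply: measurable_funX; exact: measurable_tnth.
  - move=> x _; rewrite -EFinM -EFinD lee_fin -[tnth x i ^+ 2]real_normK ?num_real//.
    have -> : s / 2 + (2 * s)^-1 * `|tnth x i| ^+ 2 =
      (2 * s)^-1 * (`|tnth x i| - s) ^+ 2 + `|tnth x i|.
      by field; rewrite gt_eqF.
    by rewrite lerDr mulr_ge0 ?sqr_ge0// invr_ge0 mulr_ge0// ltW.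
rewrite ge0_integralD//; last 3 first.
- by move=> x _; rewrite lee_fin divr_ge0// ltW.
- by move=> x _; rewrite mule_ge0// lee_fin ?sqr_ge0// invr_ge0 mulr_ge0// ltW.
- apply: emeasurable_funM => //; apply/measurable_EFinP.
  by apply: measurable_funX; exact: measurable_tnth.
rewrite integral_cst// measure_prob_setT mule1 ge0_integralZl//; last 3 first.
- by apply/measurable_EFinP; apply: measurable_funX; exact: measurable_tnth.
- by move=> x _; rewrite lee_fin sqr_ge0.
- by rewrite lee_fin invr_ge0 mulr_ge0// ltW.
apply: (@le_trans _ _ ((s / 2)%:E + (2 * s)^-1%:E * (s ^+ 2)%:E)%E).
  by rewrite leeD2l// lee_wpmul2l// lee_fin invr_ge0 mulr_ge0// ltW.
rewrite -EFinM -EFinD lee_fin le_eqVlt; apply/orP; left; apply/eqP.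
by field; rewrite gt_eqF.
Qed.

Lemma gaussV_norm1 (s : R) : 0 < s ->
  (\int[gaussV s d]_x (norm1 x)%:E <= (d%:R * s)%:E)%E.
Proof.
move=> s0; rewrite /norm1.
under eq_integral do rewrite -sumEFin.
rewrite ge0_integral_sum//; last first.
  by move=> i; apply/measurable_EFinP; apply: measurableT_comp => //; exact: measurable_tnth.
apply: (@le_trans _ _ (\sum_(i < d) s%:E)%E).
  by apply: lee_sum => i _; exact: gaussV_abs_coord.
by rewrite sumEFin sumr_const card_ord mulr_natl.
Qed.

Let mnorm1 : measurable_fun [set: V] (@norm1 R d).
Proof. by apply: measurable_sum => i; apply: measurableT_comp => //; exact: measurable_tnth. Qed.

Let norm1_ge0 (x : V) : 0 <= norm1 x. Proof. by apply: sumr_ge0. Qed.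

(** The test function is [k]-Lipschitz for [norm1], and the noise has mean [norm1] at most [d s]. *)
Lemma gconv_boxtest (om : probability V R) (s k : R) (a b : V) : 0 < s -> 0 <= k ->
  (\int[gconv om s]_x (boxtest a b k x)%:E <= \int[om]_x (boxtest a b k x)%:E + (k * (d%:R * s))%:E)%E /\
  (\int[om]_x (boxtest a b k x)%:E <= \int[gconv om s]_x (boxtest a b k x)%:E + (k * (d%:R * s))%:E)%E.
Proof.
move=> s0 k0.
have mb := @measurable_boxtest R d a b k.
have b0 x : (0 <= (boxtest a b k x)%:E)%E by rewrite lee_fin boxtest_ge0.
have mbv : measurable_fun [set: V * V] (fun z => (boxtest a b k (vadd z.1 z.2))%:E).
  by apply/measurable_EFinP; exact: (measurableT_comp mb measurable_vadd).
have mbw w : measurable_fun [set: V] (fun y => (boxtest a b k (vadd w y))%:E).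
  exact: (measurableT_comp mbv (pair1_measurable w)).
have EI : (\int[gconv om s]_x (boxtest a b k x)%:E =
    \int[om]_w \int[gaussV s d]_y (boxtest a b k (vadd w y))%:E)%E.
  by rewrite integral_pushprob ?integral_pprod//; exact/measurable_EFinP.
have mI : measurable_fun [set: V] (fun w => \int[gaussV s d]_y (boxtest a b k (vadd w y))%:E)%E.
  by apply: (measurable_fun_fubini_tonelli_F _ mbv).
have mE : measurable_fun [set: V] (EFin \o boxtest a b k) by exact/measurable_EFinP.
have N : (\int[gaussV s d]_y (k * norm1 y)%:E <= (k * (d%:R * s))%:E)%E.
  under eq_integral do rewrite EFinM.
  rewrite ge0_integralZl//; last 2 first.
  - exact/measurable_EFinP.
  - by move=> x _; rewrite lee_fin.
  by rewrite EFinM lee_wpmul2l// ?lee_fin// gaussV_norm1.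
have N0 : (0 <= (k * (d%:R * s))%:E)%E by rewrite lee_fin !mulr_ge0// ltW.
have mN : measurable_fun [set: V] (fun y => (k * norm1 y)%:E).
  by apply/measurable_EFinP; apply: measurable_funM.
rewrite EI.
have cst1 (r : R) (Q : probability V R) : (\int[Q]_x r%:E = r%:E)%E.
  by rewrite (@integral_cst _ _ _ Q setT measurableT r%:E) measure_prob_setT mule1.
split.
  rewrite -[X in (_ + X)%E](cst1 _ om) -ge0_integralD//.
  apply: ge0_le_integral => //.
  - by move=> x _; exact: integral_ge0.
  - by apply: emeasurable_funD.
  move=> w _.
  apply: (@le_trans _ _ (\int[gaussV s d]_y ((boxtest a b k w)%:E + (k * norm1 y)%:E))%E).
    apply: ge0_le_integral => //.
    - by apply: emeasurable_funD.
    - by move=> y _; rewrite -EFinD lee_fin; exact: (boxtest_lip a b w y k0).1.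
  rewrite ge0_integralD//; last by move=> y _; rewrite lee_fin mulr_ge0.
  by rewrite cst1 leeD2l.
rewrite -[X in (_ + X)%E](cst1 _ om) -ge0_integralD//; last by move=> x _; exact: integral_ge0.
apply: ge0_le_integral => //.
- by apply: emeasurable_funD.
move=> w _.
apply: (@le_trans _ _ (\int[gaussV s d]_y ((boxtest a b k (vadd w y))%:E + (k * norm1 y)%:E))%E).
  rewrite -[leLHS](cst1 _ (gaussV s d)); apply: ge0_le_integral => //.
  - by apply: emeasurable_funD.
  - by move=> y _; rewrite -EFinD lee_fin; exact: (boxtest_lip a b w y k0).2.
rewrite ge0_integralD//; last by move=> y _; rewrite lee_fin mulr_ge0.
by rewrite leeD2l.
Qed.

(** By [sdensE] the smoothed laws have the same density for every [s]. Letting [s] tend to 0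
    identifies the integrals of Lipschitz test functions, and letting [k] tend to infinity the
    masses of boxes. *)
Theorem characteristic_unique (nu1 nu2 : probability V R) :
  (forall t, chC nu1 t = chC nu2 t) -> (forall t, chS nu1 t = chS nu2 t) ->
  forall A, measurable A -> nu1 A = nu2 A.
Proof.
move=> C12 S12.
have Econv s F : 0 < s -> measurable_fun [set: V] F -> (forall x, 0 <= F x)%E ->
    (\int[gconv nu1 s]_x F x = \int[gconv nu2 s]_x F x)%E.
  move=> s0 mF F0; rewrite !integral_gconv//.
  apply: eq_integral => y _; rewrite !sdensE//.
  by under eq_Rintegral do rewrite C12 S12.
have ib (nu : probability V R) a b (k : R) : 0 <= k -> nu.-integrable setT (EFin \o boxtest a b k).
  move=> k0; apply: (@bounded_integrable _ _ _ _ _ 1); first exact: measurable_boxtest.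
  by move=> x; rewrite ger0_norm ?boxtest_ge0// boxtest_le1.
have Ebox a b (k : R) : 0 <= k ->
    (\int[nu1]_x (boxtest a b k x)%:E = \int[nu2]_x (boxtest a b k x)%:E)%E.
  move=> k0; rewrite !EFin_Rintegral; [|exact: ib|exact: ib].
  have half (m1 m2 : probability V R) : (forall s, 0 < s ->
      (\int[gconv m1 s]_x (boxtest a b k x)%:E = \int[gconv m2 s]_x (boxtest a b k x)%:E)%E) ->
      \int[m1]_x boxtest a b k x <= \int[m2]_x boxtest a b k x.
    move=> H; apply/ler_addgt0Pr => e e0.
    (* Smoothing costs [k d s] once for each law; with this [s] the two costs add up to at most
       [e]. *)
    pose s := e / (2 * (k * d%:R + 1)).
    have kd0 : 0 <= k * d%:R by rewrite mulr_ge0.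
    have kd1 : 0 < k * d%:R + 1 by rewrite ltr_wpDl.
    have s0 : 0 < s by rewrite divr_gt0// mulr_gt0.
    have [_ h1] := gconv_boxtest m1 a b s0 k0.
    have [h2 _] := gconv_boxtest m2 a b s0 k0.
    rewrite -lee_fin EFinD -!EFin_Rintegral; [|exact: ib|exact: ib].
    apply: (le_trans h1); rewrite H//.
    apply: (le_trans (leeD2r _ h2)).
    rewrite -addeA leeD2l// -EFinD lee_fin.
    rewrite (_ : _ + _ = (2 * (k * d%:R)) * s); last by ring.
    rewrite /s mulrCA -[leRHS]mulr1 ler_wpM2l ?(ltW e0)// ler_pdivrMr ?mulr_gt0// mul1r.
    by rewrite ler_wpM2l// lerDl.
  congr EFin; apply/eqP; rewrite eq_le; apply/andP; split; apply: half => s s0.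
    by apply: Econv => //; [apply/measurable_EFinP; exact: measurable_boxtest|
      move=> x; rewrite lee_fin boxtest_ge0].
  apply/esym; apply: Econv => //; first by apply/measurable_EFinP; exact: measurable_boxtest.
  by move=> x; rewrite lee_fin boxtest_ge0.
have Cbox (nu : probability V R) a b :
    (\int[nu]_x (boxtest a b n%:R x)%:E @[n --> \oo] --> nu (box a b))%E.
  rewrite -[X in _ --> X](_ : \int[nu]_x (\1_(box a b) x)%:E = _)%E; last first.
    by rewrite integral_indic ?setIT//; exact: measurable_box.
  apply: (@dominated_cvg _ _ _ nu setT measurableT _ _ (cst 1%E)) => //.
  - by move=> n; apply/measurable_EFinP; exact: measurable_boxtest.
  - by move=> x _; apply: cvg_EFin; [exact: nearW|exact: cvg_boxtest].
  - exact: finite_measure_integrable_cst.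
  - by move=> n x _; rewrite /= lee_fin ger0_norm ?boxtest_ge0// boxtest_le1.
apply: measure_eq_boxes => [a b|k]; last first.
  by rewrite (le_lt_trans (probability_le1 _ _)) ?ltry//; exact: measurable_box.
have h2 := Cbox nu2 a b.
have h1 := Cbox nu1 a b.
have E n : (\int[nu1]_x (boxtest a b n%:R x)%:E = \int[nu2]_x (boxtest a b n%:R x)%:E)%E by exact: Ebox.
move: h1; rewrite (eq_cvg _ _ E) => h1.
exact: (cvg_unique _ h1 h2).
Qed.

End CharacteristicUniqueness.

(** * Quadratic forms *)

Section QuadraticForms.
Context {R : realType} {d : nat}.
Notation V := (d.-tuple R).
Implicit Types (K : 'M[R]_d) (x y t : V).

Definition vscale (r : R) x : V := [tuple r * tnth x i | i < d].
Definition basisv (i : 'I_d) : V := [tuple (j == i)%:R | j < d].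
Definition bil K x y : R := \sum_(i < d) \sum_(j < d) tnth x i * K i j * tnth y j.

Lemma quadf_bil K x : quadf K x = bil K x x. Proof. by []. Qed.

Lemma bilDl K x x' y : bil K (vadd x x') y = bil K x y + bil K x' y.
Proof.
rewrite /bil -big_split; apply: eq_bigr => i _; rewrite -big_split /=.
by apply: eq_bigr => j _; rewrite tnth_mktuple !mulrDl.
Qed.

Lemma bilDr K x y y' : bil K x (vadd y y') = bil K x y + bil K x y'.
Proof.
rewrite /bil -big_split; apply: eq_bigr => i _; rewrite -big_split /=.
by apply: eq_bigr => j _; rewrite tnth_mktuple mulrDr.
Qed.

Lemma bilZl K r x y : bil K (vscale r x) y = r * bil K x y.
Proof.
rewrite /bil mulr_sumr; apply: eq_bigr => i _; rewrite mulr_sumr.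
by apply: eq_bigr => j _; rewrite tnth_mktuple !mulrA.
Qed.

Lemma bilZr K r x y : bil K x (vscale r y) = r * bil K x y.
Proof.
rewrite /bil mulr_sumr; apply: eq_bigr => i _; rewrite mulr_sumr.
by apply: eq_bigr => j _; rewrite tnth_mktuple; ring.
Qed.

Lemma bilC K x y : K^T = K -> bil K x y = bil K y x.
Proof.
move=> sK; rewrite /bil exchange_big; apply: eq_bigr => i _; apply: eq_bigr => j _.
by rewrite -{1}sK mxE; ring.
Qed.

Definition rowv K (n : 'I_d) : V := [tuple K n j | j < d].

Lemma bil_basisl K n y : bil K (basisv n) y = dotv (rowv K n) y.
Proof.
rewrite /bil (bigD1 n)//= [X in _ + X]big1 ?addr0 => [|i ni].
  by apply: eq_bigr => j _; rewrite !tnth_mktuple eqxx mul1r.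
by rewrite big1// => j _; rewrite tnth_mktuple (negbTE ni) !mul0r.
Qed.

Lemma dotv_basisr y n : dotv y (basisv n) = tnth y n.
Proof.
rewrite /dotv (bigD1 n)//= tnth_mktuple eqxx mulr1 big1 ?addr0// => i ni.
by rewrite tnth_mktuple (negbTE ni) mulr0.
Qed.

Lemma bil_basis K n m : bil K (basisv n) (basisv m) = K n m.
Proof. by rewrite bil_basisl dotv_basisr tnth_mktuple. Qed.

Lemma quadf_shift K x r n : K^T = K ->
  quadf K (vadd x (vscale r (basisv n))) =
  quadf K x + 2 * r * dotv (rowv K n) x + r ^+ 2 * K n n.
Proof.
move=> sK; rewrite !quadf_bil bilDl !bilDr !bilZl !bilZr [bil K x (basisv n)]bilC//.
rewrite bil_basisl bil_basis; ring.
Qed.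

Lemma psd_diag_ge0 K n : psd K -> 0 <= K n n.
Proof. by move=> [_ /(_ (basisv n))]; rewrite quadf_bil bil_basis. Qed.

(** Along [basisv n] the form is affine with slope [2 D]; a nonzero slope would let it reach the
    value -1. *)
Lemma psd_row0 K n x : psd K -> K n n = 0 -> dotv (rowv K n) x = 0.
Proof.
move=> [sK pK] Kn0; apply/eqP/negPn/negP => D0.
set D := dotv _ _ in D0.
have := pK (vadd x (vscale (- (quadf K x + 1) / (2 * D)) (basisv n))).
rewrite quadf_shift// Kn0 mulr0 addr0 -/D.
have -> : quadf K x + 2 * (- (quadf K x + 1) / (2 * D)) * D = -1 by field.
by rewrite oppr_ge0 ler10.
Qed.

(** The Schur complement, kept at full size. If [K n n = 0], the convention for the inverse of 0
    leaves [K] unchanged, and its row [n] vanishes by [psd_row0]. *)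
Definition schur K (n : 'I_d) : 'M[R]_d := \matrix_(i, j) (K i j - (K n n)^-1 * K i n * K n j).

Lemma quadf_schur K n x : K^T = K ->
  quadf (schur K n) x = quadf K x - (K n n)^-1 * dotv (rowv K n) x ^+ 2.
Proof.
move=> sK.
have sKij i j : K i j = K j i by rewrite -{1}sK mxE.
rewrite /quadf /dotv expr2 mulr_suml mulr_sumr -sumrB; apply: eq_bigr => i _.
rewrite !mulr_sumr -sumrB; apply: eq_bigr => j _.
by rewrite !mxE !tnth_mktuple (sKij i n); ring.
Qed.

(** If [K n n] is nonzero, the new form at [x] is the minimum of the old one on the line through [x]
    directed by [basisv n]. *)
Lemma psd_schur K n : psd K -> psd (schur K n).
Proof.
move=> pK; have [sK K0] := pK; split.
  have sKij i j : K i j = K j i by rewrite -{1}sK mxE.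
  by apply/matrixP => i j; rewrite !mxE (sKij j i) (sKij j n) (sKij i n); ring.
move=> x; rewrite quadf_schur//.
have [Kn0|Kn0] := eqVneq (K n n) 0; first by rewrite Kn0 invr0 mul0r subr0.
have := K0 (vadd x (vscale (- dotv (rowv K n) x / K n n) (basisv n))).
rewrite quadf_shift//; congr (_ <= _); by field.
Qed.

(* Gaussian elimination: subtract one square per coordinate. *)
Lemma psd_sum_squares K : psd K ->
  exists B : 'I_d -> V, forall x, quadf K x = \sum_(j < d) dotv (B j) x ^+ 2.
Proof.
move=> pK.
suff H : forall n, (n <= d)%N -> exists B : 'I_d -> V, exists K' : 'M[R]_d, [/\ psd K',
    (forall i j : 'I_d, (i < n)%N -> K' i j = 0) &
    forall x, quadf K x = \sum_(j < d | (j < n)%N) dotv (B j) x ^+ 2 + quadf K' x].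
  have [B [K' [_ K0 E]]] := H d (leqnn d).
  exists B => x; rewrite E [quadf K' x]big1 ?addr0 => [|i _].
    by apply: eq_bigl => j; rewrite ltn_ord.
  by rewrite big1// => j _; rewrite K0 ?ltn_ord// mulr0 mul0r.
elim=> [|n IHn] nd.
  exists (fun=> vzero R d), K; split => // x.
  by rewrite big_pred0 ?add0r// => j; rewrite ltn0.
have [B [K' [pK' K0 E]]] := IHn (ltnW nd).
pose i0 := Ordinal nd.
exists (fun j => if j == i0 then vscale (Num.sqrt (K' i0 i0)^-1) (rowv K' i0) else B j), (schur K' i0).
have [sK' _] := pK'.
split.
- exact: psd_schur.
- move=> i j; rewrite ltnS leq_eqVlt => /predU1P[ni|ltin].
    have -> : i = i0 by exact: val_inj.
    rewrite mxE; have [Kn0|Kn0] := eqVneq (K' i0 i0) 0; last by rewrite mulVf// mul1r subrr.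
    have := psd_row0 (basisv j) pK' Kn0; rewrite dotv_basisr tnth_mktuple => ->.
    by rewrite mulr0 subr0.
  by rewrite mxE !(K0 i)// mulr0 mul0r subr0.
- move=> x; rewrite quadf_schur// E [X in _ = X + _](bigD1 i0) ?ltnSn//= eqxx.
  have -> : dotv (vscale (Num.sqrt (K' i0 i0)^-1) (rowv K' i0)) x ^+ 2 =
     (K' i0 i0)^-1 * dotv (rowv K' i0) x ^+ 2.
    rewrite -[(K' i0 i0)^-1 in RHS]sqr_sqrtr ?invr_ge0 ?psd_diag_ge0// -exprMn.
    congr (_ ^+ 2); rewrite /dotv mulr_sumr; apply: eq_bigr => j _.
    by rewrite !tnth_mktuple mulrA.
  have rr (a b c : R) : a + b + (c - a) = b + c by ring.
  rewrite rr; congr (_ + _).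
  apply/esym; apply: eq_big => [j|j /andP[_ /negbTE ->]//].
  rewrite ltnS leq_eqVlt; have [->|ji] := eqVneq j i0; first by rewrite andbF /= ltnn.
  rewrite andbT; case: eqP => // jn; case/eqP: ji; exact: val_inj.
Qed.

Lemma nsq_ge0 x : 0 <= nsq x.
Proof. by apply: sumr_ge0 => i _; exact: sqr_ge0. Qed.

Lemma nsq_eq0 x : nsq x = 0 -> x = vzero R d.
Proof.
move/eqP; rewrite psumr_eq0 => [/allP H|i _]; last exact: sqr_ge0.
apply/eq_from_tnth => i; rewrite tnth_mktuple; apply/eqP.
by rewrite -sqrf_eq0; exact: (H i (mem_index_enum i)).
Qed.

(** In the sum of squares, definiteness makes the matrix of the linear forms [B j] invertible. So
    each coordinate of [x] is a combination of the numbers [dotv (B j) x], all bounded by the square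
    root of [quadf K x]. Adding 1 to [C] covers dimension 0. *)
Lemma posdef_coercive K : posdef K ->
  exists2 l : R, 0 < l & forall x, l * nsq x <= quadf K x.
Proof.
move=> [sK K0].
have qz : quadf K (vzero R d) = 0.
  by rewrite quadf_bil /bil big1// => i _; rewrite big1// => j _; rewrite tnth_mktuple !mul0r.
have pK : psd K.
  split => // x; have [->|] := pselect (x = vzero R d); first by rewrite qz.
  by move=> /K0/ltW.
have [B E] := psd_sum_squares pK.
pose M : 'M[R]_d := \matrix_(i, j) tnth (B j) i.
have XM x j : ((\row_i tnth x i) *m M) 0 j = dotv (B j) x.
  by rewrite mxE; apply: eq_bigr => i _; rewrite !mxE mulrC.
have uM : M \in unitmx.
  rewrite -row_free_unit -kermx_eq0; apply/rowV0P => u /sub_kermxP uM0.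
  pose x : V := [tuple u 0 i | i < d].
  have xu : \row_i tnth x i = u by apply/rowP => i; rewrite mxE tnth_mktuple.
  have [x0|x0] := pselect (x = vzero R d).
    by apply/rowP => i; rewrite -xu !mxE x0 tnth_mktuple.
  have := K0 _ x0; rewrite E big1 ?ltxx// => j _.
  by rewrite -XM xu uM0 mxE expr0n.
pose N := invmx M.
pose C := \sum_(i < d) (\sum_(j < d) `|N j i|) ^+ 2.
have C0 : 0 <= C by apply: sumr_ge0 => i _; exact: sqr_ge0.
exists (C + 1)^-1; first by rewrite invr_gt0 ltr_wpDl.
move=> x; rewrite mulrC ler_pdivrMr ?ltr_wpDl//.
have q0 : 0 <= quadf K x by exact: pK.2.
apply: (@le_trans _ _ (quadf K x * C)); last by rewrite ler_wpM2l// lerDl.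
rewrite /nsq mulr_sumr; apply: ler_sum => i _.
have -> : tnth x i = \sum_(j < d) dotv (B j) x * N j i.
  have := congr1 (fun u : 'rV_d => u 0 i) (mulmxK uM (\row_i tnth x i)).
  by rewrite [X in X = _]mxE [X in _ = X]mxE => <-; apply: eq_bigr => j _; rewrite XM.
rewrite -[quadf K x]sqr_sqrtr// -exprMn.
rewrite -[leLHS]real_normK ?num_real// lerXn2r ?nnegrE//.
  by rewrite mulr_ge0 ?sqrtr_ge0// sumr_ge0.
apply: (le_trans (ler_norm_sum _ _ _)); rewrite mulr_sumr; apply: ler_sum => j _.
rewrite normrM ler_wpM2r// -sqrtr_sqr ler_sqrt// E (bigD1 j)//= lerDl.
by apply: sumr_ge0 => k _; exact: sqr_ge0.
Qed.

Lemma quadf_sub_scalar K l x : quadf (K - l%:M) x = quadf K x - l * nsq x.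
Proof.
rewrite /quadf /nsq mulr_sumr -sumrB; apply: eq_bigr => i _.
rewrite (eq_bigr (fun j => tnth x i * K i j * tnth x j - tnth x i * (l *+ (i == j)) * tnth x j)); last first.
  by move=> j _; rewrite !mxE; ring.
rewrite sumrB; congr (_ - _); rewrite (bigD1 i)//= eqxx big1 ?addr0 => [|j ji].
  by rewrite mulr1n; ring.
by rewrite eq_sym (negbTE ji) mulr0n mulr0 mul0r.
Qed.

Lemma psd_sub_scalar K l : K^T = K -> (forall x, l * nsq x <= quadf K x) -> psd (K - l%:M).
Proof.
move=> sK h; split; last by move=> x; rewrite quadf_sub_scalar subr_ge0.
by rewrite /symmetric_mx linearB/= sK tr_scalar_mx.
Qed.

Lemma nsqE x : nsq x = dotv x x.
Proof. by apply: eq_bigr => i _; rewrite expr2. Qed.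

Lemma dotv_scale r t x : dotv (vscale r t) x = r * dotv t x.
Proof. by rewrite /dotv mulr_sumr; apply: eq_bigr => i _; rewrite tnth_mktuple mulrA. Qed.

Lemma nsq_scale r x : nsq (vscale r x) = r ^+ 2 * nsq x.
Proof. by rewrite /nsq mulr_sumr; apply: eq_bigr => i _; rewrite tnth_mktuple exprMn. Qed.

Lemma quadf_scale K r x : quadf K (vscale r x) = r ^+ 2 * quadf K x.
Proof. by rewrite !quadf_bil bilZl bilZr; ring. Qed.

Lemma dotv_sqr_le t x : dotv t x ^+ 2 <= nsq t * nsq x.
Proof.
have [x0|x0] := eqVneq (nsq x) 0.
  rewrite (nsq_eq0 x0) /dotv big1 ?expr0n ?mulr_ge0 ?nsq_ge0// => i _.
  by rewrite tnth_mktuple mulr0.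
have xgt0 : 0 < nsq x by rewrite lt_neqAle eq_sym x0 nsq_ge0.
have := nsq_ge0 (vsub (vscale (nsq x) t) (vscale (dotv t x) x)).
have -> : nsq (vsub (vscale (nsq x) t) (vscale (dotv t x) x)) =
  nsq x * (nsq t * nsq x - dotv t x ^+ 2).
  rewrite nsqE dotv_vsub ![dotv (vsub _ _) _]dotvC !dotv_vsub !dotv_scale.
  by rewrite ![dotv _ (vscale _ _)]dotvC !dotv_scale -!nsqE [dotv x t]dotvC; ring.
by rewrite pmulr_rge0// subr_ge0.
Qed.

End QuadraticForms.

(** * Gaussian laws as affine images of the standard one *)

Section GaussianBase.
Context {R : realType} {d : nat}.
Notation V := (d.-tuple R).
Variables (m : V) (B : 'I_d -> V).

Definition affv (x : V) : V := [tuple tnth m i + \sum_(j < d) tnth (B j) i * tnth x j | i < d].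

Lemma measurable_affv : measurable_fun [set: V] affv.
Proof.
apply/measurable_fun_tnthP => i.
rewrite (_ : _ \o _ = fun x => tnth m i + \sum_(j < d) tnth (B j) i * tnth x j); last first.
  by apply/funext => x /=; rewrite tnth_mktuple.
apply: measurable_funD => //; apply: measurable_sum => j; apply: measurable_funM => //.
exact: measurable_tnth.
Qed.

Definition affgauss : probability V R := pushprob (gaussV 1 d) measurable_affv.

Lemma dotv_affv t x : dotv t (affv x) = dotv [tuple dotv (B j) t | j < d] x + dotv t m.
Proof.
rewrite /dotv addrC.
rewrite (eq_bigr (fun i => tnth t i * tnth m i + \sum_(j < d) tnth t i * (tnth (B j) i * tnth x j))); last first.
  by move=> i _; rewrite tnth_mktuple mulrDr mulr_sumr.
rewrite big_split /=; congr (_ + _); rewrite exchange_big /=; apply: eq_bigr => j _.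
by rewrite tnth_mktuple mulr_suml; apply: eq_bigr => i _; ring.
Qed.

Lemma Rintegral_cos_affgauss t c : \int[affgauss]_x cos (dotv t x + c) =
  cos (dotv t m + c) * expR (- ((\sum_(j < d) dotv (B j) t ^+ 2) / 2)).
Proof.
rewrite (@Rintegral_pushprob _ _ _ _ _ _ _ _ _ 1); last 2 first.
- exact: measurable_cos_dotv.
- by move=> y; exact: cos_max.
under eq_Rintegral do rewrite dotv_affv -addrA.
apply: (etrans (Rintegral_cos_gaussV _ _ ltr01)).
have -> // : 1 ^+ 2 * nsq [tuple dotv (B j) t | j < d] = \sum_(j < d) dotv (B j) t ^+ 2.
by rewrite expr1n mul1r; apply: eq_bigr => j _; rewrite tnth_mktuple.
Qed.

Lemma chC_affgauss t : chC affgauss t =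
  cos (dotv t m) * expR (- ((\sum_(j < d) dotv (B j) t ^+ 2) / 2)).
Proof.
rewrite -[dotv t m]addr0 -Rintegral_cos_affgauss.
by apply: eq_Rintegral => x _; rewrite addr0.
Qed.

Lemma chS_affgauss t : chS affgauss t =
  sin (dotv t m) * expR (- ((\sum_(j < d) dotv (B j) t ^+ 2) / 2)).
Proof.
rewrite -cosBpihalf -Rintegral_cos_affgauss.
by apply: eq_Rintegral => x _; rewrite cosBpihalf.
Qed.

End GaussianBase.

(** * The functional equation *)

Section QuadraticEquation.
Context {R : realType}.

(** The defect [h] is additive and vanishes on integers, so it is periodic and bounded everywhere;
    since [h (n r) = n h r], it is zero. *)
Lemma additive_bounded_linear (g : R -> R) (D : R) :
  {morph g : x y / x + y} -> (forall r, `|r| <= 1 -> `|g r| <= D) ->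
  forall r, g r = r * g 1.
Proof.
move=> gD gb.
pose h r := g r - r * g 1.
have hD x y : h (x + y) = h x + h y by rewrite /h gD; ring.
have h0 : h 0 = 0 by have := hD 0 0; rewrite addr0 -[X in X = _]addr0 => /addrI.
have hM (n : nat) r : h (n%:R * r) = n%:R * h r.
  elim: n => [|n IHn]; first by rewrite !mul0r.
  by rewrite -natr1 !mulrDl !mul1r hD IHn.
have h1 : h 1 = 0 by rewrite /h mul1r subrr.
have hn (n : nat) : h n%:R = 0 by have := hM n 1; rewrite mulr1 h1 mulr0.
have hN x : h (- x) = - h x.
  by apply/eqP; rewrite -subr_eq0 opprK addrC -hD subrr h0.
have hz (z : int) : h z%:~R = 0.
  by case: z => n; [exact: hn|rewrite NegzE mulrNz hN hn oppr0].
have hb r : `|h r| <= 2 * D.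
  have -> : h r = h (r - (Num.floor r)%:~R) by rewrite hD hN hz oppr0 addr0.
  have fr0 : 0 <= r - (Num.floor r)%:~R by rewrite subr_ge0 floor_le_tmp.
  have fr1 : r - (Num.floor r)%:~R <= 1.
    by rewrite lerBlDl ltW// -(intrD _ _ 1) floorD1_gt.
  set x := r - _ in fr0 fr1 *.
  rewrite /h; apply: (le_trans (ler_normB _ _)).
  rewrite normrM (ger0_norm fr0).
  have gx : `|g x| <= D by apply: gb; rewrite ger0_norm.
  have g1 : `|g 1| <= D by apply: gb; rewrite normr1.
  have : x * `|g 1| <= 1 * D by apply: ler_pM.
  lra.
move=> r; apply/eqP; rewrite -subr_eq0 -/(h r); apply/negPn/negP => hr0.
have hr : 0 < `|h r| by rewrite normr_gt0.
pose n := (Num.truncn (2 * D / `|h r|)).+1.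
have := hb (n%:R * r); rewrite hM normrM normr_nat.
apply/negP; rewrite -ltNge -ltr_pdivrMr//.
exact: truncnS_gt.
Qed.

Context {d : nat}.
Notation V := (d.-tuple R).
Notation "x +v y" := (@vadd R d x y) (at level 50, left associativity).
Notation "x -v y" := (@vsub R d x y) (at level 50, left associativity).
Notation v0 := (vzero R d).

Ltac veq := apply/eq_from_tnth => ?; rewrite ?tnth_mktuple; try ring.

Lemma linear_coords (L : V -> R) : (forall x y, L (x +v y) = L x + L y) ->
  (forall r x, L (vscale r x) = r * L x) ->
  forall x, L x = \sum_(i < d) tnth x i * L (basisv i).
Proof.
move=> LD LZ x.
have L0 : L v0 = 0.
  have := LZ 0 v0; rewrite mul0r => <-; congr L; veq.
pose tr n : V := [tuple if (i < n)%N then tnth x i else 0 | i < d].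
have H n : (n <= d)%N -> L (tr n) = \sum_(i < d | (i < n)%N) tnth x i * L (basisv i).
  elim: n => [|n IHn] nd.
    by rewrite big_pred0// -L0; congr L; veq.
  pose i0 := Ordinal nd.
  have -> : tr n.+1 = tr n +v vscale (tnth x i0) (basisv i0).
    apply/eq_from_tnth => i; rewrite !tnth_mktuple ltnS leq_eqVlt.
    have [->|ii0] := eqVneq i i0; first by rewrite /= eqxx ltnn /= mulr1 add0r.
    have -> : (i == n :> nat) = false.
      by apply/negbTE; apply: contra ii0 => /eqP ni; apply/eqP/val_inj.
    by rewrite /= mulr0 addr0.
  rewrite LD LZ IHn ?(ltnW nd)// [RHS](bigD1 i0 (ltnSn n)) [RHS]addrC; apply: f_equal2 => //.
  apply: eq_bigl => i; rewrite [in RHS]ltnS [in RHS]leq_eqVlt.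
  have [->|ii0] := eqVneq i i0; first by rewrite andbF /= ltnn.
  rewrite andbT; case: eqP => // ni; by case/eqP: ii0; apply/val_inj.
have -> : x = tr d by apply/eq_from_tnth => i; rewrite tnth_mktuple ltn_ord.
rewrite H//; apply: eq_big => [i|i _]; first by rewrite ltn_ord.
by rewrite tnth_mktuple ltn_ord.
Qed.

Lemma nsqD_le (x y : V) : nsq (x +v y) <= 2 * nsq x + 2 * nsq y.
Proof.
rewrite /nsq !mulr_sumr -big_split; apply: ler_sum => i _; rewrite tnth_mktuple /=.
by have := sqr_ge0 (tnth x i - tnth y i); lra.
Qed.

(* Jordan and von Neumann: the polarization of a bounded solution of the
   parallelogram law is bilinear. *)
Lemma parallelogram_quadf (q : V -> R) (C : R) :
  (forall x y, q (x +v y) + q (x -v y) = 2 * q x + 2 * q y) ->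
  (forall x, 0 <= q x <= C * nsq x) ->
  exists2 K : 'M[R]_d, K^T = K & forall x, q x = quadf K x.
Proof.
move=> pq qb.
have addC (x y : V) : x +v y = y +v x by veq.
pose F x y := q (x +v y) - q x - q y.
have FC x y : F x y = F y x by rewrite /F addC; ring.
have FD x x' y : F (x +v x') y = F x y + F x' y.
  (* The sum of the first two instances minus the third, with the fourth eliminating
     [q (x -v x')]. *)
  have := pq (x +v y) x'; have := pq (x' +v y) x; have := pq y (x -v x'); have := pq x x'.
  have -> : x +v y +v x' = x +v x' +v y by veq.
  have -> : x' +v y +v x = x +v x' +v y by veq.
  have -> : y +v (x -v x') = x +v y -v x' by veq.
  have -> : y -v (x -v x') = x' +v y -v x by veq.
  rewrite /F; lra.
have C0 (x : V) : 0 <= C * nsq x by have /andP[/le_trans h /h] := qb x.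
have q0 : q v0 = 0.
  have /andP[h1 h2] := qb v0; apply/le_anti; rewrite h1 andbT (le_trans h2)//.
  by rewrite /nsq big1 ?mulr0// => i _; rewrite tnth_mktuple expr0n.
have FZ r x y : F (vscale r x) y = r * F x y.
  have := @additive_bounded_linear (fun r => F (vscale r x) y) (4 * (C * nsq x) + 4 * (C * nsq y)).
  move=> /(_ _ _ r) ->.
  - by congr (_ * F _ _); veq.
  - move=> u v; rewrite -FD; congr F; veq.
  - move=> u u1; rewrite /F.
    have nu : C * nsq (vscale u x) <= C * nsq x.
      rewrite nsq_scale mulrCA ler_piMl//.
      by rewrite -[u ^+ 2]real_normK ?num_real// exprn_ile1.
    have /andP[a1 a2] := qb (vscale u x +v y).
    have /andP[b1 b2] := qb (vscale u x).
    have /andP[c1 c2] := qb y.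
    have e : C * nsq (vscale u x +v y) <= 2 * (C * nsq (vscale u x)) + 2 * (C * nsq y).
      have [Cge|Clt] := leP 0 C.
        by have := ler_wpM2l Cge (nsqD_le (vscale u x) y); rewrite mulrDr ![C * (2 * _)]mulrCA.
      have := C0 (vscale u x); have := C0 y.
      have : C * nsq (vscale u x +v y) <= 0 by rewrite mulr_le0_ge0 ?nsq_ge0 ?ltW.
      lra.
    have := C0 x; have := C0 y => *.
    rewrite ler_norml; apply/andP; split; lra.
exists (\matrix_(i, j) (F (basisv i) (basisv j) / 2)).
  by apply/matrixP => i j; rewrite !mxE FC.
move=> x.
have Fxx : F x x = 2 * q x.
  have := pq x x; have -> : x -v x = v0 by veq.
  by rewrite q0 /F; lra.
apply: (@mulfI _ 2) => //; rewrite -Fxx.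
rewrite (@linear_coords (F x))//; last 2 first.
- by move=> u v; rewrite FC FD FC [F v x]FC.
- by move=> r u; rewrite FC FZ FC.
rewrite /quadf exchange_big mulr_sumr; apply: eq_bigr => j _.
rewrite FC (@linear_coords (F (basisv j)))//; last 2 first.
- by move=> u v; rewrite FC FD FC [F v _]FC.
- by move=> r u; rewrite FC FZ FC.
rewrite !mulr_sumr; apply: eq_bigr => i _.
by rewrite mxE FC; field.
Qed.

End QuadraticEquation.

Section FunctionalEquation.
Context {R : realType} {d : nat}.
Notation V := (d.-tuple R).
Notation "x +v y" := (@vadd R d x y) (at level 50, left associativity).
Notation "x -v y" := (@vsub R d x y) (at level 50, left associativity).
Notation v0 := (vzero R d).
Variables (M l : R).
Hypothesis M0 : 0 <= M.

Ltac veq := apply/eq_from_tnth => ?; rewrite ?tnth_mktuple; try ring.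

(* What is used of the characteristic function [c + i s] of [Y - E Y], where
   [Y] has second moment at most [M] and a Gaussian component of covariance
   [l * I]. *)
Record chreg (c s : V -> R) : Prop := ChReg {
  chreg_c : forall t, `|1 - c t| <= M * nsq t;
  chreg_s : forall t, `|s t| <= M * nsq t;
  chreg_mod : forall t, c t ^+ 2 + s t ^+ 2 <= expR (- (l * nsq t));
  chreg_clip : forall t t' eta, 0 < eta -> nsq (t -v t') <= eta ^+ 2 ->
    `|c t - c t'| <= eta * (M + 1);
  chreg_slip : forall t t' eta, 0 < eta -> nsq (t -v t') <= eta ^+ 2 ->
    `|s t - s t'| <= eta * (M + 1);
  chreg_cN : forall t, c (v0 -v t) = c t;
  chreg_sN : forall t, s (v0 -v t) = - s t }.

(* Real and imaginary parts of
   [phi1 (u + v) phi2 (u - v) = phi1 u phi2 u phi1 v (phi2 v)^*]. *)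
Definition chfe_re (c1 s1 c2 s2 : V -> R) (u v : V) : R :=
  (c1 (u +v v) * c2 (u -v v) - s1 (u +v v) * s2 (u -v v)) -
  ((c1 u * c2 u - s1 u * s2 u) * (c1 v * c2 v + s1 v * s2 v) -
   (c1 u * s2 u + s1 u * c2 u) * (s1 v * c2 v - c1 v * s2 v)).

Definition chfe_im (c1 s1 c2 s2 : V -> R) (u v : V) : R :=
  (c1 (u +v v) * s2 (u -v v) + s1 (u +v v) * c2 (u -v v)) -
  ((c1 u * c2 u - s1 u * s2 u) * (s1 v * c2 v - c1 v * s2 v) +
   (c1 u * s2 u + s1 u * c2 u) * (c1 v * c2 v + s1 v * s2 v)).

Definition chfe eps (c1 s1 c2 s2 : V -> R) := forall u v,
  `|chfe_re c1 s1 c2 s2 u v| <= eps /\ `|chfe_im c1 s1 c2 s2 u v| <= eps.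

Let half (t : V) := vscale 2^-1 t.

Let halfK t : half t +v half t = t.
Proof. by apply/eq_from_tnth => i; rewrite !tnth_mktuple -mulrDr -mulr2n -[X in _ * X]mulr_natl mulrA mulVf ?mul1r. Qed.

Let nsq_half t : nsq (half t) = nsq t / 4.
Proof. by rewrite nsq_scale; field. Qed.

(* Descent along [t, t/2, t/4, ...]. *)
Let small_ind (Q : V -> Prop) (e : R) : 0 < e -> (forall t, Q (half t) -> Q t) ->
  (forall t, nsq t <= e -> Q t) -> forall t, Q t.
Proof.
move=> e0 Qh Qe t.
have : exists n : nat, nsq t <= e * 4 ^+ n.
  exists (Num.truncn (nsq t / e)).+1.
  rewrite mulrC -ler_pdivrMr//; apply: (le_trans (ltW (truncnS_gt _))).
  set n := (Num.truncn _).+1; elim: (n) => // k IH.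
  rewrite exprS -natr1; have : (1 : R) <= 4 ^+ k by apply: exprn_ege1; rewrite ler1n.
  lra.
case=> n; elim: n t => [|n IHn] t h; first by apply: Qe; rewrite expr0 mulr1 in h.
apply: Qh; apply: IHn; rewrite nsq_half ler_pdivrMr//.
by rewrite -mulrA -exprSr.
Qed.

Let nsq0 : nsq v0 = 0.
Proof. by rewrite /nsq big1// => i _; rewrite tnth_mktuple expr0n. Qed.

Section Exact.
Variables (c1 s1 c2 s2 : V -> R).
Hypotheses (r1 : chreg c1 s1) (r2 : chreg c2 s2) (fe : chfe 0 c1 s1 c2 s2).

Let re0 u v : c1 (u +v v) * c2 (u -v v) - s1 (u +v v) * s2 (u -v v) =
  (c1 u * c2 u - s1 u * s2 u) * (c1 v * c2 v + s1 v * s2 v) -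
   (c1 u * s2 u + s1 u * c2 u) * (s1 v * c2 v - c1 v * s2 v).
Proof. by have [] := fe u v; rewrite normr_le0 subr_eq0 => /eqP. Qed.

Let im0 u v : c1 (u +v v) * s2 (u -v v) + s1 (u +v v) * c2 (u -v v) =
  (c1 u * c2 u - s1 u * s2 u) * (s1 v * c2 v - c1 v * s2 v) +
   (c1 u * s2 u + s1 u * c2 u) * (c1 v * c2 v + s1 v * s2 v).
Proof. by have [_] := fe u v; rewrite normr_le0 subr_eq0 => /eqP. Qed.

Let ch0 c s : chreg c s -> c v0 = 1 /\ s v0 = 0.
Proof.
move=> r; split.
  by have := chreg_c r v0; rewrite nsq0 mulr0 normr_le0 subr_eq0 => /eqP.
by have := chreg_s r v0; rewrite nsq0 mulr0 normr_le0 => /eqP.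
Qed.

Let subvv t : t -v t = v0. Proof. veq. Qed.
Let addvN t : t +v (v0 -v t) = v0. Proof. veq. Qed.
Let subvN t : t -v (v0 -v t) = t +v t. Proof. veq. Qed.

Let a t := c1 t ^+ 2 + s1 t ^+ 2.
Let b t := c2 t ^+ 2 + s2 t ^+ 2.

(** Squared moduli of both sides of the exact equation, where all phases disappear. *)
Let abE u v : a (u +v v) * b (u -v v) = a u * b u * (a v * b v).
Proof.
have -> : a (u +v v) * b (u -v v) =
  (c1 (u +v v) * c2 (u -v v) - s1 (u +v v) * s2 (u -v v)) ^+ 2 +
  (c1 (u +v v) * s2 (u -v v) + s1 (u +v v) * c2 (u -v v)) ^+ 2 by rewrite /a /b; ring.
by rewrite re0 im0 /a /b; ring.
Qed.

Let aN t : a (v0 -v t) = a t. Proof. by rewrite /a (chreg_cN r1) (chreg_sN r1) sqrrN. Qed.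
Let bN t : b (v0 -v t) = b t. Proof. by rewrite /b (chreg_cN r2) (chreg_sN r2) sqrrN. Qed.

Let a0 : a v0 = 1. Proof. by rewrite /a; have [-> ->] := ch0 r1; rewrite expr1n expr0n addr0. Qed.
Let b0 : b v0 = 1. Proof. by rewrite /b; have [-> ->] := ch0 r2; rewrite expr1n expr0n addr0. Qed.

(** The choices [u = v = t/2] and [u = - v = t/2] isolate [a t] and [b t], with the same right-hand
    side since [a] and [b] are even. *)
Let ab t : a t = b t.
Proof.
rewrite -(halfK t); have := abE (half t) (half t); have := abE (half t) (v0 -v half t).
by rewrite subvv addvN subvN aN bN a0 b0 mul1r mulr1 => -> ->.
Qed.

Let aE u v : a (u +v v) * a (u -v v) = a u ^+ 2 * a v ^+ 2.
Proof. by have := abE u v; rewrite -!ab => ->; ring. Qed.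

Let adbl t : a (t +v t) = a t ^+ 4.
Proof. by have := aE t t; rewrite subvv a0 mulr1 => ->; ring. Qed.

(** The ball on which [M * nsq t] is at most one half, so that [c1] stays away from 0; [M + 1]
    avoids a division by zero. *)
Let e1 : R := (2 * (M + 1))^-1.
Let e1_gt0 : 0 < e1. Proof. by rewrite invr_gt0 mulr_gt0// ltr_wpDl. Qed.
Let Me1 (t : V) : nsq t <= e1 -> M * nsq t <= 2^-1.
Proof.
move=> h; have M1 : 0 < M + 1 by rewrite ltr_wpDl.
apply: (@le_trans _ _ ((M + 1) * e1)); last by rewrite /e1 invfM mulrCA divff ?gt_eqF// mulr1.
by apply: ler_pM => //; [exact: nsq_ge0|rewrite lerDl].
Qed.

Let c_small (t : V) : nsq t <= e1 -> 1 - M * nsq t <= c1 t.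
Proof. by move=> h; have := chreg_c r1 t; rewrite ler_norml => /andP[_]; lra. Qed.

(** Positivity near the origin spreads to all arguments through [a (2 t) = a t ^ 4]. *)
Let a_gt0 t : 0 < a t.
Proof.
move: t; apply: (@small_ind (fun t => 0 < a t) e1 e1_gt0) => t h.
  by rewrite -(halfK t) adbl exprn_gt0.
rewrite /a ltr_wpDr ?sqr_ge0// exprn_even_gt0//= gt_eqF//.
have := c_small h; have := Me1 h; lra.
Qed.

Let a_le t : a t <= expR (- (l * nsq t)). Proof. exact: chreg_mod. Qed.

(* [phi_k (2 t)] is [phi_k t ^ 2 * a t]: the phase doubles, while it is
   quadratically small at the origin. *)
Let phase0 c s : (forall t, c (t +v t) = (c t ^+ 2 - s t ^+ 2) * a t) ->
  (forall t, s (t +v t) = 2 * c t * s t * a t) -> (forall t, c t ^+ 2 + s t ^+ 2 = a t) ->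
  (forall t, a t <= 1) -> chreg c s -> forall t, s t = 0 /\ 0 <= c t.
Proof.
move=> cd sd ca a1 r.
have cb t : `|c t| <= 1.
  rewrite -(@ler_pXn2r _ 2)// ?nnegrE// real_normK ?num_real// expr1n.
  by apply: le_trans (a1 t); rewrite -ca lerDl sqr_ge0.
(* One halving divides the quadratic bound by 4 while the doubling formula for [s] multiplies by 2:
   each round gains a factor 2. *)
have sb n : forall t, `|s t| <= M * nsq t / 2 ^+ n.
  elim: n => [|n IHn] t; first by rewrite expr0 divr1; exact: (chreg_s r).
  rewrite -{1}(halfK t) sd.
  have := IHn (half t); rewrite nsq_half => h.
  rewrite (_ : 2 * _ * _ * _ = 2 * (s (half t) * (c (half t) * a (half t)))); last by ring.
  rewrite normrM (ger0_norm (_ : 0 <= 2))// normrM.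
  have ca1 : `|c (half t) * a (half t)| <= 1.
    by rewrite normrM mulr_ile1// ger0_norm ?a1// ltW.
  apply: (@le_trans _ _ (2 * (`|s (half t)| * 1))).
    by rewrite ler_wpM2l// ler_wpM2l.
  rewrite mulr1; apply: (@le_trans _ _ (2 * (M * (nsq t / 4) / 2 ^+ n))); first by rewrite ler_wpM2l.
  rewrite le_eqVlt; apply/orP; left; apply/eqP; rewrite exprS.
  by field; rewrite expf_neq0.
have s0 t : s t = 0.
  apply/eqP; rewrite -normr_le0; apply/ler_addgt0Pr => e e0; rewrite add0r.
  pose n := (Num.truncn (M * nsq t / e)).+1.
  apply: (le_trans (sb n t)).
  rewrite ler_pdivrMr ?exprn_gt0// -ler_pdivrMl// [leLHS]mulrC.
  apply: (le_trans (ltW (truncnS_gt _))); rewrite -/n.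
  by rewrite -natrX ler_nat ltnW// ltn_expl.
move=> t; split => //; rewrite -(halfK t) cd s0 expr0n subr0 mulr_ge0 ?sqr_ge0//.
exact: ltW.
Qed.

Hypothesis l0 : 0 <= l.

Let a_le1 t : a t <= 1.
Proof. by apply: (le_trans (a_le t)); rewrite -expR0 ler_expR oppr_le0 mulr_ge0 ?nsq_ge0. Qed.

(** Doubling in [phi1] is the equation at [v = u], where [phi2] is taken at 0; [phase2] uses
    [v = - u], which exchanges the roles. *)
Let phase1 t : s1 t = 0 /\ 0 <= c1 t.
Proof.
move: t; apply: phase0 r1 => // t.
- have := re0 t t; rewrite subvv; have [-> ->] := ch0 r2; rewrite mulr1 mulr0 subr0 => ->.
  by rewrite ab /b; ring.
- have := im0 t t; rewrite subvv; have [-> ->] := ch0 r2; rewrite mulr1 mulr0 add0r => ->.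
  by rewrite ab /b; ring.
Qed.

Let phase2 t : s2 t = 0 /\ 0 <= c2 t.
Proof.
move: t; apply: phase0 r2 => // t.
- have := re0 t (v0 -v t); rewrite addvN subvN !(chreg_cN r1, chreg_sN r1, chreg_cN r2, chreg_sN r2).
  have [-> ->] := ch0 r1; rewrite mul1r mul0r subr0 => ->.
  by rewrite /a; ring.
- have := im0 t (v0 -v t); rewrite addvN subvN !(chreg_cN r1, chreg_sN r1, chreg_cN r2, chreg_sN r2).
  have [-> ->] := ch0 r1; rewrite mul1r mul0r addr0 => ->.
  by rewrite /a; ring.
Qed.

Let q t := - ln (a t).

Let expq t : expR (- q t) = a t. Proof. by rewrite /q opprK lnK// posrE. Qed.

(** The origin of the bound [4 * M] on [K]. On the small ball, with [x = M * nsq t], the chain is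
    [a >= c1^2 >= (1 - x)^2 >= e^(-4x)]; both sides of the claim are multiplied by 4 when the
    argument doubles. *)
Let q_le t : q t <= 4 * M * nsq t.
Proof.
move: t; apply: (@small_ind (fun t => q t <= 4 * M * nsq t) e1 e1_gt0) => t h.
  have -> : q t = 4 * q (half t).
    by rewrite /q -{1}(halfK t) adbl lnXn ?a_gt0// -mulr_natl; ring.
  by rewrite nsq_half in h; lra.
have x0 : 0 <= M * nsq t by rewrite mulr_ge0 ?nsq_ge0.
have x1 := Me1 h; have cx := c_small h.
rewrite -mulrA; move: (M * nsq t) x0 x1 cx => x x0 x1 cx.
rewrite -lerN2 -ler_expR expq.
apply: (@le_trans _ _ ((1 - x) ^+ 2)).
  rewrite (_ : - (4 * x) = - (2 * x) + - (2 * x)); last by ring.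
  rewrite expRD expr2.
  have e2 : expR (- (2 * x)) <= 1 - x.
    rewrite expRN -[leLHS]mul1r ler_pdivrMr ?expR_gt0//.
    apply: (@le_trans _ _ ((1 - x) * (1 + 2 * x))); last by rewrite ler_wpM2l ?expR_ge1Dx// subr_ge0; lra.
    have : 0 <= x * (1 - 2 * x) by rewrite mulr_ge0//; lra.
    by lra.
  by apply: ler_pM; rewrite ?expR_ge0.
rewrite /a; apply: (@le_trans _ _ (c1 t ^+ 2)); last by rewrite lerDl sqr_ge0.
by rewrite lerXn2r ?nnegrE//; lra.
Qed.

Lemma chfe_exact : exists K : 'M[R]_d, [/\ K^T = K,
  forall x, l * nsq x <= quadf K x <= 4 * M * nsq x &
  forall x, [/\ c1 x = expR (- (quadf K x / 2)), s1 x = 0,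
               c2 x = expR (- (quadf K x / 2)) & s2 x = 0]].
Proof.
have [x y||K sK qK] := @parallelogram_quadf R d q (4 * M).
- have := congr1 (@ln R) (aE x y).
  by rewrite !lnM ?posrE ?mulr_gt0 ?exprn_gt0// /q => h; lra.
- by move=> x; rewrite q_le andbT /q oppr_ge0 -ln1 ler_ln ?posrE.
exists K; split => // x.
  by rewrite -qK q_le andbT /q lerNr -(expRK (- (l * nsq x))) ler_ln ?posrE ?expR_gt0.
have Hk c s : s x = 0 -> 0 <= c x -> c x ^+ 2 + s x ^+ 2 = a x -> c x = expR (- (quadf K x / 2)).
  move=> -> c0; rewrite expr0n addr0 -expq qK => h.
  apply: (@pexpIrn _ 2) => //; rewrite ?nnegrE ?expR_ge0// h expr2 -expRD; congr expR.
  by field.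
have [h1 h1'] := phase1 x; have [h2 h2'] := phase2 x; split => //.
  exact: Hk h1 h1' erefl.
by apply: Hk h2 h2' _; rewrite ab.
Qed.

End Exact.
End FunctionalEquation.

(** * Compactness and the approximate equation *)

Section UltraLimit.
Context {R : realType}.

Lemma ultra_bounded_cvg (G : set_system nat) (u : nat -> R) (D : R) : UltraFilter G ->
  (forall n, `|u n| <= D) -> exists r : R, u n @[n --> G] --> r.
Proof.
move=> UG ub.
have PG : ProperFilter G by exact: ultra_proper.
have [p [_ clp]] : `[- D, D] `&` cluster (u n @[n --> G]) !=set0.
  apply: (@segment_compact R (- D) D).
  have : G (u @^-1` `[- D, D]) by apply: filterE => n /=; rewrite in_itv/= -ler_norml.
  exact.
exists p => B Bp.
have [//|GB] := in_ultra_setVsetC (u @^-1` B) UG.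
by have [y [/= ny yB]] := clp (~` B) B GB Bp.
Qed.

End UltraLimit.

Section ApproximateEquation.
Context {R : realType} {d : nat}.
Notation V := (d.-tuple R).
Notation "x -v y" := (@vsub R d x y) (at level 50, left associativity).
Variables (M l : R).
Hypotheses (M0 : 0 <= M) (l0 : 0 <= l).

Lemma chreg_bound (c s : V -> R) : chreg M l c s -> forall t, `|c t| <= 1 /\ `|s t| <= 1.
Proof.
move=> r t; have := chreg_mod r t.
have : expR (- (l * nsq t)) <= 1 by rewrite -expR0 ler_expR oppr_le0 mulr_ge0 ?nsq_ge0.
move=> e1 h.
have sq (x : R) : x ^+ 2 <= 1 -> `|x| <= 1.
  by move=> x1; rewrite -(@ler_pXn2r _ 2)// ?nnegrE// real_normK ?num_real// expr1n.
have := sqr_ge0 (c t); have := sqr_ge0 (s t) => h1 h2.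
by split; apply: sq; lra.
Qed.

(** Every field of [chreg] is an equation or a weak inequality whose constants do not involve [n];
    this form of the record is chosen for this stability. *)
Lemma chreg_limit (G : set_system nat) (c s : nat -> V -> R) (c' s' : V -> R) : ProperFilter G ->
  (forall n, chreg M l (c n) (s n)) -> (forall t, c n t @[n --> G] --> c' t) ->
  (forall t, s n t @[n --> G] --> s' t) -> chreg M l c' s'.
Proof.
move=> PG r cc ss.
have le (u : nat -> R) (a b : R) : u n @[n --> G] --> a -> (forall n, u n <= b) -> a <= b.
  move=> ua ub; apply: (@ler_cvg_to _ G _ _ _ _ _ _ ua (cvg_cst b)).
  exact: nearW.
have eq (u v : nat -> R) (a b : R) : u n @[n --> G] --> a -> v n @[n --> G] --> b ->
    (forall n, u n = v n) -> a = b.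
  move=> ua vb uv; apply/eqP; rewrite eq_le; apply/andP; split.
    by apply: (@ler_cvg_to _ G _ _ _ _ _ _ ua vb); apply: nearW => n; rewrite uv.
  by apply: (@ler_cvg_to _ G _ _ _ _ _ _ vb ua); apply: nearW => n; rewrite uv.
split.
- move=> t; apply: (le (fun n => `|1 - c n t|)) => [|n]; last exact: (chreg_c (r n)).
  by apply: cvg_norm; apply: cvgB => //; exact: cvg_cst.
- move=> t; apply: (le (fun n => `|s n t|)) => [|n]; last exact: (chreg_s (r n)).
  exact: cvg_norm.
- move=> t; apply: (le (fun n => c n t ^+ 2 + s n t ^+ 2)) => [|n]; last exact: (chreg_mod (r n)).
  by apply: cvgD; apply: cvgM.
- move=> t t' eta eta0 h; apply: (le (fun n => `|c n t - c n t'|)) => [|n]; last exact: (chreg_clip (r n)).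
  by apply: cvg_norm; apply: cvgB.
- move=> t t' eta eta0 h; apply: (le (fun n => `|s n t - s n t'|)) => [|n]; last exact: (chreg_slip (r n)).
  by apply: cvg_norm; apply: cvgB.
- by move=> t; apply: (eq _ _ _ _ (cc _) (cc t)) => n; exact: (chreg_cN (r n)).
- by move=> t; apply: (eq _ _ _ _ (ss _) (cvgN (ss t))) => n; exact: (chreg_sN (r n)).
Qed.

Lemma chfe_limit (G : set_system nat) (c1 s1 c2 s2 : nat -> V -> R) (c1' s1' c2' s2' : V -> R)
    (eps : nat -> R) : ProperFilter G ->
  (forall t, c1 n t @[n --> G] --> c1' t) -> (forall t, s1 n t @[n --> G] --> s1' t) ->
  (forall t, c2 n t @[n --> G] --> c2' t) -> (forall t, s2 n t @[n --> G] --> s2' t) ->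
  eps n @[n --> G] --> 0 -> (forall n, chfe (eps n) (c1 n) (s1 n) (c2 n) (s2 n)) ->
  chfe 0 c1' s1' c2' s2'.
Proof.
move=> PG h1 h2 h3 h4 e0 fe u v.
have mm (x y z t : nat -> R) (x' y' z' t' : R) : x n @[n --> G] --> x' -> y n @[n --> G] --> y' ->
    z n @[n --> G] --> z' -> t n @[n --> G] --> t' ->
    x n * y n - z n * t n @[n --> G] --> x' * y' - z' * t'.
  by move=> ? ? ? ?; apply: cvgB; apply: cvgM.
have pp (x y z t : nat -> R) (x' y' z' t' : R) : x n @[n --> G] --> x' -> y n @[n --> G] --> y' ->
    z n @[n --> G] --> z' -> t n @[n --> G] --> t' ->
    x n * y n + z n * t n @[n --> G] --> x' * y' + z' * t'.
  by move=> ? ? ? ?; apply: cvgD; apply: cvgM.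
have a1 := mm _ _ _ _ _ _ _ _ (h1 u) (h3 u) (h2 u) (h4 u).
have a2 := pp _ _ _ _ _ _ _ _ (h1 v) (h3 v) (h2 v) (h4 v).
have a3 := pp _ _ _ _ _ _ _ _ (h1 u) (h4 u) (h2 u) (h3 u).
have a4 := mm _ _ _ _ _ _ _ _ (h2 v) (h3 v) (h1 v) (h4 v).
split.
  apply: (@ler_cvg_to _ G _ _ _ _ _ _ _ e0 (nearW _ (fun n => (fe n u v).1))).
  apply: cvg_norm; rewrite /chfe_re.
  have b1 := mm _ _ _ _ _ _ _ _ (h1 (vadd u v)) (h3 (u -v v)) (h2 (vadd u v)) (h4 (u -v v)).
  have b2 := mm _ _ _ _ _ _ _ _ a1 a2 a3 a4.
  exact: (cvgB b1 b2).
apply: (@ler_cvg_to _ G _ _ _ _ _ _ _ e0 (nearW _ (fun n => (fe n u v).2))).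
apply: cvg_norm; rewrite /chfe_im.
have b1 := pp _ _ _ _ _ _ _ _ (h1 (vadd u v)) (h4 (u -v v)) (h2 (vadd u v)) (h3 (u -v v)).
have b2 := pp _ _ _ _ _ _ _ _ a1 a4 a3 a2.
exact: (cvgB b1 b2).
Qed.

(** A grid of mesh [1/p] in the cube of half-side [N]: the grid point below [x] misses each
    coordinate by at most [1/p], and [d / p^2 <= eta^2] by the choice of [p]. From [x_i^2 <= N] one
    gets [|x_i| <= N] because [N >= 1]. *)
Lemma finite_net (L eta : R) : 0 < eta -> exists (I : finType) (g : I -> V),
  forall x, nsq x <= L -> exists i, nsq (x -v g i) <= eta ^+ 2.
Proof.
move=> eta0.
pose p : R := (Num.truncn ((d%:R + 1) / eta ^+ 2)).+1%:R.
have p1 : 1 <= p by rewrite ler1n.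
have p0 : 0 < p by rewrite ltr0n.
pose N := (Num.truncn `|L|).+1.
have NL : L <= N%:R by rewrite (le_trans (ler_norm L))// ltW// truncnS_gt.
have N1 : (1 : R) <= N%:R by rewrite ler1n.
pose m := (Num.truncn (p * (2 * N%:R))).+1.
exists {ffun 'I_d -> 'I_m}, (fun f : {ffun 'I_d -> 'I_m} => [tuple (f i)%:R / p - N%:R | i < d]) => x xL.
have xN i : `|tnth x i| <= N%:R.
  have xi2 : tnth x i ^+ 2 <= N%:R.
    by apply: le_trans NL; apply: le_trans xL; rewrite /nsq (bigD1 i)//= lerDl sumr_ge0// => j _; exact: sqr_ge0.
  rewrite leNgt; apply/negP => h.
  have : N%:R ^+ 2 < tnth x i ^+ 2.
    by rewrite -[ltRHS]real_normK ?num_real// ltrXn2r ?nnegrE.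
  move=> h2; have : (N%:R : R) * 1 <= N%:R * N%:R by rewrite ler_wpM2l.
  by rewrite expr2 in h2; lra.
pose k i := Num.truncn (p * (tnth x i + N%:R)).
have y0 i : 0 <= tnth x i + N%:R by have := xN i; rewrite ler_norml => /andP[]; lra.
have kb i : (k i < m)%N.
  rewrite ltnS; apply: le_truncn; apply: ler_wpM2l; first exact: ltW.
  by have := xN i; rewrite ler_norml => /andP[]; lra.
exists [ffun i => Ordinal (kb i)].
apply: (@le_trans _ _ (\sum_(i < d) p ^- 2)).
  apply: ler_sum => i _; rewrite !tnth_mktuple ffunE /=.
  have := truncn_itv (mulr_ge0 (ltW p0) (y0 i)); rewrite -/(k i) => /andP[k1 k2].
  have k1' : (k i)%:R / p <= tnth x i + N%:R by rewrite ler_pdivrMr// mulrC.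
  have k2' : tnth x i + N%:R <= (k i)%:R / p + p^-1.
    by rewrite -{2}[p^-1]mul1r -mulrDl natr1 ler_pdivlMr// mulrC ltW.
  move: k1' k2'; set z := _ / p; set y := tnth x i - _ => k1' k2'.
  have y1 : 0 <= y by rewrite subr_ge0 lerBlDr.
  have y2 : y <= p^-1 by rewrite /y opprB addrA lerBlDl.
  by rewrite -exprVn; apply: lerXn2r; rewrite ?nnegrE ?invr_ge0 ?(ltW p0).
rewrite sumr_const card_ord -[X in X <= _]mulr_natl ler_pdivrMr ?exprn_gt0//.
have h : d%:R + 1 <= p * eta ^+ 2 by rewrite -ler_pdivrMr ?exprn_gt0// ltW// truncnS_gt.
have h2 : p * eta ^+ 2 <= p ^+ 2 * eta ^+ 2.
  by rewrite ler_wpM2r ?sqr_ge0// expr2 ler_peMl// ltW.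
by rewrite mulrC; lra.
Qed.

Definition near_gauss (delta L : R) (K : 'M[R]_d) (c1 s1 c2 s2 : V -> R) :=
  forall x, nsq x <= L ->
    [/\ `|c1 x - expR (- (quadf K x / 2))| <= delta, `|s1 x| <= delta,
        `|c2 x - expR (- (quadf K x / 2))| <= delta & `|s2 x| <= delta].

Theorem chfe_approx (delta L : R) : 0 < delta -> exists2 eps : R, 0 < eps &
  forall c1 s1 c2 s2 : V -> R, chreg M l c1 s1 -> chreg M l c2 s2 -> chfe eps c1 s1 c2 s2 ->
  exists K : 'M[R]_d, [/\ K^T = K, forall x, l * nsq x <= quadf K x <= 4 * M * nsq x &
    near_gauss delta L K c1 s1 c2 s2].
Proof.
move=> delta0; apply: contrapT => nex.
have H (n : nat) : exists w : (V -> R) * (V -> R) * ((V -> R) * (V -> R)),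
   [/\ chreg M l w.1.1 w.1.2, chreg M l w.2.1 w.2.2,
       chfe (n.+1%:R^-1) w.1.1 w.1.2 w.2.1 w.2.2 &
       ~ exists K : 'M[R]_d, [/\ K^T = K, forall x, l * nsq x <= quadf K x <= 4 * M * nsq x &
         near_gauss delta L K w.1.1 w.1.2 w.2.1 w.2.2]].
  apply: contrapT => nw; apply: nex; exists n.+1%:R^-1; first by rewrite invr_gt0.
  move=> c1 s1 c2 s2 r1 r2 fe; apply: contrapT => nK; apply: nw.
  by exists ((c1, s1), (c2, s2)).
have [w /all_and4[r1 r2 fe nK]] := choice H.
(* An ultrafilter makes the four sequences of functions converge at all arguments simultaneously. *)
have [G [UG Goo]] := ultraFilterLemma (eventually_filter : ProperFilter \oo).
have PG : ProperFilter G by exact: ultra_proper.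
have lim (f : nat -> V -> R) : (forall n t, `|f n t| <= 1) ->
    exists f' : V -> R, forall t, f n t @[n --> G] --> f' t.
  move=> f1.
  have /choice[f' hf] t : exists r : R, f n t @[n --> G] --> r.
    by apply: (@ultra_bounded_cvg _ _ _ 1 UG) => n; exact: f1.
  by exists f'.
have [c1 h1] := lim (fun n => (w n).1.1) (fun n t => (chreg_bound (r1 n) t).1).
have [s1 h2] := lim (fun n => (w n).1.2) (fun n t => (chreg_bound (r1 n) t).2).
have [c2 h3] := lim (fun n => (w n).2.1) (fun n t => (chreg_bound (r2 n) t).1).
have [s2 h4] := lim (fun n => (w n).2.2) (fun n t => (chreg_bound (r2 n) t).2).
have R1 := chreg_limit PG r1 h1 h2.
have R2 := chreg_limit PG r2 h3 h4.
have FE : chfe 0 c1 s1 c2 s2.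
  apply: (chfe_limit PG h1 h2 h3 h4 _ fe).
  by apply: cvg_trans (@cvg_harmonic R); move=> A hA; exact: Goo.
have [K [sK bK EK]] := chfe_exact M0 R1 R2 FE l0.
(* Pointwise convergence becomes uniform on the ball through a finite net. Passing to the net point,
   from the sequence to its limit there, and back, costs three times [delta / 4]. *)
pose eta := delta / (4 * (M + 1)).
have M1 : 0 < M + 1 by rewrite ltr_wpDl.
have eta0 : 0 < eta by rewrite divr_gt0// mulr_gt0.
have etaE : eta * (M + 1) = delta / 4 by rewrite /eta; field; rewrite gt_eqF.
have [I [g gnet]] := finite_net L eta0.
have d2 : 0 < delta / 4 by rewrite divr_gt0.
have close (f : nat -> V -> R) (f' : V -> R) : (forall t, f n t @[n --> G] --> f' t) ->
   \forall n \near G, forall i, `|f' (g i) - f n (g i)| <= delta / 4.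
  by move=> ff; apply: filter_forall => i; have /cvgrPdist_le := ff (g i); exact.
have : G [set n | near_gauss delta L K (w n).1.1 (w n).1.2 (w n).2.1 (w n).2.2].
  have g1 := close _ _ h1. have g2 := close _ _ h2. have g3 := close _ _ h3. have g4 := close _ _ h4.
  near=> n; move=> x xL.
  have [i xi] := gnet x xL.
  have n1 : forall i, `|c1 (g i) - (w n).1.1 (g i)| <= delta / 4 by near: n.
  have n2 : forall i, `|s1 (g i) - (w n).1.2 (g i)| <= delta / 4 by near: n.
  have n3 : forall i, `|c2 (g i) - (w n).2.1 (g i)| <= delta / 4 by near: n.
  have n4 : forall i, `|s2 (g i) - (w n).2.2 (g i)| <= delta / 4 by near: n.
  have tri (A B C D : R) : `|A - B| <= delta / 4 -> `|C - B| <= delta / 4 ->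
      `|D - C| <= delta / 4 -> `|A - D| <= delta.
    by rewrite !ler_norml => /andP[? ?] /andP[? ?] /andP[? ?]; apply/andP; split; lra.
  have [E1 E2 E3 E4] := EK x.
  have L1 := chreg_clip (r1 n) eta0 xi; have L2 := chreg_slip (r1 n) eta0 xi.
  have L3 := chreg_clip (r2 n) eta0 xi; have L4 := chreg_slip (r2 n) eta0 xi.
  have L1' := chreg_clip R1 eta0 xi; have L2' := chreg_slip R1 eta0 xi.
  have L3' := chreg_clip R2 eta0 xi; have L4' := chreg_slip R2 eta0 xi.
  rewrite !etaE in L1 L2 L3 L4 L1' L2' L3' L4'.
  split.
  - by rewrite -E1; exact: tri L1 (n1 i) L1'.
  - by rewrite -[X in `|X|]subr0 -E2; exact: tri L2 (n2 i) L2'.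
  - by rewrite -E3; exact: tri L3 (n3 i) L3'.
  - by rewrite -[X in `|X|]subr0 -E4; exact: tri L4 (n4 i) L4'.
move/filter_ex => [n hn].
by apply: (nK n); exists K.
Unshelve. all: end_near. Qed.

End ApproximateEquation.

(** * Independence and centred characteristic functions *)

Section Independence.
Context {R : realType} d0 (T : measurableType d0) (P : probability T R).

Definition indep d1 d2 (T1 : measurableType d1) (T2 : measurableType d2)
    (U : T -> T1) (W : T -> T2) :=
  forall A B, measurable A -> measurable B ->
    P (U @^-1` A `&` W @^-1` B) = (P (U @^-1` A) * P (W @^-1` B))%E.

Lemma indep_comp d1 d2 d3 d4 (T1 : measurableType d1) (T2 : measurableType d2)
    (T3 : measurableType d3) (T4 : measurableType d4) (U : T -> T1) (W : T -> T2)
    (f : T1 -> T3) (g : T2 -> T4) : measurable_fun setT f -> measurable_fun setT g ->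
  indep U W -> indep (f \o U) (g \o W).
Proof.
move=> mf mg UW A B mA mB; apply: (UW (f @^-1` A) (g @^-1` B)).
  by rewrite -[X in measurable X]setTI; exact: mf.
by rewrite -[X in measurable X]setTI; exact: mg.
Qed.

Section Pair.
Context d1 d2 (T1 : measurableType d1) (T2 : measurableType d2).
Variables (U : T -> T1) (W : T -> T2).
Hypotheses (mU : measurable_fun setT U) (mW : measurable_fun setT W).

Let mUW : measurable_fun setT (fun w => (U w, W w)).
Proof. exact: measurable_fun_pair. Qed.

(** The event [E] lets [indep_pair] leave rectangles one pair at a time: for [E] a rectangle event
    of the first pair the second pair is extended, then [E] is an arbitrary event of the second
    pair. Both sides are measures in [D], and uniqueness of the product measure applies with one
    factor scaled by [P E]. *)
Lemma restricted_joint_law E : measurable E ->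
  (forall A B, measurable A -> measurable B ->
    P (U @^-1` A `&` W @^-1` B `&` E) = (P E * (P (U @^-1` A) * P (W @^-1` B)))%E) ->
  forall D, measurable D -> P ((fun w => (U w, W w)) @^-1` D `&` E) =
    (P E * pprod (pushprob P mU) (pushprob P mW) D)%E.
Proof.
move=> mE UWE D mD.
have PE0 : 0 <= fine (P E) by rewrite fine_ge0.
pose c := NngNum PE0.
have cE : (c%:num%:E = P E)%E by rewrite /c /= fineK// fin_num_measure.
pose m1 := [the {finite_measure set T1 -> \bar R} of mscale c (pushprob P mU)].
have := @product_measure_unique _ _ T1 T2 R m1 (pushprob P mW)
  [the {measure set _ -> \bar R} of pushforward (mrestr P mE) (fun w => (U w, W w))].
move=> /(_ mUW) H; transitivity ((m1 \x pushprob P mW)%E D).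
  symmetry; apply: H => // A B mA mB.
  by rewrite /m1 /= /mscale cE -muleA -[RHS]UWE.
have := @product_measure_unique _ _ T1 T2 R m1 (pushprob P mW)
  [the {measure set _ -> \bar R} of mscale c (pprod (pushprob P mU) (pushprob P mW))].
move=> ->//; first by rewrite /= /mscale cE.
move=> A B mA mB; rewrite /= /mscale -muleA; congr *%E.
exact: (product_measure1E (pushprob P mU) (pushprob P mW) mA mB).
Qed.

Hypothesis UW : indep U W.

Lemma joint_law D : measurable D ->
  P ((fun w => (U w, W w)) @^-1` D) = pprod (pushprob P mU) (pushprob P mW) D.
Proof.
move=> mD; rewrite -[X in P X]setIT (restricted_joint_law _ _ mD)//.
  by rewrite measure_prob_setT mul1e.
by move=> A B mA mB; rewrite setIT measure_prob_setT mul1e UW.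
Qed.

Lemma indep_Rintegral (h : T1 * T2 -> R) (M : R) : measurable_fun setT h ->
  (forall z, `|h z| <= M) ->
  \int[P]_w h (U w, W w) = \int[pushprob P mU]_x \int[pushprob P mW]_y h (x, y).
Proof.
move=> mh hM; rewrite -(bounded_Fubini _ _ mh hM).1 -(Rintegral_pushprob P mUW mh hM).
congr fine; apply: eq_measure_integral => A mA _.
exact: joint_law.
Qed.

End Pair.

Lemma indep_pair d1 d2 d3 d4 (T1 : measurableType d1) (T2 : measurableType d2)
    (T3 : measurableType d3) (T4 : measurableType d4)
    (X1 : T -> T1) (Z1 : T -> T2) (X2 : T -> T3) (Z2 : T -> T4) :
  measurable_fun setT X1 -> measurable_fun setT Z1 ->
  measurable_fun setT X2 -> measurable_fun setT Z2 ->
  (forall A1 A2 B1 B2, measurable A1 -> measurable A2 -> measurable B1 -> measurable B2 ->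
    P ((X1 @^-1` A1 `&` Z1 @^-1` B1) `&` (X2 @^-1` A2 `&` Z2 @^-1` B2)) =
    (P (X1 @^-1` A1) * P (Z1 @^-1` B1) * (P (X2 @^-1` A2) * P (Z2 @^-1` B2)))%E) ->
  [/\ indep X1 Z1, indep X2 Z2 &
      indep (fun w => (X1 w, Z1 w)) (fun w => (X2 w, Z2 w))].
Proof.
move=> mX1 mZ1 mX2 mZ2 H.
have pre d' (T' : measurableType d') (X : T -> T') A : measurable_fun setT X -> measurable A ->
    measurable (X @^-1` A).
  by move=> mX mA; rewrite -[X in measurable X]setTI; exact: mX.
have i1 : indep X1 Z1.
  move=> A B mA mB; have := H A setT B setT mA measurableT mB measurableT.
  by rewrite !preimage_setT setIT measure_prob_setT setIT !mule1.
have i2 : indep X2 Z2.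
  move=> A B mA mB; have := H setT A setT B measurableT mA measurableT mB.
  by rewrite !preimage_setT setIT measure_prob_setT setTI !mul1e.
split => // D1 D2 mD1 mD2.
have mX1Z1 : measurable_fun setT (fun w => (X1 w, Z1 w)) by exact: measurable_fun_pair.
have mX2Z2 : measurable_fun setT (fun w => (X2 w, Z2 w)) by exact: measurable_fun_pair.
rewrite (restricted_joint_law mX1 mZ1 _ _ mD1); last 2 first.
- exact: (pre _ _ _ _ mX2Z2).
- move=> A B mA mB; rewrite setIC (restricted_joint_law mX2 mZ2 _ _ mD2).
  + by rewrite -joint_law// i1 // muleC.
  + by apply: measurableI; exact: pre.
  + move=> A' B' mA' mB'; rewrite setIC H// i1//.
by rewrite muleC -joint_law.
Qed.

Lemma indep_cosD (f g : T -> R) : measurable_fun setT f -> measurable_fun setT g -> indep f g ->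
  \int[P]_w cos (f w + g w) = (\int[P]_w cos (f w)) * (\int[P]_w cos (g w)) -
    (\int[P]_w sin (f w)) * (\int[P]_w sin (g w)).
Proof.
move=> mf mg fg.
have mc := @measurable_cosR R. have ms := @measurable_sinR R.
have c1 (x : R) : `|cos x| <= 1 by rewrite cos_max. have s1 (x : R) : `|sin x| <= 1 by rewrite sin_max.
have mD : measurable_fun setT (fun z : R * R => z.1 + z.2).
  exact: measurable_funD measurable_fst measurable_snd.
have := @indep_Rintegral _ _ _ _ _ _ mf mg fg (fun z => cos (z.1 + z.2)) 1 (measurableT_comp mc mD) (fun=> c1 _).
move=> /= ->.
have ic (nu : probability R R) : nu.-integrable setT (EFin \o (@cos R)) by exact: bounded_integrable c1.
have is_ (nu : probability R R) : nu.-integrable setT (EFin \o (@sin R)) by exact: bounded_integrable s1.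
transitivity (\int[pushprob P mf]_x (cos x * (\int[pushprob P mg]_y cos y) -
    sin x * (\int[pushprob P mg]_y sin y))).
  apply: eq_Rintegral => x _.
  transitivity (\int[pushprob P mg]_y (cos x * cos y - sin x * sin y)).
    by apply: eq_Rintegral => y _; rewrite cosD.
  rewrite RintegralB//; last 2 first.
    exact: (integrableZl measurableT (cos x) (ic (pushprob P mg))).
    exact: (integrableZl measurableT (sin x) (is_ (pushprob P mg))).
  rewrite RintegralZl; [rewrite RintegralZl; [by []|exact: measurableT|exact: is_]|exact: measurableT|exact: ic].
rewrite /= RintegralB//; last 2 first.
  exact: (integrableZr measurableT (\int[pushprob P mg]_y cos y) (ic (pushprob P mf))).
  exact: (integrableZr measurableT (\int[pushprob P mg]_y sin y) (is_ (pushprob P mf))).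
rewrite RintegralZr; [rewrite RintegralZr|exact: measurableT|exact: ic]; [|exact: measurableT|exact: is_].
by rewrite !(Rintegral_pushprob P _ _ c1)// !(Rintegral_pushprob P _ _ s1).
Qed.

Lemma indep_sinD (f g : T -> R) : measurable_fun setT f -> measurable_fun setT g -> indep f g ->
  \int[P]_w sin (f w + g w) = (\int[P]_w cos (f w)) * (\int[P]_w sin (g w)) +
    (\int[P]_w sin (f w)) * (\int[P]_w cos (g w)).
Proof.
move=> mf mg fg.
have sE (x : R) : sin x = cos (x + - (pi / 2)) by rewrite -cosBpihalf.
have mg' : measurable_fun setT (fun w => g w + - (pi / 2)) by exact: measurable_funD.
have fg' : indep f (fun w => g w + - (pi / 2)).
  move=> A B mA mB; apply: (fg A ((fun x => x + - (pi / 2)) @^-1` B)) => //.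
  rewrite -[X in measurable X]setTI; apply: (measurable_funD _ _) => //.
under eq_Rintegral => w _ do rewrite sE -addrA.
rewrite (indep_cosD mf mg' fg').
have -> : \int[P]_w sin (g w + - (pi / 2)) = - \int[P]_w cos (g w).
  under eq_Rintegral => w _ do rewrite sinBpihalf -mulN1r.
  rewrite RintegralZl ?mulN1r//.
  apply: (@bounded_integrable _ _ _ _ _ 1) => [|x]; last exact: cos_max.
  exact: (measurableT_comp (@measurable_cosR R)).
under [X in _ * X - _]eq_Rintegral => w _ do rewrite cosBpihalf.
by rewrite mulrN opprK.
Qed.

End Independence.

Lemma expectationE d (T : measurableType d) (R : realType) (P : probability T R) (f : T -> R) :
  expectation P f = (\int[P]_w (f w)%:E)%E.
Proof. by rewrite unlock. Qed.

Lemma Rintegral_ge0_le d (T : measurableType d) (R : realType) (P : probability T R) (f g : T -> R) :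
  measurable_fun setT f -> P.-integrable setT (EFin \o g) -> (forall x, 0 <= f x <= g x) ->
  P.-integrable setT (EFin \o f).
Proof.
move=> mf ig fg; apply: (le_integrable measurableT _ _ ig); first exact/measurable_EFinP.
move=> x _; have /andP[f0 fgx] := fg x.
by rewrite /= lee_fin ger0_norm// ger0_norm// (le_trans f0).
Qed.

(** * Regularity of the centred characteristic function *)

Section CenteredCharacteristic.
Context {R : realType} {d : nat} d0 (T : measurableType d0) (P : probability T R).
Notation V := (d.-tuple R).
Variable Y : T -> V.
Hypothesis mY : measurable_fun setT Y.
Hypothesis Y2 : finite_second_moment P Y.

Definition vmean : V := [tuple \int[P]_w tnth (Y w) i | i < d].
Definition cdev (t : V) (w : T) : R := dotv t (Y w) - dotv t vmean.
Definition cchC (t : V) : R := \int[P]_w cos (cdev t w).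
Definition cchS (t : V) : R := \int[P]_w sin (cdev t w).

Let mYi i : measurable_fun setT (fun w => tnth (Y w) i).
Proof. exact: (measurableT_comp (measurable_tnth i) mY). Qed.

Lemma coord2_integrable i : P.-integrable setT (EFin \o (fun w => tnth (Y w) i ^+ 2)).
Proof.
apply/integrableP; split; first exact/measurable_EFinP/measurable_funX.
have := Y2 i; rewrite expectationE; apply: le_lt_trans.
apply: ge0_le_integral => //.
- by apply: measurableT_comp => //; exact/measurable_EFinP/measurable_funX.
- exact/measurable_EFinP/measurable_funX.
- by move=> w _; rewrite /= lee_fin ger0_norm// sqr_ge0.
Qed.

Lemma coord_integrable i : P.-integrable setT (EFin \o (fun w => tnth (Y w) i)).
Proof.
have i1 := finite_measure_integrable_cst P (1 : R) measurableT.
apply: (le_integrable measurableT _ _ (integrableD measurableT i1 (coord2_integrable i))).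
  exact/measurable_EFinP.
move=> w _; rewrite /= lee_fin; set y := tnth _ _.
have := sqr_ge0 (`|y| - 1); rewrite sqrrB1 real_normK ?num_real// => h.
rewrite [leRHS]ger0_norm; last by have := sqr_ge0 y; lra.
have := sqr_ge0 y; have := normr_ge0 y; lra.
Qed.

Lemma dotv_integrable t : P.-integrable setT (EFin \o (fun w => dotv t (Y w))).
Proof.
rewrite (_ : _ \o _ = fun w => (\sum_(i < d) ((tnth t i)%:E * (tnth (Y w) i)%:E))%E); last first.
  by apply/funext => w; rewrite /= /dotv -sumEFin; apply: eq_bigr.
apply: integrable_sum => // i _.
exact: (integrableZl measurableT (tnth t i) (coord_integrable i)).
Qed.

Lemma Rintegral_dotv t : \int[P]_w dotv t (Y w) = dotv t vmean.
Proof.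
rewrite /Rintegral /dotv.
rewrite [X in fine X](_ : _ = \int[P]_w (\sum_(i < d) ((tnth t i)%:E * (tnth (Y w) i)%:E)))%E; last first.
  by apply: eq_integral => w _; rewrite -sumEFin.
rewrite integral_sum//; last first.
  by move=> i; exact: (integrableZl measurableT (tnth t i) (coord_integrable i)).
rewrite -[RHS]/(fine (_%:E)) -sumEFin; congr fine; apply: eq_bigr => i _.
rewrite integralZl//; last exact: coord_integrable.
by rewrite EFin_Rintegral ?tnth_mktuple//; exact: coord_integrable.
Qed.

Lemma measurable_dotY t : measurable_fun setT (fun w => dotv t (Y w)).
Proof. exact: (measurableT_comp (measurable_dotv t) mY). Qed.

Lemma measurable_cdev t : measurable_fun setT (cdev t).
Proof. by apply: measurable_funB => //; exact: measurable_dotY. Qed.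

Lemma dotv2_integrable t : P.-integrable setT (EFin \o (fun w => dotv t (Y w) ^+ 2)).
Proof.
have ins : P.-integrable setT (EFin \o (fun w => nsq t * nsq (Y w))).
  rewrite (_ : _ \o _ = fun w => ((nsq t)%:E * \sum_(i < d) (tnth (Y w) i ^+ 2)%:E)%E); last first.
    by apply/funext => w; rewrite /= EFinM; congr (_ * _)%E; rewrite /nsq -sumEFin.
  by apply: integrableZl => //; apply: integrable_sum => // i _; exact: coord2_integrable.
apply: Rintegral_ge0_le ins _.
  by apply: measurable_funX; exact: measurable_dotY.
by move=> w; rewrite sqr_ge0 dotv_sqr_le.
Qed.

Lemma cdev2_integrable t : P.-integrable setT (EFin \o (fun w => cdev t w ^+ 2)).
Proof.
have i1 := finite_measure_integrable_cst P (2 * dotv t vmean ^+ 2 : R) measurableT.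
have i2 := integrableZl measurableT (2 : R) (dotv2_integrable t).
apply: Rintegral_ge0_le (integrableD measurableT i2 i1) _.
  by apply: measurable_funX; exact: measurable_cdev.
move=> w; rewrite sqr_ge0 /=; have := sqr_ge0 (dotv t (Y w) + dotv t vmean); rewrite /cdev; lra.
Qed.

Lemma cdev_integrable t : P.-integrable setT (EFin \o cdev t).
Proof.
exact: (integrableB measurableT (dotv_integrable t) (finite_measure_integrable_cst P (dotv t vmean) measurableT)).
Qed.

Lemma Rintegral_cdev t : \int[P]_w cdev t w = 0.
Proof.
rewrite RintegralB//; last 2 first.
- exact: dotv_integrable.
- exact: finite_measure_integrable_cst.
by rewrite Rintegral_dotv Rintegral_prob_cst subrr.
Qed.

Lemma Rintegral_dotv2 t :
  \int[P]_w (dotv t (Y w) ^+ 2) = \int[P]_w (cdev t w ^+ 2) + dotv t vmean ^+ 2.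
Proof.
set a := dotv t vmean.
transitivity (\int[P]_w (cdev t w ^+ 2 + ((2 * a) * cdev t w + a ^+ 2))).
  by apply: eq_Rintegral => w _; rewrite /cdev -/a; ring.
have i1 := integrableZl measurableT (2 * a) (cdev_integrable t).
have i2 := finite_measure_integrable_cst P (a ^+ 2) measurableT.
rewrite RintegralD//; last 2 first.
- exact: cdev2_integrable.
- exact: (integrableD measurableT i1 i2).
rewrite RintegralD// Rintegral_prob_cst RintegralZl//; last exact: cdev_integrable.
by rewrite Rintegral_cdev mulr0 add0r.
Qed.

Variable M : R.
Hypothesis YM : (\sum_(i < d) expectation P (fun w => (tnth (Y w) i ^+ 2)%R) <= M%:E)%E.

Lemma Rintegral_dotv2_le t : \int[P]_w (dotv t (Y w) ^+ 2) <= M * nsq t.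
Proof.
rewrite -lee_fin -EFin_Rintegral; last exact: dotv2_integrable.
apply: (@le_trans _ _ (\int[P]_w ((nsq t)%:E * (nsq (Y w))%:E))%E).
  apply: ge0_le_integral => //.
  - by move=> w _; rewrite lee_fin sqr_ge0.
  - by apply/measurable_EFinP/measurable_funX; exact: measurable_dotY.
  - apply/measurable_EFinP; apply: measurable_funM => //.
    by apply: measurable_sum => i; exact: measurable_funX.
  - by move=> w _; rewrite -EFinM lee_fin dotv_sqr_le.
rewrite ge0_integralZl//; last 3 first.
- apply/measurable_EFinP; by apply: measurable_sum => i; exact: measurable_funX.
- by move=> w _; rewrite lee_fin nsq_ge0.
- by rewrite lee_fin nsq_ge0.
rewrite mulrC EFinM lee_wpmul2l ?lee_fin ?nsq_ge0//.
apply: le_trans YM; rewrite /nsq.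
under eq_integral => w _ do rewrite -sumEFin.
rewrite ge0_integral_sum//.
- by apply: lee_sum => i _; rewrite expectationE.
- by move=> i; apply/measurable_EFinP; exact: measurable_funX.
- by move=> i w _; rewrite lee_fin sqr_ge0.
Qed.

Lemma Rintegral_cdev2_le t : \int[P]_w (cdev t w ^+ 2) <= M * nsq t.
Proof.
by apply: le_trans (Rintegral_dotv2_le t); rewrite Rintegral_dotv2 lerDl sqr_ge0.
Qed.

Lemma second_moment_bound_ge0 : 0 <= M.
Proof.
rewrite -lee_fin; apply: le_trans YM; apply: sume_ge0 => i _.
by rewrite expectationE; apply: integral_ge0 => w _; rewrite lee_fin sqr_ge0.
Qed.

Let ic t : P.-integrable setT (EFin \o (fun w => cos (cdev t w))).
Proof.
apply: (@bounded_integrable _ _ _ _ _ 1) => [|x]; last exact: cos_max.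
exact: (measurableT_comp (@measurable_cosR R) (measurable_cdev t)).
Qed.

Let is_ t : P.-integrable setT (EFin \o (fun w => sin (cdev t w))).
Proof.
apply: (@bounded_integrable _ _ _ _ _ 1) => [|x]; last exact: sin_max.
exact: (measurableT_comp (@measurable_sinR R) (measurable_cdev t)).
Qed.

Let i1 : P.-integrable setT (EFin \o (fun=> 1 : R)).
Proof. exact: (finite_measure_integrable_cst P (1 : R) measurableT). Qed.

Lemma cchC_lower t : 1 - cchC t <= (\int[P]_w (cdev t w ^+ 2)) / 2.
Proof.
rewrite /cchC -[X in X - _](Rintegral_prob_cst P) -RintegralB//.
rewrite -RintegralZr//; last exact: cdev2_integrable.
apply: le_Rintegral => //.
- exact: (integrableB measurableT i1 (ic t)).
- exact: (integrableZr measurableT 2^-1 (cdev2_integrable t)).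
- by move=> w _; exact: oneBcos_le.
Qed.

Lemma cchC_bound t : `|1 - cchC t| <= M * nsq t.
Proof.
have h : 0 <= 1 - cchC t.
  rewrite subr_ge0; apply: le_trans (ler_norm _) _; apply: Rintegral_abs_le => [|w]; last exact: cos_max.
  exact: (measurableT_comp (@measurable_cosR R) (measurable_cdev t)).
rewrite ger0_norm// (le_trans (cchC_lower t))//.
have h1 := Rintegral_cdev2_le t.
have h2 : 0 <= \int[P]_w (cdev t w ^+ 2) by apply: Rintegral_ge0 => // w _; exact: sqr_ge0.
apply: le_trans h1; set z := Rintegral _ _ _ in h2 *; lra.
Qed.

(** Here centring matters: [cdev t] has mean zero, so it can be subtracted from the sine, and
    [sin x - x] is quadratically small. *)
Lemma cchS_bound t : `|cchS t| <= M * nsq t.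
Proof.
rewrite /cchS -[X in `|X|]subr0 -(Rintegral_cdev t) -RintegralB//; last exact: cdev_integrable.
have ii := integrableB measurableT (is_ t) (cdev_integrable t).
apply: le_trans (le_normr_Rintegral _ ii) _ => //.
apply: le_trans (Rintegral_cdev2_le t); apply: le_Rintegral => //.
- exact: (integrable_norm ii).
- exact: cdev2_integrable.
- by move=> w _; exact: sin_sub_le.
Qed.

Lemma cdev_vsub t t' w : cdev t w - cdev t' w = cdev (vsub t t') w.
Proof. by rewrite /cdev ![dotv (vsub _ _) _]dotvC !dotv_vsub ![dotv _ t]dotvC ![dotv _ t']dotvC; ring. Qed.

(** Integrate [|x| <= eta + x^2 / eta]. The second moment of the increment is at most [M * eta^2],
    whence the constant [M + 1]. *)
Let lip (f : R -> R) (t t' : V) (eta : R) :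
  P.-integrable setT (EFin \o (fun w => f (cdev t w))) ->
  P.-integrable setT (EFin \o (fun w => f (cdev t' w))) ->
  (forall x y, `|f x - f y| <= `|x - y|) -> 0 < eta -> nsq (vsub t t') <= eta ^+ 2 ->
  `|\int[P]_w f (cdev t w) - \int[P]_w f (cdev t' w)| <= eta * (M + 1).
Proof.
move=> i i' fl eta0 tt'; rewrite -RintegralB//.
have ii := integrableB measurableT i i'.
apply: le_trans (le_normr_Rintegral _ ii) _ => //.
have ie := finite_measure_integrable_cst P (eta : R) measurableT.
have iz := integrableZr measurableT (eta^-1) (cdev2_integrable (vsub t t')).
apply: (@le_trans _ _ (\int[P]_w (eta + cdev (vsub t t') w ^+ 2 * eta^-1))).
  apply: le_Rintegral => //.
  - exact: (integrable_norm ii).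
  - exact: (integrableD measurableT ie iz).
  - move=> w _; apply: le_trans (fl _ _) _; rewrite cdev_vsub; set x := cdev _ _.
    rewrite -(ler_pM2l eta0) mulrDr mulrCA mulfV ?gt_eqF// mulr1.
    have := sqr_ge0 (2 * `|x| - eta); have := sqr_ge0 eta; rewrite -(real_normK (num_real x)); nra.
rewrite RintegralD// Rintegral_prob_cst RintegralZr//; last exact: cdev2_integrable.
have h : \int[P]_w (cdev (vsub t t') w ^+ 2) <= M * eta ^+ 2.
  by apply: le_trans (Rintegral_cdev2_le _) _; rewrite ler_wpM2l// second_moment_bound_ge0.
rewrite mulrDr mulr1 addrC lerD2r ler_pdivrMr// (le_trans h)// expr2 mulrA mulrC mulrA.
by [].
Qed.

Lemma cchC_lip t t' eta : 0 < eta -> nsq (vsub t t') <= eta ^+ 2 ->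
  `|cchC t - cchC t'| <= eta * (M + 1).
Proof. by move=> eta0 h; apply: lip => //; exact: cos_lip. Qed.

Lemma cchS_lip t t' eta : 0 < eta -> nsq (vsub t t') <= eta ^+ 2 ->
  `|cchS t - cchS t'| <= eta * (M + 1).
Proof. by move=> eta0 h; apply: lip => //; exact: sin_lip. Qed.

Lemma cdevN t w : cdev (vsub (vzero R d) t) w = - cdev t w.
Proof.
rewrite -cdev_vsub; have -> : cdev (vzero R d) w = 0; last by rewrite sub0r.
by rewrite /cdev /dotv !big1 ?subrr// => i _; rewrite tnth_mktuple mul0r.
Qed.

Lemma cchCN t : cchC (vsub (vzero R d) t) = cchC t.
Proof. by apply: eq_Rintegral => w _; rewrite cdevN cosN. Qed.

Lemma cchSN t : cchS (vsub (vzero R d) t) = - cchS t.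
Proof.
rewrite -mulN1r -RintegralZl//; apply: eq_Rintegral => w _.
by rewrite cdevN sinN mulN1r.
Qed.

Definition chYC (t : V) : R := \int[P]_w cos (dotv t (Y w)).
Definition chYS (t : V) : R := \int[P]_w sin (dotv t (Y w)).

Let icY t : P.-integrable setT (EFin \o (fun w => cos (dotv t (Y w)))).
Proof.
apply: (@bounded_integrable _ _ _ _ _ 1) => [|x]; last exact: cos_max.
exact: (measurableT_comp (@measurable_cosR R) (measurable_dotY t)).
Qed.

Let isY t : P.-integrable setT (EFin \o (fun w => sin (dotv t (Y w)))).
Proof.
apply: (@bounded_integrable _ _ _ _ _ 1) => [|x]; last exact: sin_max.
exact: (measurableT_comp (@measurable_sinR R) (measurable_dotY t)).
Qed.

Lemma cchCE t : cchC t = cos (dotv t vmean) * chYC t + sin (dotv t vmean) * chYS t.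
Proof.
rewrite /chYC /chYS -RintegralZl// -RintegralZl// -RintegralD//.
- by apply: eq_Rintegral => w _; rewrite /cdev cosB mulrC [sin _ * _]mulrC.
- exact: (integrableZl measurableT _ (icY t)).
- exact: (integrableZl measurableT _ (isY t)).
Qed.

Lemma cchSE t : cchS t = cos (dotv t vmean) * chYS t - sin (dotv t vmean) * chYC t.
Proof.
rewrite /chYC /chYS -RintegralZl// -RintegralZl// -RintegralB//.
- by apply: eq_Rintegral => w _; rewrite /cdev sinB mulrC [cos _ * sin _]mulrC.
- exact: (integrableZl measurableT _ (isY t)).
- exact: (integrableZl measurableT _ (icY t)).
Qed.

Lemma chreg_centered l : (forall t, chYC t ^+ 2 + chYS t ^+ 2 <= expR (- (l * nsq t))) ->
  chreg M l cchC cchS.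
Proof.
move=> md; split.
- exact: cchC_bound.
- exact: cchS_bound.
- move=> t; apply: le_trans (md t).
  rewrite cchCE cchSE; have := cos2Dsin2 (dotv t vmean).
  set a := cos _; set b := sin _; set x := chYC t; set y := chYS t => ab.
  suff -> : (a * x + b * y) ^+ 2 + (a * y - b * x) ^+ 2 = (a ^+ 2 + b ^+ 2) * (x ^+ 2 + y ^+ 2).
    by rewrite ab mul1r.
  by ring.
- exact: cchC_lip.
- exact: cchS_lip.
- exact: cchCN.
- exact: cchSN.
Qed.

End CenteredCharacteristic.

Section ModulusBound.
Context {R : realType} d0 (T : measurableType d0) (P : probability T R).

(** From the squares of [C - cos] and [S - sin] one gets [C cos + S sin <= (C^2 + S^2 + 1) / 2]
    pointwise; the left side integrates to [C^2 + S^2]. *)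
Lemma cos_sin_integral_le1 (f : T -> R) : measurable_fun setT f ->
  (\int[P]_w cos (f w)) ^+ 2 + (\int[P]_w sin (f w)) ^+ 2 <= 1.
Proof.
move=> mf; set C := \int[P]_w cos _; set S := \int[P]_w sin _.
have ic : P.-integrable setT (EFin \o (fun w => cos (f w))).
  apply: (@bounded_integrable _ _ _ _ _ 1) => [|x]; last exact: cos_max.
  exact: (measurableT_comp (@measurable_cosR R) mf).
have is_ : P.-integrable setT (EFin \o (fun w => sin (f w))).
  apply: (@bounded_integrable _ _ _ _ _ 1) => [|x]; last exact: sin_max.
  exact: (measurableT_comp (@measurable_sinR R) mf).
have i1 := integrableZl measurableT C ic.
have i2 := integrableZl measurableT S is_.
have : \int[P]_w (C * cos (f w) + S * sin (f w)) <= \int[P]_w ((C ^+ 2 + S ^+ 2 + 1) / 2).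
  apply: le_Rintegral => //.
  - exact: (integrableD measurableT i1 i2).
  - exact: finite_measure_integrable_cst.
  - move=> w _; have := cos2Dsin2 (f w); have := sqr_ge0 (C - cos (f w)); have := sqr_ge0 (S - sin (f w)); nra.
rewrite Rintegral_prob_cst RintegralD// !RintegralZl// -/C -/S; lra.
Qed.

End ModulusBound.

Section SumOfIndependent.
Context {R : realType} {d : nat} d0 (T : measurableType d0) (P : probability T R).
Notation V := (d.-tuple R).
Variables (X Z : T -> V).
Hypotheses (mX : measurable_fun setT X) (mZ : measurable_fun setT Z) (XZ : indep P X Z).

Lemma measurable_sumV : measurable_fun setT (fun w => vadd (X w) (Z w)).
Proof. exact: (measurableT_comp (@measurable_vadd R d) (measurable_fun_pair mX mZ)). Qed.

Let XZt (t u : V) : indep P (fun w => dotv t (X w)) (fun w => dotv u (Z w)).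
Proof.
apply: (@indep_comp _ _ _ _ _ _ _ _ _ _ _ _ X Z (dotv t) (dotv u)) => //; exact: measurable_dotv.
Qed.

Lemma chYC_indep t u : \int[P]_w cos (dotv t (X w) + dotv u (Z w)) =
  chYC P X t * chYC P Z u - chYS P X t * chYS P Z u.
Proof. by rewrite (indep_cosD _ _ (XZt t u))//; exact: measurable_dotY. Qed.

Lemma chYS_indep t u : \int[P]_w sin (dotv t (X w) + dotv u (Z w)) =
  chYC P X t * chYS P Z u + chYS P X t * chYC P Z u.
Proof. by rewrite (indep_sinD _ _ (XZt t u))//; exact: measurable_dotY. Qed.

Lemma chYC_add t : chYC P (fun w => vadd (X w) (Z w)) t =
  chYC P X t * chYC P Z t - chYS P X t * chYS P Z t.
Proof. by rewrite -chYC_indep; apply: eq_Rintegral => w _; rewrite dotv_vadd. Qed.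

Lemma chYS_add t : chYS P (fun w => vadd (X w) (Z w)) t =
  chYC P X t * chYS P Z t + chYS P X t * chYC P Z t.
Proof. by rewrite -chYS_indep; apply: eq_Rintegral => w _; rewrite dotv_vadd. Qed.

End SumOfIndependent.

Section SumLaw.
Context {R : realType} {d : nat}.
Notation V := (d.-tuple R).
Implicit Types om : probability V R.

Lemma indep_fst_snd d1 d2 (T1 : measurableType d1) (T2 : measurableType d2)
  (P : probability T1 R) (Q : probability T2 R) : indep (pprod P Q) fst snd.
Proof.
have pE A B : measurable A -> measurable B -> pprod P Q (A `*` B) = (P A * Q B)%E.
  exact: product_measure1E.
move=> A B mA mB.
have -> : fst @^-1` A `&` snd @^-1` B = A `*` B :> set (T1 * T2) by [].
have -> : fst @^-1` A = A `*` setT :> set (T1 * T2) by apply/seteqP; split => [[x y] //|[x y] []].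
have -> : snd @^-1` B = setT `*` B :> set (T1 * T2) by apply/seteqP; split => [[x y] //|[x y] []].
transitivity (P A * Q B)%E; first exact: pE.
symmetry; congr (_ * _)%E.
  by rewrite -[RHS]mule1 -(measure_prob_setT Q); exact: pE.
by rewrite -[RHS]mul1e -(measure_prob_setT P); exact: pE.
Qed.

Lemma chC_pushprob d0 (T : measurableType d0) (P : probability T R) (Y : T -> V)
  (mY : measurable_fun setT Y) t : chC (pushprob P mY) t = chYC P Y t.
Proof.
rewrite /chC (@Rintegral_pushprob _ _ _ _ _ _ _ _ _ 1)//; last by move=> y; exact: cos_max.
exact: measurable_cos_dot.
Qed.

Lemma chS_pushprob d0 (T : measurableType d0) (P : probability T R) (Y : T -> V)
  (mY : measurable_fun setT Y) t : chS (pushprob P mY) t = chYS P Y t.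
Proof.
rewrite /chS (@Rintegral_pushprob _ _ _ _ _ _ _ _ _ 1)//; last by move=> y; exact: sin_max.
exact: measurable_sin_dot.
Qed.

Definition conv om1 om2 : probability V R := pushprob (pprod om1 om2) (measurable_vadd (d := d)).

Let pushfst om1 om2 (h : V -> R) : measurable_fun setT h -> (forall x, `|h x| <= 1) ->
  \int[pprod om1 om2]_z h z.1 = \int[om1]_x h x.
Proof.
move=> mh h1.
rewrite (bounded_Fubini om1 om2 (measurableT_comp mh measurable_fst) (fun z => h1 z.1)).1 /=.
by apply: eq_Rintegral => x _; rewrite Rintegral_prob_cst.
Qed.

Let pushsnd om1 om2 (h : V -> R) : measurable_fun setT h -> (forall x, `|h x| <= 1) ->
  \int[pprod om1 om2]_z h z.2 = \int[om2]_x h x.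
Proof.
move=> mh h1.
rewrite (bounded_Fubini om1 om2 (measurableT_comp mh measurable_snd) (fun z => h1 z.2)).1 /=.
by rewrite Rintegral_prob_cst.
Qed.

Lemma ch_conv om1 om2 (t : V) :
  chC (conv om1 om2) t = chC om1 t * chC om2 t - chS om1 t * chS om2 t /\
  chS (conv om1 om2) t = chC om1 t * chS om2 t + chS om1 t * chC om2 t.
Proof.
have i12 := @indep_fst_snd _ _ V V om1 om2.
have mc := measurable_cos_dot t. have ms := measurable_sin_dot t.
have c1 (x : V) : `|cos (dotv t x)| <= 1 by exact: cos_max.
have s1 (x : V) : `|sin (dotv t x)| <= 1 by exact: sin_max.
rewrite chC_pushprob chS_pushprob.
rewrite (chYC_add measurable_fst measurable_snd i12) (chYS_add measurable_fst measurable_snd i12).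
by rewrite /chYC /chYS !(pushfst _ _ mc c1) !(pushsnd _ _ mc c1) !(pushfst _ _ ms s1) !(pushsnd _ _ ms s1).
Qed.

End SumLaw.

(** * Splitting off isotropic Gaussian noise *)

Section GaussianComponent.
Context {R : realType} {d : nat}.
Notation V := (d.-tuple R).
Variables (Q : 'M[R]_d) (l : R).
Hypotheses (QT : Q^T = Q) (l0 : 0 < l) (lQ : forall x : V, l * nsq x <= quadf Q x).

Lemma gaussian_ch d0 (T : measurableType d0) (P : probability T R) (U : T -> V) m :
  gaussian_vec P U m Q -> forall t, chYC P U t = cos (dotv t m) * expR (- (quadf Q t / 2)) /\
    chYS P U t = sin (dotv t m) * expR (- (quadf Q t / 2)).
Proof. by move=> [_ [_ H]] t; have := H t; rewrite /Ere !expectationE. Qed.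

(* [N(m, Q)] split as [N(m, Q - l I)] plus independent noise [N(0, l I)]. *)
Lemma gaussian_split (m : V) : exists B : 'I_d -> V,
  forall t, chC (affgauss m B) t * expR (- (l * nsq t / 2)) = cos (dotv t m) * expR (- (quadf Q t / 2)) /\
    chS (affgauss m B) t * expR (- (l * nsq t / 2)) = sin (dotv t m) * expR (- (quadf Q t / 2)).
Proof.
have [B HB] := psd_sum_squares (psd_sub_scalar QT lQ).
exists B => t; rewrite chC_affgauss chS_affgauss -HB quadf_sub_scalar -!mulrA -expRD.
by split; congr (_ * expR _); field.
Qed.

Let sq : 0 < Num.sqrt l. Proof. by rewrite sqrtr_gt0. Qed.
Let sq2 : Num.sqrt l ^+ 2 = l. Proof. by rewrite sqr_sqrtr// ltW. Qed.

(** The target Gaussian is produced in the form [gconv], with the same noise as [Y_i], so that the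
    two densities compare through [sdens]. *)
Lemma gaussian_law (m : V) : exists om : probability V R,
  forall t, chC (gconv om (Num.sqrt l)) t = cos (dotv t m) * expR (- (quadf Q t / 2)) /\
    chS (gconv om (Num.sqrt l)) t = sin (dotv t m) * expR (- (quadf Q t / 2)).
Proof.
have [B HB] := gaussian_split m; exists (affgauss m B) => t.
by rewrite chC_gconv// chS_gconv// sq2 ![expR _ * _]mulrC; exact: HB.
Qed.

Context d0 (T : measurableType d0) (P : probability T R).
Variables (X Z : T -> V).
Hypotheses (mX : measurable_fun setT X) (XZ : indep P X Z)
  (gZ : gaussian_vec P Z (vzero R d) Q).

Let mZ : measurable_fun setT Z. Proof. by case: gZ. Qed.

Let dot0 (t : V) : dotv t (vzero R d) = 0.
Proof. by rewrite /dotv big1// => i _; rewrite tnth_mktuple mulr0. Qed.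

Lemma chY_gaussian_add t :
  chYC P (fun w => vadd (X w) (Z w)) t = chYC P X t * expR (- (quadf Q t / 2)) /\
  chYS P (fun w => vadd (X w) (Z w)) t = chYS P X t * expR (- (quadf Q t / 2)).
Proof.
rewrite chYC_add// chYS_add//; have [-> ->] := gaussian_ch gZ t.
by rewrite dot0 cos0 sin0 !mul1r !mul0r !mulr0 subr0 add0r.
Qed.

Lemma chY_modulus t : chYC P (fun w => vadd (X w) (Z w)) t ^+ 2 +
  chYS P (fun w => vadd (X w) (Z w)) t ^+ 2 <= expR (- (l * nsq t)).
Proof.
have [-> ->] := chY_gaussian_add t; rewrite !exprMn -mulrDl -expRM_natl.
have h := cos_sin_integral_le1 P (measurable_dotY mX t).
apply: (@le_trans _ _ (1 * expR (2 * - (quadf Q t / 2)))).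
  by rewrite ler_wpM2r ?expR_ge0.
by rewrite mul1r ler_expR mulrN mulrCA mulfV// mulr1 lerN2.
Qed.

(** The splitting of the noise is one of laws, not of the variable [Z] on its space; equality of
    characteristic functions transfers it to the law of the sum. *)
Lemma smooth_law : exists om : probability V R, forall A, measurable A ->
  P ((fun w => vadd (X w) (Z w)) @^-1` A) = gconv om (Num.sqrt l) A.
Proof.
have [B HB] := gaussian_split (vzero R d).
pose om := conv (pushprob P mX) (affgauss (vzero R d) B).
exists om => A mA; have mY := measurable_sumV mX mZ.
change (pushprob P mY A = gconv om (Num.sqrt l) A).
apply: characteristic_unique mA => t.
  rewrite chC_pushprob chC_gconv// sq2 (ch_conv _ _ t).1 chC_pushprob chS_pushprob.
  have [-> _] := chY_gaussian_add t; have [h1 h2] := HB t.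
  rewrite dot0 cos0 sin0 mul0r mul1r in h1 h2.
  by rewrite mulrBr -h1 mulrC mulrCA; ring: h2.
rewrite chS_pushprob chS_gconv// sq2 (ch_conv _ _ t).2 chC_pushprob chS_pushprob.
have [_ ->] := chY_gaussian_add t; have [h1 h2] := HB t.
rewrite dot0 cos0 sin0 mul0r mul1r in h1 h2.
by rewrite -h1; ring: h2.
Qed.

End GaussianComponent.

Section CenteredEquation.
Context {R : realType} {d : nat} d0 (T : measurableType d0) (P : probability T R).
Notation V := (d.-tuple R).
Variables (Y1 Y2 : T -> V).
Hypotheses (mY1 : measurable_fun setT Y1) (mY2 : measurable_fun setT Y2) (Y12 : indep P Y1 Y2).

(** The frequencies [u] and [v] on the sum and the difference are [u + v] on [Y1] and [u - v] on
    [Y2]. Centring multiplies all terms of the equation by the same phase, of angle [- th], so the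
    modulus of the error is unchanged. *)
Lemma eps_dependent_chfe (eps : R) :
  eps_dependent P (fun w => vadd (Y1 w) (Y2 w)) (fun w => vsub (Y1 w) (Y2 w)) eps ->
  chfe eps (cchC P Y1) (cchS P Y1) (cchC P Y2) (cchS P Y2).
Proof.
move=> ed u v; have := ed u v; rewrite /= /Ere !expectationE.
have int_dot (f : R -> R) (g h : T -> R) : g =1 h -> \int[P]_w f (g w) = \int[P]_w f (h w).
  by move=> gh; apply: eq_Rintegral => w _; rewrite gh.
rewrite -!/(Rintegral _ _ _).
have e1 w : dotv u (vadd (Y1 w) (Y2 w)) + dotv v (vsub (Y1 w) (Y2 w)) =
    dotv (vadd u v) (Y1 w) + dotv (vsub u v) (Y2 w).
  by rewrite dotv_vadd dotv_vsub ![dotv (vadd _ _) _]dotvC ![dotv (vsub _ _) _]dotvC dotv_vadd dotv_vsub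
    ![dotv _ u]dotvC ![dotv _ v]dotvC; ring.
have e2 w : dotv u (vadd (Y1 w) (Y2 w)) = dotv u (Y1 w) + dotv u (Y2 w) by exact: dotv_vadd.
have dN w : dotv (vsub (vzero R d) v) (Y2 w) = - dotv v (Y2 w).
  rewrite dotvC dotv_vsub ![dotv (Y2 w) _]dotvC -[RHS]sub0r; congr (_ - _).
  by rewrite /dotv big1// => i _; rewrite tnth_mktuple mul0r.
have e3 w : dotv v (vsub (Y1 w) (Y2 w)) = dotv v (Y1 w) + dotv (vsub (vzero R d) v) (Y2 w).
  by rewrite dotv_vsub dN.
have cN : chYC P Y2 (vsub (vzero R d) v) = chYC P Y2 v.
  by apply: eq_Rintegral => w _; rewrite dN cosN.
have sN : chYS P Y2 (vsub (vzero R d) v) = - chYS P Y2 v.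
  rewrite -mulN1r -RintegralZl//.
    by apply: eq_Rintegral => w _; rewrite dN sinN mulN1r.
  apply: (@bounded_integrable _ _ _ _ _ 1) => [|x]; last exact: sin_max.
  exact: (measurableT_comp (@measurable_sinR R) (measurable_dotY mY2 v)).
rewrite !(int_dot _ _ _ e1) !(int_dot _ _ _ e2) !(int_dot _ _ _ e3).
rewrite !(chYC_indep mY1 mY2 Y12) !(chYS_indep mY1 mY2 Y12) cN sN.
set re := _ - _; set im := _ - _.
move=> h.
have hs : re ^+ 2 + im ^+ 2 <= eps ^+ 2.
  have e0 : 0 <= eps by apply: le_trans h; exact: sqrtr_ge0.
  rewrite -ler_sqrt ?sqr_ge0// sqrtr_sqr ger0_norm//.
pose m1 := vmean P Y1; pose m2 := vmean P Y2.
pose th := (dotv u m1 + dotv v m1) + (dotv u m2 - dotv v m2).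
have bnd (a b : R) : a ^+ 2 + b ^+ 2 = 1 -> `|a * re + b * im| <= eps.
  move=> ab; have e0 : 0 <= eps by apply: le_trans h; exact: sqrtr_ge0.
  rewrite -(@ler_pXn2r _ 2) ?nnegrE// real_normK ?num_real// (le_trans _ hs)//.
  have -> : re ^+ 2 + im ^+ 2 = (a * re + b * im) ^+ 2 + (a * im - b * re) ^+ 2.
    by rewrite -[LHS]mul1r -ab; ring.
  by rewrite lerDl sqr_ge0.
have vl (t t' x : V) : dotv (vadd t t') x = dotv t x + dotv t' x.
  by rewrite dotvC dotv_vadd ![dotv x _]dotvC.
have vl' (t t' x : V) : dotv (vsub t t') x = dotv t x - dotv t' x.
  by rewrite dotvC dotv_vsub ![dotv x _]dotvC.
have E1 : chfe_re (cchC P Y1) (cchS P Y1) (cchC P Y2) (cchS P Y2) u v = cos th * re + sin th * im.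
  rewrite /chfe_re !cchCE// !cchSE// !vl !vl' /th /re /im -/m1 -/m2.
  rewrite !(cosD, sinD, cosN, sinN).
  by ring.
have E2 : chfe_im (cchC P Y1) (cchS P Y1) (cchC P Y2) (cchS P Y2) u v = cos th * im - sin th * re.
  rewrite /chfe_im !cchCE// !cchSE// !vl !vl' /th /re /im -/m1 -/m2.
  rewrite !(cosD, sinD, cosN, sinN).
  by ring.
split; first by rewrite E1; apply: bnd; exact: cos2Dsin2.
by rewrite E2 addrC -mulNr; apply: bnd; rewrite sqrrN addrC cos2Dsin2.
Qed.

End CenteredEquation.

(** * Continuity of the entropy *)

Section EntropyFunction.
Context {R : realType}.
Implicit Types x y : R.

Lemma ln_le_sub1 x : 0 < x -> ln x <= x - 1.
Proof.
move=> x0; have := expR_ge1Dx (ln x); rewrite lnK ?posrE// => h; lra.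
Qed.

(** The inequality [ln y <= y - 1] at [y = 1 / sqrt x]. *)
Lemma xlnx_ge x : 0 <= x -> - (2 * Num.sqrt x) <= x * ln x.
Proof.
rewrite le_eqVlt => /predU1P[<-|x0]; first by rewrite sqrtr0 mulr0 oppr0 mul0r.
set r := Num.sqrt x; have r0 : 0 < r by rewrite sqrtr_gt0.
have xE : x = r ^+ 2 by rewrite sqr_sqrtr// ltW.
have := @ln_le_sub1 r^-1; rewrite invr_gt0 => /(_ r0); rewrite lnV ?posrE// => h.
rewrite xE lnXn// -mulr_natl.
have h2 : r ^+ 2 * (- ln r) <= r ^+ 2 * (r^-1 - 1) by rewrite ler_wpM2l ?sqr_ge0.
have h3 : r ^+ 2 * r^-1 = r by rewrite expr2 mulfK// gt_eqF.
have := sqr_ge0 r; nra.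
Qed.

(** For [y <= x] and [t = x - y] the difference is [t ln x + y (ln x - ln y)]. The second term lies
    in [[0, t]]; the first is at most [C t] and at least [t ln t], hence the square root. *)
Lemma xlnx_modulus (C h x y : R) : 0 <= C -> 0 <= x -> 0 <= y -> ln x <= C -> ln y <= C ->
  `|x - y| <= h -> `|x * ln x - y * ln y| <= (1 + C) * h + 2 * Num.sqrt h.
Proof.
move=> C0; wlog yx : x y / y <= x.
  move=> H x0 y0 lx ly xy; have [/H|/ltW/H] := leP y x; first exact.
  by rewrite distrC [in X in _ -> X]distrC; apply => //; rewrite distrC.
move=> x0 y0 lx ly; rewrite ger0_norm ?subr_ge0// => xyh.
set t := x - y in xyh *; have t0 : 0 <= t by rewrite subr_ge0.
have h0 : 0 <= h by exact: le_trans xyh.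
have sth : Num.sqrt t <= Num.sqrt h by rewrite ler_wsqrtr.
have ylt : 0 <= y * (ln x - ln y) <= t.
  move: y0; rewrite le_eqVlt => /predU1P[<-|y0]; first by rewrite mul0r lexx.
  have xp : 0 < x by exact: lt_le_trans yx.
  rewrite -ln_div ?posrE// mulr_ge0 ?(ltW y0)//=; last first.
    by rewrite ln_ge0// ler_pdivlMr// mul1r.
  have := @ln_le_sub1 (x / y) (divr_gt0 xp y0).
  rewrite -(ler_pM2l y0) mulrBr mulr1 mulrCA mulfV ?gt_eqF// mulr1.
  by [].
have tlx : - (2 * Num.sqrt h) <= t * ln x <= C * h.
  apply/andP; split.
    apply: (@le_trans _ _ (t * ln t)).
      by apply: le_trans (xlnx_ge t0); rewrite lerN2 ler_wpM2l.
    move: (t0); rewrite le_eqVlt => /predU1P[<-|tp]; first by rewrite !mul0r.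
    by rewrite ler_wpM2l// ler_ln ?posrE// ?(lt_le_trans tp)// gerBl.
  apply: (@le_trans _ _ (t * C)); first by rewrite ler_wpM2l.
  by rewrite mulrC ler_wpM2l.
have -> : x * ln x - y * ln y = t * ln x + y * (ln x - ln y) by rewrite /t; ring.
have sh : 0 <= Num.sqrt h by exact: sqrtr_ge0.
have Ch : 0 <= C * h by exact: mulr_ge0.
rewrite ler_norml; apply/andP; split; lra.
Qed.

(** A density value above [exp (- S)] pays its logarithm by the factor [S], later a moment; a value
    below is controlled by [exp (- S / 2)] alone, whatever the density. *)
Lemma xlnx_tail (C S x : R) : 0 <= C -> 0 <= S -> 0 <= x -> ln x <= C ->
  `|x * ln x| <= x * (C + S) + 2 * expR (- (S / 2)).
Proof.
move=> C0 S0 x0 lx; have e0 := expR_ge0 (- (S / 2)).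
have [l0|l0] := leP 0 (ln x).
  rewrite ger0_norm ?mulr_ge0//.
  have : x * ln x <= x * (C + S) by rewrite ler_wpM2l//; lra.
  by move: e0; lra.
rewrite normrM ger0_norm// ltr0_norm//.
have xC : 0 <= x * C by exact: mulr_ge0.
have xS : 0 <= x * S by exact: mulr_ge0.
have [lS|lS] := leP (- ln x) S.
  have : x * - ln x <= x * S by rewrite ler_wpM2l.
  by rewrite mulrDr; move: e0; lra.
have h := xlnx_ge x0.
suff : Num.sqrt x <= expR (- (S / 2)) by rewrite mulrDr; lra.
move: x0; rewrite le_eqVlt => /predU1P[<-|xp]; first by rewrite sqrtr0.
have -> : expR (- (S / 2)) = Num.sqrt (expR (- S)).
  rewrite (_ : - S = - (S / 2) + - (S / 2)); last by field.
  by rewrite expRD -expr2 sqrtr_sqr ger0_norm.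
by rewrite ler_wsqrtr// -[leLHS]lnK ?posrE// ler_expR; lra.
Qed.

(** To be used with [S = norm1 y], [N = nsq y], [D = d]. For [S <= rho] the modulus of continuity
    applies, and [exp ((rho - S) / 4) >= 1]; for [S > rho >= 1] the tail bound applies, with
    [C + S <= (C + 1) S^2 / rho]. One integrable weight [exp (- S / 4)] covers both regions. *)
Lemma xlnx_pointwise (C h rho S N D x y : R) : 0 <= C -> 0 <= S -> 1 <= rho -> 0 <= x -> 0 <= y ->
  S ^+ 2 <= D * N ->
  ln x <= C -> ln y <= C -> `|x - y| <= h ->
  `|x * ln x - y * ln y| <=
  expR (- (S / 4)) * (((1 + C) * h + 2 * Num.sqrt h) * expR (rho / 4) + 4 * expR (- (rho / 4))) +
  (x + y) * ((C + 1) * (D * N) / rho).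
Proof.
move=> C0 S0 r1 x0 y0 SN lx ly xyh.
have r0 : 0 < rho by exact: lt_le_trans r1.
have w0 : 0 <= (1 + C) * h + 2 * Num.sqrt h.
  have h0 : 0 <= h by exact: le_trans xyh.
  by rewrite addr_ge0// mulr_ge0// ?sqrtr_ge0// addr_ge0.
have DN : 0 <= D * N by apply: le_trans SN; exact: sqr_ge0.
have T0 : 0 <= (x + y) * ((C + 1) * (D * N) / rho).
  by rewrite mulr_ge0 ?addr_ge0// divr_ge0 ?(ltW r0)// mulr_ge0// addr_ge0.
have e1 := expR_ge0 (- (S / 4)). have e2 := expR_ge0 (- (rho / 4)).
have e12 : 0 <= expR (- (S / 4)) * (4 * expR (- (rho / 4))) by rewrite !mulr_ge0.
have [Sr|Sr] := leP S rho.
  apply: le_trans (xlnx_modulus C0 x0 y0 lx ly xyh) _; set w := _ + _ in w0 *.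
  have : w <= expR (- (S / 4)) * (w * expR (rho / 4)).
    rewrite mulrCA -expRD ler_peMr//.
    by have := expR_ge1Dx (- (S / 4) + rho / 4); lra.
  by rewrite mulrDr; lra.
have h1 := xlnx_tail C0 S0 x0 lx; have h2 := xlnx_tail C0 S0 y0 ly.
apply: le_trans (ler_normB _ _) _.
have e3 : expR (- (S / 2)) <= expR (- (S / 4)) * expR (- (rho / 4)).
  by rewrite -expRD ler_expR; lra.
have CS : C + S <= (C + 1) * (D * N) / rho.
  rewrite ler_pdivlMr//; apply: (@le_trans _ _ ((C + 1) * S ^+ 2)); last by rewrite ler_wpM2l// addr_ge0.
  apply: (@le_trans _ _ ((C + S) * S)); first by rewrite ler_wpM2l ?addr_ge0// ltW.
  rewrite expr2 mulrA ler_wpM2r//; have : 1 <= S by exact: le_trans (ltW Sr).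
  nra.
have CSx : x * (C + S) <= x * ((C + 1) * (D * N) / rho) by rewrite ler_wpM2l.
have CSy : y * (C + S) <= y * ((C + 1) * (D * N) / rho) by rewrite ler_wpM2l.
have W : 0 <= expR (- (S / 4)) * (((1 + C) * h + 2 * Num.sqrt h) * expR (rho / 4)).
  by rewrite mulr_ge0// mulr_ge0// expR_ge0.
rewrite mulrDr mulrDl; lra.
Qed.

End EntropyFunction.

Lemma measurable_param_Rintegral (R : realType) d1 d2 (T1 : measurableType d1) (T2 : measurableType d2)
    (Q : probability T2 R) (f : T1 * T2 -> R) (M : R) : measurable_fun setT f ->
  (forall z, `|f z| <= M) -> measurable_fun setT (fun x => \int[Q]_y f (x, y)).
Proof.
move=> mf fM.
have mx x : measurable_fun setT (fun y => f (x, y)).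
  exact: (measurableT_comp mf (pair1_measurable x)).
(* Shifted by [M], the integrand is nonnegative and measurability of its partial integral is
   Tonelli's. *)
have g0 z : 0 <= f z + M by have := fM z; rewrite ler_norml => /andP[]; lra.
have mg : measurable_fun setT (fun z => (f z + M)%:E).
  by apply/measurable_EFinP; exact: measurable_funD.
have mF := @measurable_fun_fubini_tonelli_F _ _ T1 T2 R Q (fun z => (f z + M)%:E) mg (fun z => g0 z).
rewrite (_ : (fun x => _) = (fun x => fine (fubini_F Q (fun z => (f z + M)%:E) x) - M)).
  by apply: measurable_funB => //; exact: measurableT_comp.
apply/funext => x; rewrite /fubini_F -[fine _]/(\int[Q]_y (f (x, y) + M)).
rewrite RintegralD//; last 2 first.
- exact: (@bounded_integrable _ _ _ _ _ M).
- exact: finite_measure_integrable_cst.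
by rewrite Rintegral_prob_cst addrK.
Qed.

Section ExponentialWeight.
Context {R : realType}.

Let w1 (x : R) : R := expR (- (`|x| / 4)).

Let cw1 : continuous w1.
Proof.
move=> x; apply: continuous_comp; last exact: continuous_expR.
by apply: continuousN; apply: continuousM; [exact: norm_continuous|exact: cst_continuous].
Qed.

(** The weight on a half-line is 4 times the exponential density of rate 1/4; the two half-lines
    give 8. *)
Let w1_int : (\int[lebR]_x (w1 x)%:E <= 8%:E)%E.
Proof.
have mw : measurable_fun setT w1 by exact: continuous_measurable_fun.
rewrite integral_lebR//; [|exact/measurable_EFinP|by move=> x; rewrite lee_fin expR_ge0].
rewrite ge0_symfun_integralT//; last 2 first.
- by move=> x; exact: expR_ge0.
- by move=> x; rewrite /w1 /= normrN.
have r4 : 0 < (4^-1 : R) by [].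
apply: (@le_trans _ _ (2%:E * \int[lebesgue_measure]_x (4%:E * (exponential_pdf 4^-1 x)%:E))%E).
  apply: lee_wpmul2l => //; set J := (X in (_ <= X)%E).
  apply: (@le_trans _ _ (\int[lebesgue_measure]_(x in [set x : R | (0 <= x)%R]) (4%:E * (exponential_pdf 4^-1 x)%:E))%E).
    rewrite le_eqVlt; apply/orP; left; apply/eqP.
    apply: eq_integral => x; rewrite inE /= => x0.
    rewrite exponential_pdfE// -EFinM mulrA mulfV// mul1r /w1 ger0_norm//.
    by congr (expR _)%:E; rewrite mulNr mulrC.
  apply: ge0_subset_integral => //.
  - by rewrite -set_itvcy.
  - by apply/measurable_EFinP; apply: measurable_funM => //; exact: measurable_exponential_pdf.
  - by move=> x _; rewrite -EFinM lee_fin mulr_ge0// exponential_pdf_ge0// ltW.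
rewrite ge0_integralZl//; last 2 first.
- by apply/measurable_EFinP; exact: measurable_exponential_pdf.
- by move=> x _; rewrite lee_fin exponential_pdf_ge0// ltW.
by rewrite integral_exponential_pdf// mule1 -EFinM lee_fin; lra.
Qed.

Lemma measurable_norm1 d : measurable_fun [set: d.-tuple R] (@norm1 R d).
Proof. by apply: measurable_sum => i; apply: measurableT_comp => //; exact: measurable_tnth. Qed.

Lemma measurable_expnorm1 d :
  measurable_fun [set: d.-tuple R] (fun x => expR (- (norm1 x / 4))).
Proof.
apply: measurableT_comp => //; apply: measurableT_comp => //.
by apply: measurable_funM => //; exact: measurable_norm1.
Qed.

Lemma integral_expnorm1 d :
  (\int[lebV d]_x (expR (- (norm1 x / 4)))%:E <= (8 ^+ d)%:E :> \bar R)%E.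
Proof.
rewrite /lebV; elim: d => [|d IHd].
  have m0 : measurable_fun [set: 0.-tuple R] (fun x : 0.-tuple R => (expR (- (norm1 x / 4)))%:E).
    by apply/measurable_EFinP; exact: measurable_expnorm1.
  rewrite (integral_mpow0 _ m0).
  by rewrite /norm1 big_ord0 mul0r oppr0 expR0 expr0.
apply: (@le_trans _ _ (\int[lebR]_x ((8 ^+ d)%:E * (w1 x)%:E))%E); last first.
  rewrite ge0_integralZl//; last 2 first.
  - by apply/measurable_EFinP; exact: continuous_measurable_fun.
  - by move=> x _; rewrite lee_fin expR_ge0.
  by rewrite exprSr EFinM; apply: lee_wpmul2l => //; rewrite lee_fin exprn_ge0.
have mS : measurable_fun [set: d.+1.-tuple R] (fun x : d.+1.-tuple R => (expR (- (norm1 x / 4)))%:E).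
  by apply/measurable_EFinP; exact: measurable_expnorm1.
rewrite (integral_mpowS _ mS); last by move=> x; rewrite lee_fin expR_ge0.
have E (x : R) : (\int[mpow (lebR : {sigma_finite_measure set R -> \bar R}) d]_y (expR (- (norm1 (tcons (x, y)) / 4)))%:E =
   (w1 x)%:E * \int[mpow (lebR : {sigma_finite_measure set R -> \bar R}) d]_y (expR (- (norm1 y / 4)))%:E)%E.
  have me : measurable_fun [set: d.-tuple R] (fun y : d.-tuple R => (expR (- (norm1 y / 4)))%:E).
    by apply/measurable_EFinP; exact: measurable_expnorm1.
  transitivity (\int[mpow (lebR : {sigma_finite_measure set R -> \bar R}) d]_y ((w1 x)%:E * (expR (- (norm1 y / 4)))%:E))%E; last first.
    by apply: ge0_integralZl => // *; rewrite lee_fin expR_ge0.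
  apply: eq_integral => y _; rewrite -EFinM /w1 -expRD /norm1 big_ord_recl /tcons tnth0.
  congr (expR _)%:E; rewrite -opprD -mulrDl; congr (- (_ / _)); congr (_ + _).
  by apply: eq_bigr => i _; rewrite tnthS.
under eq_integral => x _ do rewrite E.
apply: ge0_le_integral => //.
- by move=> x _; rewrite mule_ge0 ?lee_fin ?expR_ge0//; apply: integral_ge0 => y _; rewrite lee_fin expR_ge0.
- apply: emeasurable_funM => //; by apply/measurable_EFinP; exact: continuous_measurable_fun.
- apply: emeasurable_funM => //; by apply/measurable_EFinP; exact: continuous_measurable_fun.
- by move=> x _; rewrite muleC lee_wpmul2r// lee_fin expR_ge0.
Qed.

End ExponentialWeight.

Section DensityComparison.
Context {R : realType} {d : nat}.
Notation V := (d.-tuple R).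
Implicit Types om : probability V R.
Variable s : R.
Hypothesis s0 : 0 < s.

Lemma norm1_sqr_le (x : V) : norm1 x ^+ 2 <= d%:R * nsq x.
Proof.
have -> : norm1 x = dotv [tuple (1 : R) | i < d] [tuple `|tnth x i| | i < d].
  by apply: eq_bigr => i _; rewrite !tnth_mktuple mul1r.
apply: le_trans (dotv_sqr_le _ _) _.
rewrite le_eqVlt; apply/orP; left; apply/eqP; congr (_ * _).
  rewrite /nsq (eq_bigr (fun=> 1)); last by move=> i _; rewrite tnth_mktuple expr1n.
  by rewrite sumr_const card_ord.
by apply: eq_bigr => i _; rewrite tnth_mktuple real_normK ?num_real.
Qed.

Lemma nsq_le_norm1_sqr (x : V) : nsq x <= norm1 x ^+ 2.
Proof.
rewrite expr2 {1}/norm1 mulr_suml; apply: ler_sum => i _.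
rewrite -real_normK ?num_real// expr2 ler_wpM2l// /norm1 (bigD1 i)//= lerDl.
by apply: sumr_ge0.
Qed.

Lemma chC_chS_le1 om t : `|chC om t| <= 1 /\ `|chS om t| <= 1.
Proof.
split; apply: Rintegral_abs_le => [|x]; [exact: measurable_cos_dot|exact: cos_max
 |exact: measurable_sin_dot|exact: sin_max].
Qed.

(** In the Fourier formula the integrands differ by at most [2 * delta] inside the ball. Outside
    they differ by at most 4, hence by [4 * norm1 x / lam], and the Gaussian weight has mean [norm1]
    at most [d / s]. *)
Lemma sdens_close om1 om2 (delta lam : R) : 0 <= delta -> 0 < lam ->
  (forall t, nsq t <= lam ^+ 2 -> `|chC om1 t - chC om2 t| <= delta /\ `|chS om1 t - chS om2 t| <= delta) ->
  forall y, `|sdens om1 s y - sdens om2 s y| <=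
    normal_peak s ^+ d * (2 * delta + 4 / lam * (d%:R / s)).
Proof.
move=> delta0 lam0 close y.
have si : 0 < s^-1 by rewrite invr_gt0.
have p0 : 0 <= normal_peak s ^+ d by rewrite exprn_ge0// normal_peak_ge0.
rewrite !sdensE// -mulrBr normrM ger0_norm// ler_wpM2l//.
have mdot : measurable_fun setT (fun z : V * V => dotv z.1 z.2).
  by apply: measurable_sum => i; apply: measurable_funM;
    [exact: (measurableT_comp (measurable_tnth i) measurable_fst)
    |exact: (measurableT_comp (measurable_tnth i) measurable_snd)].
have mC om : measurable_fun setT (chC om).
  apply: (measurable_param_Rintegral om (f := fun z => cos (dotv z.1 z.2)) (M := 1)) => [|z]; last exact: cos_max.
  exact: (measurableT_comp (@measurable_cosR R) mdot).
have mS om : measurable_fun setT (chS om).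
  apply: (measurable_param_Rintegral om (f := fun z => sin (dotv z.1 z.2)) (M := 1)) => [|z]; last exact: sin_max.
  exact: (measurableT_comp (@measurable_sinR R) mdot).
pose H om (x : V) := cos (dotv y x) * chC om x + sin (dotv y x) * chS om x.
have mH om : measurable_fun setT (H om).
  by apply: measurable_funD; apply: measurable_funM => //; [exact: measurable_cos_dot|exact: measurable_sin_dot].
have cs1 (x : V) : `|cos (dotv y x)| <= 1 /\ `|sin (dotv y x)| <= 1 by split; [exact: cos_max|exact: sin_max].
have H2 om x : `|H om x| <= 2.
  have [c1 k1] := cs1 x; have [c2 k2] := chC_chS_le1 om x.
  apply: le_trans (ler_normD _ _) _; rewrite !normrM.
  have : `|cos (dotv y x)| * `|chC om x| <= 1 * 1 by rewrite ler_pM.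
  have : `|sin (dotv y x)| * `|chS om x| <= 1 * 1 by rewrite ler_pM.
  lra.
have iH om := bounded_integrable (gaussV s^-1 d : probability V R) (mH om) (H2 om).
rewrite -[X in `|X|]RintegralB//; [|exact: (iH om1)|exact: (iH om2)].
have iB := integrableB measurableT (iH om1) (iH om2).
apply: le_trans (le_normr_Rintegral _ iB) _ => //.
rewrite -lee_fin -EFin_Rintegral; last exact: (integrable_norm iB).
apply: (@le_trans _ _ (\int[gaussV s^-1 d]_x ((2 * delta)%:E + (4 / lam)%:E * (norm1 x)%:E))%E).
  apply: ge0_le_integral => //.
  - by apply/measurable_EFinP; apply: measurableT_comp => //; apply: measurable_funB.
  - apply: emeasurable_funD => //; apply: emeasurable_funM => //; apply/measurable_EFinP; exact: measurable_norm1.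
  - move=> x _; rewrite -EFinM -EFinD lee_fin.
    have n0 : 0 <= norm1 x by apply: sumr_ge0.
    have [xL|xL] := leP (nsq x) (lam ^+ 2).
      have [cl1 cl2] := close x xL; have [k1 k2] := cs1 x.
      have -> : H om1 x - H om2 x = cos (dotv y x) * (chC om1 x - chC om2 x) + sin (dotv y x) * (chS om1 x - chS om2 x).
        by rewrite /H; ring.
      apply: le_trans (ler_normD _ _) _; rewrite !normrM.
      have : `|cos (dotv y x)| * `|chC om1 x - chC om2 x| <= 1 * delta by rewrite ler_pM.
      have : `|sin (dotv y x)| * `|chS om1 x - chS om2 x| <= 1 * delta by rewrite ler_pM.
      have : 0 <= 4 / lam * norm1 x by rewrite mulr_ge0// divr_ge0// ltW.
      lra.
    have ll : lam <= norm1 x.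
      rewrite -(@ler_pXn2r _ 2) ?nnegrE ?(ltW lam0)//; apply: le_trans (nsq_le_norm1_sqr x); exact: ltW.
    have : 4 <= 4 / lam * norm1 x by rewrite -mulrA mulrC -ler_pdivrMr// divff// mulrC ler_pdivlMr// mul1r.
    have := H2 om1 x; have := H2 om2 x; have := ler_normB (H om1 x) (H om2 x); lra.
rewrite ge0_integralD//; last 3 first.
- by move=> x _; rewrite lee_fin mulr_ge0.
- by move=> x _; rewrite mule_ge0 ?lee_fin ?divr_ge0 ?(ltW lam0)//; apply: sumr_ge0.
- apply: emeasurable_funM => //; apply/measurable_EFinP; exact: measurable_norm1.
rewrite integral_cst// measure_prob_setT mule1 ge0_integralZl//; last 3 first.
- apply/measurable_EFinP; exact: measurable_norm1.
- by move=> x _; rewrite lee_fin; apply: sumr_ge0.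
- by rewrite lee_fin divr_ge0// ltW.
rewrite EFinD; apply: leeD2l; rewrite [X in (_ <= X)%E]EFinM; apply: lee_wpmul2l.
  by rewrite lee_fin divr_ge0// ltW.
exact: gaussV_norm1.
Qed.

End DensityComparison.

Section EntropyContinuity.
Context {R : realType} {d : nat}.
Notation V := (d.-tuple R).
Implicit Types om : probability V R.
Variable s : R.
Hypothesis s0 : 0 < s.

Let c := normal_peak s ^+ d.
(** An upper bound for the logarithm of every smoothed density, made nonnegative for the pointwise
    estimates. *)
Let C := Num.max 0 (ln c).
Let C0 : 0 <= C. Proof. by rewrite le_max lexx. Qed.
Let c0 : 0 <= c. Proof. by rewrite exprn_ge0// normal_peak_ge0. Qed.

Definition seta om (y : V) : R := sdens om s y * ln (sdens om s y).

Let ln_sdens om y : ln (sdens om s y) <= C.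
Proof.
have [f0|f0] := leP (sdens om s y) 0; first by rewrite ln0.
rewrite le_max; apply/orP; right; rewrite ler_ln ?posrE//; first exact: sdens_le.
by apply: lt_le_trans f0 _; exact: sdens_le.
Qed.

Let mf om : measurable_fun setT (sdens om s). Proof. exact: measurable_sdens. Qed.
Let f0 om y : 0 <= sdens om s y. Proof. exact: sdens_ge0. Qed.

Lemma measurable_seta om : measurable_fun setT (seta om).
Proof. by apply: measurable_funM => //; apply: measurableT_comp => //; exact: measurable_ln. Qed.

Let weight om (q : V -> R) : measurable_fun setT q -> (forall y, 0 <= q y) ->
  (\int[lebV d]_y (sdens om s y * q y)%:E = \int[gconv om s]_y (q y)%:E)%E.
Proof.
move=> mq q0; rewrite (integral_gconv om s0) => [|//|y]; [|exact/measurable_EFinP|by rewrite lee_fin].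
by apply: eq_integral => y _; rewrite mulrC EFinM.
Qed.

Let mnsq : measurable_fun [set: V] (@nsq R d).
Proof. by apply: measurable_sum => i; apply: measurable_funX; exact: measurable_tnth. Qed.

Variable A : R.
Hypothesis A0 : 0 <= A.
Let second_moment om := (\int[gconv om s]_y (nsq y)%:E <= A%:E)%E.

Let S (y : V) := norm1 y.
Let S0 y : 0 <= S y. Proof. by apply: sumr_ge0. Qed.

Let expweight (k : R) : 0 <= k ->
  (\int[lebV d]_y (k%:E * (expR (- (S y / 4)))%:E) <= (k * 8 ^+ d)%:E)%E.
Proof.
move=> k0.
have me : measurable_fun [set: V] (fun y : V => (expR (- (S y / 4)))%:E).
  by apply/measurable_EFinP; exact: measurable_expnorm1.
apply: (@le_trans _ _ (k%:E * \int[lebV d]_y (expR (- (S y / 4)))%:E)%E).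
  rewrite le_eqVlt; apply/orP; left; apply/eqP.
  by apply: ge0_integralZl => // *; rewrite lee_fin expR_ge0.
by rewrite EFinM; apply: lee_wpmul2l => //; exact: integral_expnorm1.
Qed.

(** By [xlnx_tail] at [S = norm1 y]: the part proportional to the density is paid by the second
    moment, the rest by the exponential weight. *)
Lemma seta_integrable om : second_moment om -> (lebV d).-integrable setT (EFin \o seta om).
Proof.
move=> mo.
pose g (y : V) := sdens om s y * (C + 1 + d%:R * nsq y) + 2 * expR (- (S y / 4)).
have q0 (y : V) : 0 <= C + 1 + d%:R * nsq y by rewrite !addr_ge0// mulr_ge0// nsq_ge0.
have mq : measurable_fun [set: V] (fun y => C + 1 + d%:R * nsq y).
  by apply: measurable_funD => //; exact: measurable_funM.
have me := @measurable_expnorm1 R d.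
have mg : measurable_fun setT g.
  by apply: measurable_funD; apply: measurable_funM => //.
have g0 y : 0 <= g y by rewrite addr_ge0// mulr_ge0// expR_ge0.
have ig : (lebV d).-integrable setT (EFin \o g).
  apply/integrableP; split; first exact/measurable_EFinP.
  have -> : (\int[lebV d]_x `|(EFin \o g) x| = \int[lebV d]_y (sdens om s y * (C + 1 + d%:R * nsq y))%:E +
      \int[lebV d]_y (2%:E * (expR (- (S y / 4)))%:E))%E.
    transitivity (\int[lebV d]_y ((sdens om s y * (C + 1 + d%:R * nsq y))%:E + 2%:E * (expR (- (S y / 4)))%:E))%E.
      by apply: eq_integral => y _; rewrite /= ger0_norm// -EFinM -EFinD.
    apply: ge0_integralD => //.
    - by move=> y _; rewrite lee_fin mulr_ge0.
    - by apply/measurable_EFinP; exact: measurable_funM.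
    - by apply: emeasurable_funM => //; exact/measurable_EFinP.
  apply: lte_add_pinfty.
    rewrite weight//; apply: (@le_lt_trans _ _ ((C + 1)%:E + d%:R%:E * A%:E)%E); last by rewrite -EFinM -EFinD ltry.
    rewrite (_ : (\int[_]_y _ = \int[gconv om s]_y ((C + 1)%:E + d%:R%:E * (nsq y)%:E))%E)//.
    rewrite ge0_integralD//; last 3 first.
    - by move=> y _; rewrite lee_fin addr_ge0.
    - by move=> y _; rewrite -EFinM lee_fin mulr_ge0// nsq_ge0.
    - by apply: emeasurable_funM => //; exact/measurable_EFinP.
    rewrite integral_cst// measure_prob_setT mule1; apply: leeD2l.
    rewrite ge0_integralZl//; last 2 first.
    - exact/measurable_EFinP.
    - by move=> y _; rewrite lee_fin nsq_ge0.
    by apply: lee_wpmul2l.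
  by apply: le_lt_trans (expweight _) (ltry _).
apply: le_integrable ig => //; first by apply/measurable_EFinP; exact: measurable_seta.
move=> y _; rewrite /= lee_fin [leRHS]ger0_norm//.
apply: le_trans (xlnx_tail C0 (S0 y) (f0 om y) (ln_sdens om y)) _.
have h1 : expR (- (S y / 2)) <= expR (- (S y / 4)) by rewrite ler_expR; have := S0 y; lra.
have h2 : S y <= 1 + d%:R * nsq y.
  have := norm1_sqr_le y; have := sqr_ge0 (2 * S y - 1); rewrite /S; nra.
have h3 : sdens om s y * (C + S y) <= sdens om s y * (C + 1 + d%:R * nsq y).
  by rewrite ler_wpM2l// -addrA lerD2l.
by rewrite /g; lra.
Qed.

Lemma seta_close om1 om2 (h rho : R) : second_moment om1 -> second_moment om2 -> 1 <= rho ->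
  (forall y, `|sdens om1 s y - sdens om2 s y| <= h) ->
  `|\int[lebV d]_y seta om1 y - \int[lebV d]_y seta om2 y| <=
  8 ^+ d * (((1 + C) * h + 2 * Num.sqrt h) * expR (rho / 4) + 4 * expR (- (rho / 4))) +
  2 * (C + 1) * d%:R * A / rho.
Proof.
move=> m1 m2 r1 hh.
have i1 := seta_integrable m1. have i2 := seta_integrable m2.
have iB := integrableB measurableT i1 i2.
rewrite -RintegralB//.
apply: le_trans (le_normr_Rintegral _ iB) _ => //.
have r0 : 0 < rho by exact: lt_le_trans r1.
have h0 : 0 <= h by apply: le_trans (hh (vzero R d)).
pose w := ((1 + C) * h + 2 * Num.sqrt h) * expR (rho / 4) + 4 * expR (- (rho / 4)).
have w0 : 0 <= w.
  rewrite addr_ge0 ?mulr_ge0 ?expR_ge0//.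
  by rewrite addr_ge0 ?mulr_ge0 ?sqrtr_ge0// addr_ge0.
pose k := (C + 1) * d%:R / rho.
have k0 : 0 <= k by rewrite divr_ge0 ?(ltW r0)// mulr_ge0// addr_ge0.
have me := @measurable_expnorm1 R d.
rewrite -lee_fin /Rintegral fineK; last exact: integrable_fin_num (integrable_norm iB).
apply: (@le_trans _ _ (\int[lebV d]_y (w%:E * (expR (- (S y / 4)))%:E + ((sdens om1 s y * (k * nsq y))%:E + (sdens om2 s y * (k * nsq y))%:E)))%E).
  apply: ge0_le_integral => //.
  - by apply/measurable_EFinP; apply: measurableT_comp => //; apply: measurable_funB; exact: measurable_seta.
  - apply: emeasurable_funD; first by apply: emeasurable_funM => //; exact/measurable_EFinP.
    by apply: emeasurable_funD; apply/measurable_EFinP; apply: measurable_funM => //; exact: measurable_funM.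
  - move=> y _; rewrite -EFinM -!EFinD lee_fin.
    apply: le_trans (xlnx_pointwise C0 (S0 y) r1 (f0 om1 y) (f0 om2 y) (norm1_sqr_le y) (ln_sdens om1 y) (ln_sdens om2 y) (hh y)) _.
    rewrite -/w [w * _]mulrC lerD2l -mulrDl le_eqVlt; apply/orP; left; apply/eqP.
    by rewrite /k; field; rewrite gt_eqF.
have mk : measurable_fun setT (fun y : V => k * nsq y) by exact: measurable_funM.
have kn0 (y : V) : 0 <= k * nsq y by rewrite mulr_ge0// nsq_ge0.
have wm om : second_moment om -> (\int[lebV d]_y (sdens om s y * (k * nsq y))%:E <= (k * A)%:E)%E.
  move=> mo; rewrite weight//.
  rewrite (_ : (\int[_]_y _ = \int[gconv om s]_y (k%:E * (nsq y)%:E))%E)//.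
  rewrite ge0_integralZl//; last 2 first.
  - exact/measurable_EFinP.
  - by move=> y _; rewrite lee_fin nsq_ge0.
  by rewrite [X in (_ <= X)%E]EFinM; apply: lee_wpmul2l.
rewrite ge0_integralD//; last 4 first.
- by move=> y _; rewrite -EFinM lee_fin mulr_ge0// expR_ge0.
- by apply: emeasurable_funM => //; exact/measurable_EFinP.
- by move=> y _; rewrite -EFinD lee_fin addr_ge0// mulr_ge0.
- by apply: emeasurable_funD; apply/measurable_EFinP; apply: measurable_funM.
rewrite [X in (_ <= X)%E]EFinD; apply: leeD.
  by rewrite mulrC; exact: expweight.
rewrite ge0_integralD//; last 4 first.
- by move=> y _; rewrite lee_fin mulr_ge0.
- by apply/measurable_EFinP; apply: measurable_funM.
- by move=> y _; rewrite lee_fin mulr_ge0.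
- by apply/measurable_EFinP; apply: measurable_funM.
apply: le_trans (leeD (wm _ m1) (wm _ m2)) _.
rewrite -EFinD lee_fin /k le_eqVlt; apply/orP; left; apply/eqP; by field; rewrite gt_eqF.
Qed.

(** The order of the choices matters: first [rho], against the tails; then the tolerance [h] on the
    densities, small enough to beat [exp (rho / 4)]; last [eta] and the radius, which enforce
    [h]. *)
Lemma entropy_close (delta : R) : 0 < delta -> exists eta L : R, 0 < eta /\
  forall om1 om2, second_moment om1 -> second_moment om2 ->
    (forall t, nsq t <= L -> `|chC om1 t - chC om2 t| <= eta /\ `|chS om1 t - chS om2 t| <= eta) ->
  `|\int[lebV d]_y seta om1 y - \int[lebV d]_y seta om2 y| <= delta.
Proof.
move=> delta0; pose E : R := 8 ^+ d.
have E0 : 0 < E by rewrite exprn_gt0.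
pose K := 2 * (C + 1) * d%:R * A.
have K0 : 0 <= K by rewrite !mulr_ge0// addr_ge0.
(* Since [exp (- (rho / 4)) <= 4 / rho], the two tail terms are at most [16 E / rho] and [K / rho],
   together at most [delta / 4]. *)
pose rho := 1 + 4 * (K + 16 * E) / delta.
have rho1 : 1 <= rho by rewrite lerDl divr_ge0 ?(ltW delta0)// mulr_ge0// addr_ge0// mulr_ge0// ltW.
have rho0 : 0 < rho by exact: lt_le_trans rho1.
have hrho : (K + 16 * E) / rho <= delta / 4.
  rewrite ler_pdivrMr// mulrDr mulr1.
  have -> : delta / 4 * (4 * (K + 16 * E) / delta) = K + 16 * E by field; rewrite gt_eqF.
  by rewrite lerDr divr_ge0// ltW.
have erho : expR (- (rho / 4)) <= 4 / rho.
  rewrite expRN -[leRHS]invrK lef_pV2 ?posrE ?expR_gt0 ?invr_gt0 ?divr_gt0//.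
  by rewrite invf_div; have := expR_ge1Dx (rho / 4); lra.
pose b := expR (rho / 4). have b0 : 0 < b by exact: expR_gt0.
pose w := delta / (4 * (E * b)). have w0 : 0 < w by rewrite divr_gt0// mulr_gt0// mulr_gt0.
(* One argument of the minimum for the linear term, the other for the square root. *)
pose h := Num.min (w / (2 * (1 + C))) ((w / 4) ^+ 2).
have C1 : 0 < 1 + C by rewrite ltr_wpDr.
have h0 : 0 < h.
  by rewrite lt_min; apply/andP; split; [rewrite divr_gt0// mulr_gt0|rewrite exprn_gt0// divr_gt0].
have hw : (1 + C) * h + 2 * Num.sqrt h <= w.
  have h1 : (1 + C) * h <= w / 2.
    apply: (@le_trans _ _ ((1 + C) * (w / (2 * (1 + C))))).
      by rewrite ler_wpM2l ?(ltW C1)// ge_min lexx.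
    rewrite le_eqVlt; apply/orP; left; apply/eqP; field; by rewrite gt_eqF.
  have h2 : Num.sqrt h <= w / 4.
    apply: (@le_trans _ _ (Num.sqrt ((w / 4) ^+ 2))); first by rewrite ler_wsqrtr// ge_min lexx orbT.
    by rewrite sqrtr_sqr ger0_norm// divr_ge0// ltW.
  lra.
(* [eta] and [lam] each spend half of [h] in [sdens_close]; [d + 1] keeps [lam] positive in
   dimension 0. *)
pose eta := h / (4 * (c + 1)).
have c1 : 0 < c + 1 by rewrite ltr_wpDl.
have eta0 : 0 < eta by rewrite divr_gt0// mulr_gt0.
pose lam := 8 * (c + 1) * (d%:R + 1) / (s * h).
have d1 : (0 : R) < d%:R + 1 by rewrite ltr_wpDl.
have lam0 : 0 < lam by rewrite divr_gt0 ?mulr_gt0.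
exists eta, (lam ^+ 2); split => // om1 om2 m1 m2 close.
have fh y : `|sdens om1 s y - sdens om2 s y| <= h.
  apply: le_trans (sdens_close s0 (ltW eta0) lam0 close y) _; rewrite -/c mulrDr.
  have -> : 4 / lam * (d%:R / s) = h / 2 * (d%:R / (d%:R + 1)) / (c + 1).
    by rewrite /lam; field; rewrite !gt_eqF.
  have -> : 2 * eta = h / 2 / (c + 1) by rewrite /eta; field; rewrite gt_eqF.
  have cc : c / (c + 1) <= 1 by rewrite ler_pdivrMr// mul1r lerDl.
  have dd : (d%:R / (d%:R + 1) : R) <= 1 by rewrite ler_pdivrMr// mul1r lerDl.
  have cc0 : 0 <= c / (c + 1) by rewrite divr_ge0// ltW.
  have dd0 : (0 : R) <= d%:R / (d%:R + 1) by rewrite divr_ge0// ltW.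
  have -> : c * (h / 2 / (c + 1)) = h / 2 * (c / (c + 1)) by field; rewrite gt_eqF.
  have -> : c * (h / 2 * (d%:R / (d%:R + 1)) / (c + 1)) = h / 2 * ((d%:R / (d%:R + 1)) * (c / (c + 1))).
    by field; rewrite !gt_eqF.
  have h20 : 0 <= h / 2 by rewrite divr_ge0// ltW.
  have : h / 2 * (c / (c + 1)) <= h / 2 * 1 by rewrite ler_wpM2l.
  have : h / 2 * ((d%:R / (d%:R + 1)) * (c / (c + 1))) <= h / 2 * (1 * 1).
    by rewrite ler_wpM2l// ler_pM.
  by rewrite !mulr1; lra.
apply: le_trans (seta_close m1 m2 rho1 fh) _; rewrite -/E -/K -/b mulrDr.
have w1 : E * (((1 + C) * h + 2 * Num.sqrt h) * b) <= delta / 4.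
  apply: (@le_trans _ _ (E * (w * b))); first by rewrite ler_wpM2l ?(ltW E0)// ler_wpM2r// ltW.
  rewrite le_eqVlt; apply/orP; left; apply/eqP; rewrite /w; field; by rewrite !gt_eqF.
have w2 : E * (4 * expR (- (rho / 4))) <= 16 * E / rho.
  have -> : 16 * E / rho = E * (4 * (4 / rho)) by field; rewrite gt_eqF.
  by rewrite ler_wpM2l ?(ltW E0)// ler_wpM2l.
move: hrho; rewrite mulrDl; move: w2 w1.
set x1 := _ * (_ * b); set x2 := E * _; set x3 := _ / rho; set x4 := K / rho.
lra.
Qed.

End EntropyContinuity.

Section EntropyOfDensity.
Context {R : realType} {d : nat}.
Notation V := (d.-tuple R).
Variable mu : {measure set V -> \bar R}.
Hypothesis Hmu : lebesgue_vec mu.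
Variable s : R.
Hypothesis s0 : 0 < s.
Context d0 (T : measurableType d0) (P : probability T R) (Y : T -> V) (om : probability V R).
Hypothesis law : forall A, measurable A -> P (Y @^-1` A) = gconv om s A.

Let mu_leb (A : set V) (f : V -> \bar R) : measurable A ->
  (\int[mu]_(x in A) f x = \int[lebV d]_(x in A) f x)%E.
Proof.
move=> mA; apply: eq_measure_integral => B mB _.
by apply: lebesgue_vec_unique => //; exact: lebesgue_vec_lebV.
Qed.

Lemma density_sdens : density_of mu P Y (sdens om s).
Proof.
split; first exact: measurable_sdens.
split; first by move=> x; exact: sdens_ge0.
move=> A mA; rewrite law// mu_leb//.
have -> : gconv om s A = (\int[gconv om s]_x (\1_A x)%:E)%E by rewrite integral_indic// setIT.
rewrite (integral_gconv om s0) => [|//|x]; [|by apply/measurable_EFinP|by rewrite lee_fin].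
rewrite [RHS]integral_mkcond; apply: eq_integral => x _.
rewrite patchE indicE; case: ifPn => _; first by rewrite mul1e.
by rewrite mul0e.
Qed.

Variable A : R.
Hypothesis mo : (\int[gconv om s]_y (nsq y)%:E <= A%:E)%E.

(** Two densities of the same law agree almost everywhere, so the entropy does not depend on the
    version [f] and can be computed on the explicit one. *)
Lemma diff_entropy_sdens f : density_of mu P Y f ->
  diff_entropy mu f = (- \int[lebV d]_y seta s om y)%:E.
Proof.
move=> [mf [f0 fE]]; rewrite /diff_entropy mu_leb// EFinN; congr (- _)%E.
have [mg [g0 gE]] := density_sdens.
have is_ := seta_integrable s0 mo.
rewrite -[RHS]/((fine _)%:E) fineK; last exact: integrable_fin_num is_.
have fi : (lebV d).-integrable setT (EFin \o f).
  apply/integrableP; split; first exact/measurable_EFinP.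
  rewrite (_ : (\int[_]_x _ = \int[lebV d]_(x in setT) (f x)%:E)%E); last first.
    by apply: eq_integral => x _; rewrite /= ger0_norm.
  by rewrite -mu_leb// -fE// preimage_setT measure_prob_setT ltry.
have fg : ae_eq (lebV d) setT (EFin \o f) (EFin \o sdens om s).
  apply: integral_ae_eq => //; first exact/measurable_EFinP.
  by move=> B _ mB; rewrite -!mu_leb// -fE// gE.
apply: ae_eq_integral => //.
- by apply/measurable_EFinP; apply: measurable_funM => //; exact: measurableT_comp.
- by apply/measurable_EFinP; exact: measurable_seta.
apply: filterS fg => x /(_ I) /= [fgx] _; by rewrite fgx.
Qed.

End EntropyOfDensity.

(** * Gaussian approximation *)

Lemma integral_law (R : realType) d0 (T : measurableType d0) (P : probability T R) d1
    (T1 : measurableType d1) (nu : {measure set T1 -> \bar R}) (Y : T -> T1) (f : T1 -> \bar R) :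
  measurable_fun setT Y -> (forall A, measurable A -> P (Y @^-1` A) = nu A) ->
  measurable_fun setT f -> (forall x, 0 <= f x)%E -> (\int[nu]_x f x = \int[P]_w f (Y w))%E.
Proof.
move=> mY law mf f0; rewrite -(integral_pushprob P mY mf f0).
by apply: eq_measure_integral => A mA _; exact/esym/law.
Qed.

Section NearGaussian.
Context {R : realType} {d : nat}.
Notation V := (d.-tuple R).
Variables (M l : R).
Hypotheses (M0 : 0 <= M) (l0 : 0 < l).
Let s := Num.sqrt l.
Let s0 : 0 < s. Proof. by rewrite sqrtr_gt0. Qed.
Let s2 : s ^+ 2 = l. Proof. by rewrite sqr_sqrtr// ltW. Qed.

Lemma expRN_le (x : R) : 0 <= x -> expR (- x) <= 1 - x + x ^+ 2.
Proof.
move=> x0; rewrite expRN; have x1 : 0 < 1 + x by rewrite ltr_wpDr.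
apply: (@le_trans _ _ (1 + x)^-1).
  by rewrite lef_pV2 ?posrE ?expR_gt0//; exact: expR_ge1Dx.
rewrite -[leLHS]mul1r ler_pdivrMr//.
have -> : (1 - x + x ^+ 2) * (1 + x) = 1 + x ^+ 3 by ring.
by rewrite lerDl exprn_ge0.
Qed.

Definition gaussian_law_of (K : 'M[R]_d) (m : V) (omG : probability V R) :=
  forall t, chC (gconv omG s) t = cos (dotv t m) * expR (- (quadf K t / 2)) /\
    chS (gconv omG s) t = sin (dotv t m) * expR (- (quadf K t / 2)).

(** An upper bound is what the Loewner inequality asks for, and Fatou gives it from the
    characteristic function. *)
Lemma gaussian_second_moment K m omG t : 0 <= quadf K t -> gaussian_law_of K m omG ->
  (\int[gconv omG s]_x (dotv t x ^+ 2)%:E <= (quadf K t + dotv t m ^+ 2)%:E)%E.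
Proof.
move=> K0 G; apply: second_moment_le => [|h]; first exact: measurable_dotv.
have -> : \int[gconv omG s]_x cos (h * dotv t x) = chC (gconv omG s) (vscale h t).
  by apply: eq_Rintegral => x _; rewrite dotv_scale.
rewrite (G _).1 quadf_scale dotv_scale.
set a := h * dotv t m; set b := h ^+ 2 * quadf K t / 2.
have b0 : 0 <= b by rewrite divr_ge0// mulr_ge0// sqr_ge0.
have h1 := oneBcos_le a; have h2 := expR_ge1Dx (- b).
have h3 : 0 <= 1 - cos a by rewrite subr_ge0; have := cos_max a; rewrite ler_norml => /andP[].
have h4 : (1 - cos a) * expR (- b) <= (1 - cos a) * 1.
  by rewrite ler_wpM2l// -expR0 ler_expR oppr_le0.
have -> : h ^+ 2 * (quadf K t + dotv t m ^+ 2) / 2 = b + a ^+ 2 / 2 by rewrite /a /b; field.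
nra.
Qed.

Let mnsqi (i : 'I_d) : measurable_fun setT (fun x : V => (tnth x i ^+ 2)%:E).
Proof. by apply/measurable_EFinP; apply: measurable_funX; exact: measurable_tnth. Qed.

Lemma coord_nsq_moment (nu : probability V R) (a : R) :
  (forall i, \int[nu]_x (dotv (basisv i) x ^+ 2)%:E <= a%:E)%E ->
  (\int[nu]_x (nsq x)%:E <= (d%:R * a)%:E)%E.
Proof.
move=> h; rewrite /nsq; under eq_integral => x _ do rewrite -sumEFin.
rewrite ge0_integral_sum//; last by move=> i x _; rewrite lee_fin sqr_ge0.
apply: (@le_trans _ _ (\sum_(i < d) a%:E)%E).
  apply: lee_sum => i _; apply: le_trans (h i); rewrite le_eqVlt; apply/orP; left; apply/eqP.
  by apply: eq_integral => x _; rewrite dotvC dotv_basisr.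
by rewrite sumEFin sumr_const card_ord mulr_natl.
Qed.

Let nsq_basisv i : nsq (basisv i : V) = 1.
Proof. by rewrite nsqE dotv_basisr tnth_mktuple eqxx. Qed.

(** The second clause compares covariances: the Gaussian receives the mean of [Y], so the mean terms
    cancel when second moments are compared. *)
Definition entropy_cov_close (delta : R) d0 (T : measurableType d0) (P : probability T R)
    (Y : T -> V) (K : 'M[R]_d) (om omG : probability V R) :=
  `|\int[lebV d]_y seta s om y - \int[lebV d]_y seta s omG y| <= delta /\
  forall u, quadf K u <= \int[P]_w (cdev P Y u w ^+ 2) + delta * nsq u.

Section OneVariable.
Context d0 (T : measurableType d0) (P : probability T R) (Y : T -> V).
Hypotheses (mY : measurable_fun setT Y) (Y2 : finite_second_moment P Y)
  (YM : (\sum_(i < d) expectation P (fun w => (tnth (Y w) i ^+ 2)%R) <= M%:E)%E).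
Variable om : probability V R.
Hypothesis law : forall A, measurable A -> P (Y @^-1` A) = gconv om s A.

Let law_Rint (f : V -> R) : \int[gconv om s]_x f x = \int[pushprob P mY]_x f x.
Proof.
by congr fine; apply: eq_measure_integral => A mA _; exact/esym/law.
Qed.

Lemma law_ch t : chC (gconv om s) t = chYC P Y t /\ chS (gconv om s) t = chYS P Y t.
Proof. by rewrite -(chC_pushprob P mY) -(chS_pushprob P mY) /chC /chS !law_Rint. Qed.

(** [5 * M] is the bound shared with the Gaussian of [gaussian_law_moment]: per coordinate, at most
    [4 * M] from [K] and [M] from the squared mean. *)
Lemma law_second_moment : (\int[gconv om s]_x (nsq x)%:E <= (d%:R * (5 * M))%:E)%E.
Proof.
apply: coord_nsq_moment => i; rewrite (integral_law mY law); last 2 first.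
- by apply/measurable_EFinP; apply: measurable_funX; exact: measurable_dotv.
- by move=> x; rewrite lee_fin sqr_ge0.
rewrite EFin_Rintegral; last exact: dotv2_integrable.
rewrite lee_fin (le_trans (Rintegral_dotv2_le mY Y2 YM _))// nsq_basisv.
by have := M0; lra.
Qed.

Lemma gaussian_law_moment K omG : (forall x : V, l * nsq x <= quadf K x <= 4 * M * nsq x) ->
  gaussian_law_of K (vmean P Y) omG ->
  (\int[gconv omG s]_x (nsq x)%:E <= (d%:R * (5 * M))%:E)%E.
Proof.
move=> bK G; apply: coord_nsq_moment => i; have /andP[k1 k2] := bK (basisv i).
have k0 : 0 <= quadf K (basisv i) by apply: le_trans k1; rewrite mulr_ge0 ?nsq_ge0// ltW.
apply: le_trans (gaussian_second_moment k0 G) _; rewrite lee_fin.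
have h1 := Rintegral_dotv2_le mY Y2 YM (basisv i).
rewrite Rintegral_dotv2// in h1.
have h2 : 0 <= \int[P]_w (cdev P Y (basisv i) w ^+ 2) by apply: Rintegral_ge0 => // w _; exact: sqr_ge0.
rewrite !nsq_basisv in h1 k2; lra.
Qed.

Lemma chY_uncenter t : chYC P Y t = cos (dotv t (vmean P Y)) * cchC P Y t - sin (dotv t (vmean P Y)) * cchS P Y t /\
  chYS P Y t = sin (dotv t (vmean P Y)) * cchC P Y t + cos (dotv t (vmean P Y)) * cchS P Y t.
Proof.
rewrite cchCE// cchSE//; have := cos2Dsin2 (dotv t (vmean P Y)).
set a := cos _; set b := sin _; set x := chYC _ _ _; set y := chYS _ _ _ => ab.
split; [rewrite -[LHS]mul1r -ab|rewrite -[LHS]mul1r -ab]; ring.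
Qed.

(** The entropy estimate compares the laws before smoothing. Dividing by the noise factor costs at
    most [exp (l L / 2)] on the ball; restoring the mean mixes cosine and sine and costs the factor
    2. *)
Lemma gaussian_law_ch_close K omG (eta L : R) : gaussian_law_of K (vmean P Y) omG ->
  (forall t, nsq t <= L -> `|cchC P Y t - expR (- (quadf K t / 2))| <= eta /\ `|cchS P Y t| <= eta) ->
  forall t, nsq t <= L -> `|chC om t - chC omG t| <= expR (l * L / 2) * (2 * eta) /\
    `|chS om t - chS omG t| <= expR (l * L / 2) * (2 * eta).
Proof.
move=> G near t tL; have [n1 n2] := near t tL.
have [G1 G2] := G t; have [Y1' Y2'] := law_ch t; have [U1 U2] := chY_uncenter t.
rewrite chC_gconv// in G1; rewrite chS_gconv// in G2; rewrite chC_gconv// in Y1'; rewrite chS_gconv// in Y2'.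
rewrite s2 in G1 G2 Y1' Y2'.
have eK (x : R) : x = expR (l * nsq t / 2) * (expR (- (l * nsq t / 2)) * x).
  by rewrite mulrA -expRD subrr expR0 mul1r.
have le1 : expR (l * nsq t / 2) <= expR (l * L / 2).
  by rewrite ler_expR ler_pM2r// ler_wpM2l// ltW.
set a := dotv t (vmean P Y) in G1 G2 U1 U2.
set g := expR (- (quadf K t / 2)) in n1 G1 G2.
have ca : `|cos a| <= 1 by exact: cos_max. have sa : `|sin a| <= 1 by exact: sin_max.
have tri (x y p q : R) : `|x| <= 1 -> `|y| <= 1 -> `|p| <= eta -> `|q| <= eta -> `|x * p + y * q| <= 2 * eta.
  move=> x1 y1 pe qe; apply: le_trans (ler_normD _ _) _; rewrite !normrM.
  have : `|x| * `|p| <= 1 * eta by rewrite ler_pM.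
  have : `|y| * `|q| <= 1 * eta by rewrite ler_pM.
  lra.
have fin (x y p q : R) : expR (- (l * nsq t / 2)) * x = p -> expR (- (l * nsq t / 2)) * y = q ->
    `|p - q| <= 2 * eta -> `|x - y| <= expR (l * L / 2) * (2 * eta).
  move=> xp yq pq; rewrite (eK x) (eK y) xp yq -mulrBr normrM ger0_norm ?expR_ge0//.
  by rewrite ler_pM ?expR_ge0.
split.
  apply: fin Y1' G1 _; rewrite U1.
  have -> : cos a * cchC P Y t - sin a * cchS P Y t - cos a * g = cos a * (cchC P Y t - g) + (- sin a) * cchS P Y t by ring.
  by apply: tri => //; rewrite normrN.
apply: fin Y2' G2 _; rewrite U2.
have -> : sin a * cchC P Y t + cos a * cchS P Y t - sin a * g = sin a * (cchC P Y t - g) + cos a * cchS P Y t by ring.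
exact: tri.
Qed.

(* Expand [exp (- tau^2 K_u / 2)] and [E cos (tau W)] to second order at
   [tau^2 = rho / nsq u]. *)
Lemma quadf_cov_close K (eta rho : R) : (forall x : V, l * nsq x <= quadf K x <= 4 * M * nsq x) ->
  0 < rho ->
  (forall t, nsq t <= rho -> `|cchC P Y t - expR (- (quadf K t / 2))| <= eta) ->
  forall u, quadf K u <= \int[P]_w (cdev P Y u w ^+ 2) + (2 * eta / rho + 8 * M ^+ 2 * rho) * nsq u.
Proof.
move=> bK rho0 near u; have /andP[k1 k2] := bK u.
have [u0|u0] := leP (nsq u) 0.
  have {}u0 : nsq u = 0 by apply/eqP; rewrite eq_le u0 nsq_ge0.
  rewrite u0 mulr0 addr0; rewrite u0 mulr0 in k2; apply: le_trans k2 _.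
  by apply: Rintegral_ge0 => // w _; exact: sqr_ge0.
pose tau := Num.sqrt (rho / nsq u).
have tau2 : tau ^+ 2 = rho / nsq u by rewrite sqr_sqrtr// divr_ge0// ltW.
have k0 : 0 <= quadf K u by apply: le_trans k1; rewrite mulr_ge0 ?nsq_ge0// ltW.
have nt : nsq (vscale tau u) = rho by rewrite nsq_scale tau2 divfK// gt_eqF.
have := near (vscale tau u); rewrite nt => /(_ (lexx _)); rewrite quadf_scale => n1.
have n2 := cchC_lower mY Y2 (vscale tau u).
have cE : \int[P]_w (cdev P Y (vscale tau u) w ^+ 2) = tau ^+ 2 * \int[P]_w (cdev P Y u w ^+ 2).
  rewrite -RintegralZl//; last exact: cdev2_integrable.
  by apply: eq_Rintegral => w _; rewrite /cdev !dotv_scale -mulrBr exprMn.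
rewrite cE in n2; set W := Rintegral _ _ _ in n2 *.
pose x := tau ^+ 2 * quadf K u / 2.
have x0 : 0 <= x by rewrite divr_ge0// mulr_ge0// sqr_ge0.
have n3 := expRN_le x0.
have xle : x <= 2 * M * rho.
  rewrite /x tau2; apply: (@le_trans _ _ (rho / nsq u * (4 * M * nsq u) / 2)).
    by rewrite ler_pM2r// ler_wpM2l// divr_ge0// ltW.
  by rewrite le_eqVlt; apply/orP; left; apply/eqP; field; rewrite gt_eqF.
have x2 : x ^+ 2 <= (2 * M * rho) ^+ 2 by rewrite lerXn2r// nnegrE ?mulr_ge0// ltW.
have main : x <= tau ^+ 2 * W / 2 + eta + (2 * M * rho) ^+ 2.
  move: n1; rewrite -/x ler_norml => /andP[]; move: n2 n3 x2; set c := cchC _ _ _; set e := expR _; lra.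
have -> : quadf K u = x * (2 * nsq u / rho).
  by rewrite /x tau2; field; rewrite !gt_eqF.
apply: (@le_trans _ _ ((tau ^+ 2 * W / 2 + eta + (2 * M * rho) ^+ 2) * (2 * nsq u / rho))).
  by rewrite ler_wpM2r// divr_ge0 ?mulr_ge0 ?(ltW u0) ?(ltW rho0).
by rewrite tau2 le_eqVlt; apply/orP; left; apply/eqP; field; rewrite !gt_eqF.
Qed.

End OneVariable.

Lemma near_gaussian_close (delta : R) : 0 < delta -> exists eta L : R, 0 < eta /\
  forall d0 (T : measurableType d0) (P : probability T R) (Y : T -> V) K (om omG : probability V R),
  measurable_fun setT Y -> finite_second_moment P Y ->
  (\sum_(i < d) expectation P (fun w => (tnth (Y w) i ^+ 2)%R) <= M%:E)%E ->
  (forall A, measurable A -> P (Y @^-1` A) = gconv om s A) ->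
  (forall x : V, l * nsq x <= quadf K x <= 4 * M * nsq x) ->
  gaussian_law_of K (vmean P Y) omG ->
  (forall t, nsq t <= L -> `|cchC P Y t - expR (- (quadf K t / 2))| <= eta /\ `|cchS P Y t| <= eta) ->
  entropy_cov_close delta P Y K om omG.
Proof.
move=> delta0.
have A0 : 0 <= d%:R * (5 * M) by rewrite !mulr_ge0.
have [eta0 [L0 [e0 H]]] := @entropy_close R d s s0 _ A0 delta delta0.
(* Makes [8 M^2 rho] at most [delta / 2]; the second bound on [eta] then does the same for
   [2 eta / rho]. *)
pose rho := delta / (16 * (M ^+ 2 + 1)).
have M1 : 0 < M ^+ 2 + 1 by rewrite ltr_wpDl// sqr_ge0.
have rho0 : 0 < rho by rewrite divr_gt0// mulr_gt0.
pose b := expR (l * L0 / 2); have b0 : 0 < b by exact: expR_gt0.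
pose eta := Num.min (eta0 / (2 * b)) (delta * rho / 4).
(* The entropy estimate uses the ball of [L0], the covariance estimate that of [rho]. *)
exists eta, (Num.max L0 rho); split.
  by rewrite lt_min; apply/andP; split; rewrite divr_gt0// mulr_gt0.
move=> d0 T P Y K om omG mY Y2 YM law bK G near; split.
  apply: H; [by apply: law_second_moment law|by apply: gaussian_law_moment G|].
  move=> t tL.
  have near0 t' : nsq t' <= L0 -> `|cchC P Y t' - expR (- (quadf K t' / 2))| <= eta /\ `|cchS P Y t'| <= eta.
    by move=> t'L; apply: near; rewrite le_max t'L.
  have [h1 h2] := gaussian_law_ch_close mY law G near0 tL.
  have be : expR (l * L0 / 2) * (2 * eta) <= eta0.
    apply: (@le_trans _ _ (b * (2 * (eta0 / (2 * b))))).
      by rewrite ler_pM2l// ler_pM2l// ge_min lexx.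
    by rewrite le_eqVlt; apply/orP; left; apply/eqP; field; rewrite gt_eqF.
  by split; [exact: le_trans h1 be|exact: le_trans h2 be].
move=> u.
have near1 t : nsq t <= rho -> `|cchC P Y t - expR (- (quadf K t / 2))| <= eta.
  by move=> tr; apply: (near t _).1; rewrite le_max tr orbT.
apply: le_trans (quadf_cov_close mY Y2 bK rho0 near1 u) _.
rewrite lerD2l ler_wpM2r ?nsq_ge0//.
have : 2 * eta / rho <= delta / 2.
  rewrite ler_pdivrMr//; have : eta <= delta * rho / 4 by rewrite ge_min lexx orbT.
  lra.
have : 8 * M ^+ 2 * rho <= delta / 2.
  rewrite /rho mulrA ler_pdivrMr ?mulr_gt0//; have := ltW delta0; nra.
lra.
Qed.

End NearGaussian.

(** * From integral estimates to entropies and Loewner inequalities *)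

Section SecondMomentMatrix.
Context {R : realType} {d : nat} d0 (T : measurableType d0) (P : probability T R).
Notation V := (d.-tuple R).
Variable Y : T -> V.
Hypotheses (mY : measurable_fun setT Y) (Y2 : finite_second_moment P Y).

Let iYY i j : P.-integrable setT (EFin \o (fun w => tnth (Y w) i * tnth (Y w) j)).
Proof.
have mYi k : measurable_fun setT (fun w => tnth (Y w) k).
  exact: (measurableT_comp (measurable_tnth k) mY).
apply: (le_integrable measurableT _ _ (integrableD measurableT (coord2_integrable mY Y2 i) (coord2_integrable mY Y2 j))).
  by apply/measurable_EFinP; exact: measurable_funM.
move=> w _; rewrite /= lee_fin; set a := tnth _ i; set b := tnth _ j.
rewrite [leRHS]ger0_norm ?addr_ge0 ?sqr_ge0// normrM.
rewrite -(real_normK (num_real a)) -(real_normK (num_real b)).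
have := sqr_ge0 (`|a| - `|b|); have := sqr_ge0 (`|a|); have := sqr_ge0 (`|b|); nra.
Qed.

Lemma quadf_second_moment_mx u : quadf (second_moment_mx P Y) u = \int[P]_w (dotv u (Y w) ^+ 2).
Proof.
have EM i j : second_moment_mx P Y i j = \int[P]_w (tnth (Y w) i * tnth (Y w) j).
  by rewrite mxE /Ere expectationE.
rewrite /Rintegral.
have -> : (\int[P]_w (dotv u (Y w) ^+ 2)%:E = \int[P]_w (\sum_(i < d) (\sum_(j < d)
    ((tnth u i * tnth u j)%:E * (tnth (Y w) i * tnth (Y w) j)%:E))))%E.
  apply: eq_integral => w _; rewrite expr2 {1}/dotv mulr_suml -sumEFin; apply: eq_bigr => i _.
  rewrite /dotv mulr_sumr -sumEFin; apply: eq_bigr => j _; rewrite -EFinM; congr (_%:E); ring.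
have ii i j := integrableZl measurableT (tnth u i * tnth u j) (iYY i j).
rewrite integral_sum//; last by move=> i; apply: integrable_sum => // j _; exact: ii.
rewrite -[LHS]/(fine (_%:E)) /quadf -sumEFin; congr fine; apply: eq_bigr => i _.
rewrite integral_sum// -sumEFin; apply: eq_bigr => j _.
transitivity ((tnth u i * tnth u j)%:E * (\int[P]_w (tnth (Y w) i * tnth (Y w) j))%:E)%E.
  by rewrite -EFinM EM; congr (_%:E); ring.
by rewrite -EFin_Rintegral//; exact: esym (integralZl measurableT (iYY i j) _).
Qed.

Lemma second_moment_mx_sym : (second_moment_mx P Y)^T = second_moment_mx P Y.
Proof.
apply/matrixP => i j; rewrite !mxE; congr (Ere P _).
by apply/funext => w; rewrite mulrC.
Qed.

End SecondMomentMatrix.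

Section GaussianApproximation.
Context {R : realType} {d : nat}.
Notation V := (d.-tuple R).
Variable mu : {measure set V -> \bar R}.
Hypothesis Hmu : lebesgue_vec mu.

Definition gaussian_approx (b : R) d1 (T1 : measurableType d1) (P : probability T1 R) (Y : T1 -> V)
    d2 (T2 : measurableType d2) (P' : probability T2 R) (Yg : T2 -> V) :=
  [/\ exists f, density_of mu P Y f, exists g, density_of mu P' Yg g,
   forall f g, density_of mu P Y f -> density_of mu P' Yg g ->
         (`| diff_entropy mu f - diff_entropy mu g | <= b%:E)%E &
   loewner_le (second_moment_mx P' Yg) (second_moment_mx P Y + b%:M)].

Lemma quadfDB (A B : 'M[R]_d) (b : R) (u : V) :
  quadf (A + b%:M - B) u = quadf A u + b * nsq u - quadf B u.
Proof.
have -> : quadf A u + b * nsq u = quadf (A - (- b)%:M) u by rewrite quadf_sub_scalar; ring.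
rewrite (_ : (- b)%:M = - b%:M); last by apply/matrixP => i j; rewrite !mxE mulNrn.
rewrite opprK /quadf -sumrB; apply: eq_bigr => i _; rewrite -sumrB; apply: eq_bigr => j _.
by rewrite !mxE; ring.
Qed.

Variables (M l : R).
Hypotheses (M0 : 0 <= M) (l0 : 0 < l).
Let s := Num.sqrt l.
Let s0 : 0 < s. Proof. by rewrite sqrtr_gt0. Qed.

Lemma entropy_cov_close_approx (b : R) d1 (T1 : measurableType d1) (P : probability T1 R) (Y : T1 -> V)
    d2 (T2 : measurableType d2) (P' : probability T2 R) (Yg : T2 -> V) K om omG :
  measurable_fun setT Y -> finite_second_moment P Y ->
  (\sum_(i < d) expectation P (fun w => (tnth (Y w) i ^+ 2)%R) <= M%:E)%E ->
  (forall A, measurable A -> P (Y @^-1` A) = gconv om s A) ->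
  measurable_fun setT Yg ->
  (forall A, measurable A -> P' (Yg @^-1` A) = gconv omG s A) ->
  (forall x : V, l * nsq x <= quadf K x <= 4 * M * nsq x) ->
  gaussian_law_of l K (vmean P Y) omG ->
  entropy_cov_close l b P Y K om omG ->
  gaussian_approx b P Y P' Yg.
Proof.
move=> mY Y2 YM law mYg lawg bK G [ent cov].
have mom := law_second_moment M0 mY Y2 YM law.
have momg := gaussian_law_moment l0 mY Y2 YM bK G.
split.
- by exists (sdens om s); exact: density_sdens.
- by exists (sdens omG s); exact: density_sdens.
- move=> f g df dg.
  rewrite (diff_entropy_sdens Hmu s0 law mom df) (diff_entropy_sdens Hmu s0 lawg momg dg).
  by rewrite -EFinB lee_fin opprK addrC distrC; move: ent; rewrite distrC.
have dg u : (\int[P']_w (dotv u (Yg w) ^+ 2)%:E <= (quadf K u + dotv u (vmean P Y) ^+ 2)%:E)%E.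
  have k0 : 0 <= quadf K u.
    by have /andP[k1 _] := bK u; apply: le_trans k1; rewrite mulr_ge0 ?nsq_ge0// ltW.
  apply: le_trans (gaussian_second_moment k0 G); rewrite (integral_law mYg lawg)//.
  - by apply/measurable_EFinP; apply: measurable_funX; exact: measurable_dotv.
  - by move=> x; rewrite lee_fin sqr_ge0.
(* Finiteness for the Gaussian follows from the bound just proved, tested on basis vectors. *)
have Yg2 : finite_second_moment P' Yg.
  move=> i; rewrite expectationE; apply: le_lt_trans (ltry _).
  apply: le_trans (dg (basisv i)); rewrite le_eqVlt; apply/orP; left; apply/eqP.
  by apply: eq_integral => w _; rewrite dotvC dotv_basisr.
split.
  rewrite /symmetric_mx linearB /= linearD /= tr_scalar_mx.
  by rewrite !second_moment_mx_sym.
move=> u; rewrite quadfDB !quadf_second_moment_mx// Rintegral_dotv2//.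
have : \int[P']_w (dotv u (Yg w) ^+ 2) <= quadf K u + dotv u (vmean P Y) ^+ 2.
  by rewrite -lee_fin -EFin_Rintegral//; exact: dotv2_integrable.
have := cov u; lra.
Qed.

(** Both Gaussians live on one space: the centred law of covariance [K], translated by each mean.
    The law [omG] describes the translate as a smoothed law, for its density. *)
Lemma gaussian_witness (K : 'M[R]_d) (m : V) : K^T = K -> (forall x : V, l * nsq x <= quadf K x) ->
  forall om0 omG, gaussian_law_of l K (vzero R d) om0 -> gaussian_law_of l K m omG ->
  [/\ measurable_fun setT (fun x : V => vadd m x), gaussian_vec (gconv om0 s) (fun x : V => vadd m x) m K &
   forall A, measurable A -> gconv om0 s ((fun x : V => vadd m x) @^-1` A) = gconv omG s A].
Proof.
move=> KT lK om0 omG G0 G.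
have mYg : measurable_fun setT (fun x : V => vadd m x).
  exact: (measurableT_comp (@measurable_vadd R d) (pair1_measurable m)).
have ch t : chYC (gconv om0 s) (fun x : V => vadd m x) t = cos (dotv t m) * expR (- (quadf K t / 2)) /\
    chYS (gconv om0 s) (fun x : V => vadd m x) t = sin (dotv t m) * expR (- (quadf K t / 2)).
  have [c0 k0] := G0 t.
  have t0 : dotv t (vzero R d) = 0 by rewrite /dotv big1// => i _; rewrite tnth_mktuple mulr0.
  rewrite t0 cos0 mul1r in c0; rewrite t0 sin0 mul0r in k0.
  have E c : \int[gconv om0 s]_x cos (dotv t x + c) = cos c * expR (- (quadf K t / 2)).
    by rewrite Rintegral_cosD c0 k0 mulr0 subr0.
  split.
    by rewrite -E; apply: eq_Rintegral => x _; rewrite dotv_vadd addrC.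
  rewrite -[sin _]cosBpihalf -E; apply: eq_Rintegral => x _.
  by rewrite dotv_vadd -cosBpihalf addrAC addrC.
split => //.
  split => //; split.
    by split => // x; apply: le_trans (lK x); rewrite mulr_ge0 ?nsq_ge0 ?(ltW l0).
  by move=> t; rewrite /Ere !expectationE; exact: ch.
move=> A mA; change (pushprob (gconv om0 s) mYg A = gconv omG s A).
apply: characteristic_unique mA => t.
  by rewrite chC_pushprob (G t).1 (ch t).1.
by rewrite chS_pushprob (G t).2 (ch t).2.
Qed.

End GaussianApproximation.

(** * A bound uniform over all probability spaces *)

Section UniformBound.
Context {R : realType} {d : nat}.
Notation V := (d.-tuple R).
Variable mu : {measure set V -> \bar R}.
Hypothesis Hmu : lebesgue_vec mu.
Variables (M l : R).
Hypotheses (M0 : 0 <= M) (l0 : 0 < l).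

(** The interface between probability and analysis: of the decomposition [X + Z] there remain a
    Gaussian component of covariance [l I] in the law, and the regularity of the centred
    characteristic function. *)
Record regular (dT : measure_display) (T : measurableType dT) (P : probability T R) (Y : T -> V) : Prop := Regular {
  regular_measurable : measurable_fun setT Y;
  regular_finite : finite_second_moment P Y;
  regular_bound : (\sum_(i < d) expectation P (fun w => (tnth (Y w) i ^+ 2)%R) <= M%:E)%E;
  regular_law : exists om, forall A, measurable A -> P (Y @^-1` A) = gconv om (Num.sqrt l) A;
  regular_ch : chreg M l (cchC P Y) (cchS P Y) }.

Definition regular_pair eps dT (T : measurableType dT) (P : probability T R) (Y1 Y2 : T -> V) :=
  [/\ regular P Y1, regular P Y2 & chfe eps (cchC P Y1) (cchS P Y1) (cchC P Y2) (cchS P Y2)].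

Definition approximable b dT (T : measurableType dT) (P : probability T R) (Y1 Y2 : T -> V) :=
  exists (dT' : measure_display) (T' : measurableType dT') (P' : probability T' R) (Yg1 Yg2 : T' -> V)
         (m1 m2 : V) (K : 'M[R]_d),
    [/\ gaussian_vec P' Yg1 m1 K, gaussian_vec P' Yg2 m2 K,
        gaussian_approx mu b P Y1 P' Yg1 & gaussian_approx mu b P Y2 P' Yg2].

Lemma gaussian_approx_le b b' d1 (T1 : measurableType d1) (P : probability T1 R) (Y : T1 -> V)
    d2 (T2 : measurableType d2) (P' : probability T2 R) (Yg : T2 -> V) : b <= b' ->
  gaussian_approx mu b P Y P' Yg -> gaussian_approx mu b' P Y P' Yg.
Proof.
move=> bb' [ef eg ent [lsym lo]]; split => //.
  by move=> f g df dg; apply: le_trans (ent f g df dg) _; rewrite lee_fin.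
split.
  have -> : second_moment_mx P Y + b'%:M - second_moment_mx P' Yg =
      (second_moment_mx P Y + b%:M - second_moment_mx P' Yg) + (b' - b)%:M.
    by apply/matrixP => i j; rewrite !mxE mulrnBl; move: (b *+ _) (b' *+ _) => x y; ring.
  by rewrite /symmetric_mx linearD /= lsym tr_scalar_mx.
move=> u; have := lo u; rewrite !quadfDB.
have : b * nsq u <= b' * nsq u by rewrite ler_wpM2r// nsq_ge0.
lra.
Qed.

Lemma approximable_le b b' dT (T : measurableType dT) (P : probability T R) (Y1 Y2 : T -> V) :
  b <= b' -> approximable b P Y1 Y2 -> approximable b' P Y1 Y2.
Proof.
move=> bb' [dT' [T' [P' [Yg1 [Yg2 [m1 [m2 [K [G1 G2 A1 A2]]]]]]]]].
exists dT', T', P', Yg1, Yg2, m1, m2, K; split => //; exact: gaussian_approx_le bb' _.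
Qed.

Lemma regular_pair_le eps eps' dT (T : measurableType dT) (P : probability T R) (Y1 Y2 : T -> V) :
  eps <= eps' -> regular_pair eps P Y1 Y2 -> regular_pair eps' P Y1 Y2.
Proof.
move=> ee [r1 r2 fe]; split => // u v; have [h1 h2] := fe u v.
by split; [exact: le_trans h1 ee|exact: le_trans h2 ee].
Qed.

Lemma regular_approximable b dT (T : measurableType dT) (P : probability T R) (Y1 Y2 : T -> V) (K : 'M[R]_d) :
  regular P Y1 -> regular P Y2 ->
  K^T = K -> (forall x : V, l * nsq x <= quadf K x <= 4 * M * nsq x) ->
  (forall Y om omG, (Y = Y1) \/ (Y = Y2) ->
    (forall A, measurable A -> P (Y @^-1` A) = gconv om (Num.sqrt l) A) ->
    gaussian_law_of l K (vmean P Y) omG -> entropy_cov_close l b P Y K om omG) ->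
  approximable b P Y1 Y2.
Proof.
move=> r1 r2 KT bK close.
have lK x : l * nsq x <= quadf K x by have /andP[] := bK x.
have [om0 G0] := gaussian_law KT l0 lK (vzero R d).
have [omG1 G1] := gaussian_law KT l0 lK (vmean P Y1).
have [omG2 G2] := gaussian_law KT l0 lK (vmean P Y2).
have [om1 L1] := regular_law r1. have [om2 L2] := regular_law r2.
have [mg1 gv1 lg1] := gaussian_witness l0 KT lK G0 G1.
have [mg2 gv2 lg2] := gaussian_witness l0 KT lK G0 G2.
exists _, V, (gconv om0 (Num.sqrt l)), (fun x : V => vadd (vmean P Y1) x),
  (fun x : V => vadd (vmean P Y2) x), (vmean P Y1), (vmean P Y2), K; split.
- exact: gv1.
- exact: gv2.
- exact: (@entropy_cov_close_approx R d mu Hmu M l M0 l0 b _ _ P Y1 _ _ (gconv om0 (Num.sqrt l))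
    (fun x : V => vadd (vmean P Y1) x) K om1 omG1 (regular_measurable r1) (regular_finite r1)
    (regular_bound r1) L1 mg1 lg1 bK G1 (close _ _ _ (or_introl erefl) L1 G1)).
- exact: (@entropy_cov_close_approx R d mu Hmu M l M0 l0 b _ _ P Y2 _ _ (gconv om0 (Num.sqrt l))
    (fun x : V => vadd (vmean P Y2) x) K om2 omG2 (regular_measurable r2) (regular_finite r2)
    (regular_bound r2) L2 mg2 lg2 bK G2 (close _ _ _ (or_intror erefl) L2 G2)).
Qed.

Lemma approximable_small (delta : R) : 0 < delta -> exists2 eps : R, 0 < eps &
  forall dT (T : measurableType dT) (P : probability T R) (Y1 Y2 : T -> V),
    regular_pair eps P Y1 Y2 -> approximable delta P Y1 Y2.
Proof.
move=> delta0; have [eta [L [eta0 H]]] := near_gaussian_close (d := d) M0 l0 delta0.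
have [eps eps0 HK] := chfe_approx (d := d) M0 (ltW l0) L eta0.
exists eps => // dT T P Y1 Y2 [r1 r2 fe].
have [K [KT bK near]] := HK _ _ _ _ (regular_ch r1) (regular_ch r2) fe.
apply: (regular_approximable r1 r2 KT bK) => Y om omG YE law G.
have rY : regular P Y by case: YE => ->.
apply: H (regular_measurable rY) (regular_finite rY) (regular_bound rY) law bK G _.
by move=> t tL; have [n1 n2 n3 n4] := near t tL; case: YE => ->.
Qed.

(** The matrix [K] of the exact solution is fixed first and serves every tolerance, so the tolerance
    can tend to 0 with the Gaussians unchanged. *)
Lemma approximable_exact dT (T : measurableType dT) (P : probability T R) (Y1 Y2 : T -> V) :
  regular_pair 0 P Y1 Y2 -> approximable 0 P Y1 Y2.
Proof.
move=> [r1 r2 fe].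
have [K [KT bK EK]] := chfe_exact M0 (regular_ch r1) (regular_ch r2) fe (ltW l0).
apply: (regular_approximable r1 r2 KT bK) => Y om omG YE law G.
have all_delta delta : 0 < delta -> entropy_cov_close l delta P Y K om omG.
  move=> delta0; have [eta [L [eta0 H]]] := near_gaussian_close (d := d) M0 l0 delta0.
  have rY : regular P Y by case: YE => ->.
  apply: H (regular_measurable rY) (regular_finite rY) (regular_bound rY) law bK G _.
  by move=> t _; have [c1 k1 c2 k2] := EK t; case: YE => ->; rewrite ?c1 ?k1 ?c2 ?k2 subrr normr0 ltW.
split.
  by apply/ler_addgt0Pl => e e0; rewrite addr0; exact: (all_delta e e0).1.
move=> u; rewrite mul0r addr0; apply/ler_addgt0Pl => e e0.
have n0 : 0 < nsq u + 1 by rewrite ltr_wpDl// nsq_ge0.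
(* The tolerance [e / (nsq u + 1)] keeps the error term, proportional to [nsq u], below [e]. *)
apply: le_trans ((all_delta _ (divr_gt0 e0 n0)).2 u) _.
rewrite addrC lerD2r mulrAC ler_pdivrMr// ler_pM2l//; lra.
Qed.

Definition good_bounds (eps : R) : set R := [set b | 0 <= b /\
  forall dT (T : measurableType dT) (P : probability T R) (Y1 Y2 : T -> V),
    regular_pair eps P Y1 Y2 -> approximable b P Y1 Y2].

(** The infimum need not be admissible; the summand [eps] leaves room for an admissible bound just
    above it and vanishes with [eps]. The value 0 at [eps = 0] is justified by
    [approximable_exact]. *)
Definition best_bound (eps : R) : R := if eps <= 0 then 0 else inf (good_bounds eps) + eps.

Lemma good_bounds_le eps eps' : eps <= eps' -> good_bounds eps' `<=` good_bounds eps.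
Proof.
move=> ee b [b0 H]; split => // dT T P Y1 Y2 rp; apply: H; exact: regular_pair_le rp.
Qed.

Let lb eps : has_lbound (good_bounds eps). Proof. by exists 0 => b []. Qed.

Lemma best_bound_cvg0 : best_bound x @[x --> 0^'+] --> 0.
Proof.
apply/cvgrPdist_le => e e0.
have e2 : 0 < e / 2 by rewrite divr_gt0.
have [eps eps0 He] := approximable_small e2.
near=> x.
have x0 : 0 < x by near: x; exact: nbhs_right_gt.
have xe : x <= e / 2 by near: x; exact: nbhs_right_le.
have xeps : x <= eps by near: x; exact: nbhs_right_le.
have gd : good_bounds x (e / 2).
  by apply: (good_bounds_le xeps); split; [exact: ltW|exact: He].
rewrite sub0r normrN /best_bound [x <= 0]leNgt x0 /= ger0_norm.
  have := ge_inf (lb x) gd; lra.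
rewrite addr_ge0 ?(ltW x0)//; apply: lb_le_inf; first by exists (e / 2).
by move=> b [].
Unshelve. all: end_near. Qed.

(** The threshold comes from the tolerance 1: below it 1 is an admissible bound, so the infimum is
    over a nonempty set. *)
Lemma best_bound_approximable : exists2 eps0 : R, 0 < eps0 & forall eps, 0 <= eps < eps0 ->
  forall dT (T : measurableType dT) (P : probability T R) (Y1 Y2 : T -> V),
    regular_pair eps P Y1 Y2 -> approximable (best_bound eps) P Y1 Y2.
Proof.
have [eps0 e0 He] := approximable_small (@ltr01 R).
exists eps0 => // eps /andP[]; rewrite le_eqVlt => /predU1P[<-|ep] ee dT T P Y1 Y2 rp.
  by rewrite /best_bound lexx; exact: approximable_exact.
rewrite /best_bound [eps <= 0]leNgt ep /=.
have gd : good_bounds eps 1 by apply: (good_bounds_le (ltW ee)); split.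
have hi : has_inf (good_bounds eps) by split => //; exists 1.
have [b [b0 Hb] bi] := inf_adherent ep hi.
exact: approximable_le (ltW bi) (Hb _ _ _ _ _ rp).
Qed.

End UniformBound.

(** Mutual independence is used through the grouping [(X1, Z1)], [(X2, Z2)]: inside a pair to split
    off the noise, between pairs to factor the characteristic functions of [Y1] and [Y2]. *)
Lemma independent_sums_regular_pair (R : realType) (d : nat) (QZ1 QZ2 : 'M[R]_d) (M l eps : R)
    dT (T : measurableType dT) (P : probability T R) (X1 X2 Z1 Z2 : T -> d.-tuple R) :
  QZ1^T = QZ1 -> QZ2^T = QZ2 -> 0 < l ->
  (forall x : d.-tuple R, l * nsq x <= quadf QZ1 x) ->
  (forall x : d.-tuple R, l * nsq x <= quadf QZ2 x) ->
  let Y1 := fun w => vadd (X1 w) (Z1 w) in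
  let Y2 := fun w => vadd (X2 w) (Z2 w) in
  mutually_independent P (fun i : 'I_4 => nth X1 [:: X1; X2; Z1; Z2] i) ->
  gaussian_vec P Z1 (vzero R d) QZ1 -> gaussian_vec P Z2 (vzero R d) QZ2 ->
  finite_second_moment P Y1 -> finite_second_moment P Y2 ->
  (\sum_(i < d) expectation P (fun w => (tnth (Y1 w) i ^+ 2)%R) <= M%:E)%E ->
  (\sum_(i < d) expectation P (fun w => (tnth (Y2 w) i ^+ 2)%R) <= M%:E)%E ->
  eps_dependent P (fun w => vadd (Y1 w) (Y2 w)) (fun w => vsub (Y1 w) (Y2 w)) eps ->
  regular_pair M l eps P Y1 Y2.
Proof.
move=> s1 s2 l0 lQ1 lQ2 Y1 Y2 [mX ind] g1 g2 f1 f2 b1 b2 ed.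
have mX1 : measurable_fun setT X1 := mX (Ordinal (isT : (0 < 4)%N)).
have mX2 : measurable_fun setT X2 := mX (Ordinal (isT : (1 < 4)%N)).
have mZ1 : measurable_fun setT Z1 := mX (Ordinal (isT : (2 < 4)%N)).
have mZ2 : measurable_fun setT Z2 := mX (Ordinal (isT : (3 < 4)%N)).
have prod4 A1 A2 B1 B2 : measurable A1 -> measurable A2 -> measurable B1 -> measurable B2 ->
    P ((X1 @^-1` A1 `&` Z1 @^-1` B1) `&` (X2 @^-1` A2 `&` Z2 @^-1` B2)) =
    (P (X1 @^-1` A1) * P (Z1 @^-1` B1) * (P (X2 @^-1` A2) * P (Z2 @^-1` B2)))%E.
  move=> mA1 mA2 mB1 mB2.
  have := ind (fun i : 'I_4 => nth A1 [:: A1; A2; B1; B2] i).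
  rewrite !big_ord_recl !big_ord0 /= setIT mule1 => h.
  rewrite setIACA -setIA h; last by case=> -[|[|[|[|]]]].
  by rewrite !muleA; congr (_ * _)%E; rewrite -!muleA; congr (_ * _)%E; rewrite muleC.
have [i1 i2 i12] := indep_pair mX1 mZ1 mX2 mZ2 prod4.
have mY1 := measurable_sumV mX1 mZ1. have mY2 := measurable_sumV mX2 mZ2.
have i12Y : indep P Y1 Y2.
  by apply: (indep_comp (@measurable_vadd R d) (@measurable_vadd R d)) i12.
have c1 := chreg_centered mY1 f1 b1 (chY_modulus lQ1 mX1 i1 g1).
have c2 := chreg_centered mY2 f2 b2 (chY_modulus lQ2 mX2 i2 g2).
split.
- exact: Regular mY1 f1 b1 (smooth_law s1 l0 lQ1 mX1 i1 g1) c1.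
- exact: Regular mY2 f2 b2 (smooth_law s2 l0 lQ2 mX2 i2 g2) c2.
- exact (eps_dependent_chfe mY1 mY2 i12Y ed).
Qed.

Theorem theorem4 (R : realType) (d : nat)
  (mu : {measure set (d.-tuple R) -> \bar R}) (Hmu : lebesgue_vec mu)
  (QZ1 QZ2 : 'M[R]_d) (HQ1 : posdef QZ1) (HQ2 : posdef QZ2) (M : R) :
  exists eps0 : R, 0 < eps0 /\
  exists B : R -> R, B 0 = 0 /\ B x @[x --> 0^'+] --> 0 /\
  forall (dT : measure_display) (T : measurableType dT) (P : probability T R)
         (X1 X2 Z1 Z2 : T -> d.-tuple R),
    let Y1 := fun w => vadd (X1 w) (Z1 w) in
    let Y2 := fun w => vadd (X2 w) (Z2 w) in
    mutually_independent P
      (fun i : 'I_4 => nth X1 [:: X1; X2; Z1; Z2] i) ->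
    gaussian_vec P Z1 (@vzero R d) QZ1 ->
    gaussian_vec P Z2 (@vzero R d) QZ2 ->
    finite_second_moment P Y1 -> finite_second_moment P Y2 ->
    (\sum_(i < d) expectation P (fun w => (tnth (Y1 w) i ^+ 2)%R) <= M%:E)%E ->
    (\sum_(i < d) expectation P (fun w => (tnth (Y2 w) i ^+ 2)%R) <= M%:E)%E ->
    forall eps : R, 0 <= eps < eps0 ->
    eps_dependent P (fun w => vadd (Y1 w) (Y2 w)) (fun w => vsub (Y1 w) (Y2 w)) eps ->
    exists (dT' : measure_display) (T' : measurableType dT')
           (P' : probability T' R) (Yg1 Yg2 : T' -> d.-tuple R)
           (m1 m2 : d.-tuple R) (K : 'M[R]_d),
      gaussian_vec P' Yg1 m1 K /\ gaussian_vec P' Yg2 m2 K /\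
      (* i = 1 *)
      (exists f, density_of mu P Y1 f) /\ (exists g, density_of mu P' Yg1 g) /\
      (forall f g, density_of mu P Y1 f -> density_of mu P' Yg1 g ->
         (`| diff_entropy mu f - diff_entropy mu g | <= (B eps)%:E)%E) /\
      loewner_le (second_moment_mx P' Yg1)
                 (second_moment_mx P Y1 + (B eps)%:M) /\
      (* i = 2 *)
      (exists f, density_of mu P Y2 f) /\ (exists g, density_of mu P' Yg2 g) /\
      (forall f g, density_of mu P Y2 f -> density_of mu P' Yg2 g ->
         (`| diff_entropy mu f - diff_entropy mu g | <= (B eps)%:E)%E) /\
      loewner_le (second_moment_mx P' Yg2)
                 (second_moment_mx P Y2 + (B eps)%:M).
Proof.
have [l1 l10 lQ1] := posdef_coercive HQ1.
have [l2 l20 lQ2] := posdef_coercive HQ2.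
(* A noise level common to both variables, so that both densities are smoothed at the same scale. *)
pose l := Num.min l1 l2; have l0 : 0 < l by rewrite lt_min l10.
have lQ1' x : l * nsq x <= quadf QZ1 x.
  by apply: le_trans (lQ1 x); rewrite ler_wpM2r ?nsq_ge0// ge_min lexx.
have lQ2' x : l * nsq x <= quadf QZ2 x.
  by apply: le_trans (lQ2 x); rewrite ler_wpM2r ?nsq_ge0// ge_min lexx orbT.
(* The bound is chosen before the laws, when nothing is known of the sign of [M]. *)
pose M' := Num.max M 0; have M0 : 0 <= M' by rewrite le_max lexx orbT.
have MM' : M <= M' by rewrite le_max lexx.
have [eps0 eps00 H] := best_bound_approximable Hmu M0 l0.
exists eps0; split => //; exists (best_bound mu M' l); split; first by rewrite /best_bound lexx.
split; first exact: best_bound_cvg0.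
move=> dT T P X1 X2 Z1 Z2 Y1 Y2 ind g1 g2 f1 f2 b1 b2 eps epsb ed.
have b1' : (\sum_(i < d) expectation P (fun w => (tnth (Y1 w) i ^+ 2)%R) <= M'%:E)%E.
  by apply: le_trans b1 _; rewrite lee_fin.
have b2' : (\sum_(i < d) expectation P (fun w => (tnth (Y2 w) i ^+ 2)%R) <= M'%:E)%E.
  by apply: le_trans b2 _; rewrite lee_fin.
have rp := independent_sums_regular_pair HQ1.1 HQ2.1 l0 lQ1' lQ2' ind g1 g2 f1 f2 b1' b2' ed.
have [dT' [T' [P' [Yg1 [Yg2 [m1 [m2 [K [G1 G2 [? ? ? ?] [? ? ? ?]]]]]]]]]] := H eps epsb _ _ _ _ _ rp.
by exists dT', T', P', Yg1, Yg2, m1, m2, K.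
Qed.
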